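(* Let $A(t,\xi)\in\mathbb C^{d\times d}$, $t\ge 0$, $\xi\in\mathbb R^n$, be the symbol of the system $\mathrm D_tU=A(t,\mathrm D_x)U$ and let $\mathcal E(t,s,\xi)$ be its fundamental solution in Fourier space, i.e. $\mathrm D_t\mathcal E(t,s,\xi)=A(t,\xi)\mathcal E(t,s,\xi)$, $\mathcal E(s,s,\xi)=\mathrm I$. Assume that $A$ satisfies the uniform strict hyperbolicity assumption and the subprincipal assumption (with constants $\kappa_\pm$) of the context. Then for any integer $k>\kappa_--\kappa_++1$ there is a zone constant $N$ such that within $\mathcal Z_{\rm hyp}(N)$ the fundamental solution $\mathcal E(t,t_\xi,\xi)$ is representable as $$\mathcal E(t,t_\xi,\xi)=M(t,\xi)N_k(t,\xi)\widetilde{\mathcal E}_k(t,t_\xi,\xi)\mathcal Q_k(t,t_\xi,\xi)N_k^{-1}(t_\xi,\xi)M^{-1}(t_\xi,\xi)$$ in terms of the diagonaliser $M$ of the hyperbolic principal symbol, the matrices $N_k$ of the diagonalisation scheme, the diagonal matrices $$\widetilde{\mathcal E}_k(t,t_\xi,\xi)=\exp\left(\mathrm i\int_{t_\xi}^t\big(\mathcal D(\tau,\xi)+F_{k-1}(\tau,\xi)\big)\,\mathrm d\tau\right)$$ satisfying the uniform bound $$\|\widetilde{\mathcal E}_k(t,t_\xi,\xi)\|\lesssim_{N,k}\left(\frac{1+t}{1+t_\xi}\right)^{-\kappa_+},\qquad t\ge t_\xi,$$ and matrices $\mathcal Q_k(t,s,\xi)$ that are uniformly bounded and uniformly invertible within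 $\mathcal Z_{\rm hyp}(N)$ and satisfy the symbolic estimates $$\|\mathrm D_\xi^\alpha\mathcal Q_k(t,t_\xi,\xi)\|\lesssim_{N,k}|\xi|^{-|\alpha|},\qquad t\ge t_\xi,$$ for all multi-indices $\alpha$ with $|\alpha|\le k-1+\kappa_+-\kappa_-$.
   Context: Notation: $\mathrm D=-\mathrm i\partial$; $f\lesssim_{k} g$ means $f\le C_k g$ with a constant $C_k$ depending only on the indicated parameters $k$ (and on the given system), uniformly in the arguments. For a matrix $B$, $\operatorname{diag}B$ is its diagonal part; inequalities and imaginary parts of diagonal matrices are understood entrywise on the diagonal. For a zone constant $N>0$: $\mathcal Z_{\rm hyp}(N)=\{(t,\xi)\in\mathbb R_+\times\mathbb R^n:(1+t)|\xi|\ge N\}$, and $t_\xi=\max\{N/|\xi|-1,0\}$ for $\xi\neq0$. The symbol class $\mathcal S\{m_1,m_2\}$ is the union over $N$ of the sets of $a\in C^\infty(\mathcal Z_{\rm hyp}(N))$ with $|\mathrm D_t^k\mathrm D_\xi^\alpha a(t,\xi)|\lesssim_{k,\alpha,N}|\xi|^{m_1-|\alpha|}(1+t)^{-m_2-k}$ for all $k,\alpha$; $\mathcal S\{m_1,m_2\}\otimes\mathbb C^{d\times d}$ denotes matrices with such entries. Uniform strict hyperbolicity assumption: there is a positively homogeneous $A_{\rm hom}\in\mathcal S\{1,0\}\otimes\mathbb C^{d\times d}$ (i.e. $A_{\rm hom}(t,\rho\xi)=\rho A_{\rm hom}(t,\xi)$ for $\rho>0$), the hyperbolic principal symbol, such that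 $A-A_{\rm hom}\in\mathcal S\{0,1\}\otimes\mathbb C^{d\times d}$ and the eigenvalues $\lambda_1(t,\xi),\ldots,\lambda_d(t,\xi)$ of $A_{\rm hom}(t,\xi)$ are real and satisfy $|\lambda_i(t,\xi)-\lambda_j(t,\xi)|\ge\delta|\xi|$ for some $\delta>0$, all $t\ge0$, all $\xi$ and all $i\ne j$. It is known that then there is $M\in\mathcal S\{0,0\}\otimes\mathbb C^{d\times d}$ with $M^{-1}\in\mathcal S\{0,0\}\otimes\mathbb C^{d\times d}$ and $M^{-1}A_{\rm hom}M=\mathcal D:=\operatorname{diag}(\lambda_1,\ldots,\lambda_d)$; such an $M$ is fixed. Subprincipal assumption: with $F_0=\operatorname{diag}\big(M^{-1}(A-A_{\rm hom})M+(\mathrm D_tM^{-1})M\big)$ modulo $\mathcal S\{-1,2\}\otimes\mathbb C^{d\times d}$ (the hyperbolic subprincipal symbol), there are constants $\kappa_\pm\in\mathbb R$ and $C_\pm\in\mathbb R$ such that, for all $t\ge s\ge t_\xi$, $$\kappa_+\log\frac{1+t}{1+s}+C_+\le\operatorname{Im}\int_s^tF_0(\tau,\xi)\,\mathrm d\tau\le\kappa_-\log\frac{1+t}{1+s}+C_-.$$ Diagonalisation scheme (known): put $R_0=M^{-1}(A-A_{\rm hom})M+(\mathrm D_tM^{-1})M\in\mathcal S\{0,1\}\otimes\mathbb C^{d\times d}$ and $F_0=\operatorname{diag}R_0$. For each $k\ge1$ there are $N_k\in\mathcal S\{0,0\}\otimes\mathbb C^{d\times d}$ with $N_k^{-1}\in\mathcal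 S\{0,0\}\otimes\mathbb C^{d\times d}$ for a sufficiently large zone constant $N$, a diagonal $F_{k-1}\in\mathcal S\{0,1\}\otimes\mathbb C^{d\times d}$ and $R_k\in\mathcal S\{-k,k+1\}\otimes\mathbb C^{d\times d}$ such that the operator identity $$(\mathrm D_t-\mathcal D-R_0)N_k=N_k(\mathrm D_t-\mathcal D-F_{k-1}-R_k)$$ holds, with $N_1-\mathrm I\in\mathcal S\{-1,1\}\otimes\mathbb C^{d\times d}$ and, for $k>1$, $F_{k-1}-F_{k-2}\in\mathcal S\{1-k,k\}\otimes\mathbb C^{d\times d}$ and $N_k-N_{k-1}\in\mathcal S\{-k,k\}\otimes\mathbb C^{d\times d}$.
   Formalization: The estimates for the ξ-derivatives of Q_k(t,t_ξ,ξ) are stated on the zone minus the sphere |ξ| = N, where t_ξ has a kink and the composite is in general not differentiable; for α = 0 the uniform bound covers the sphere. *)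

(* Defs.v *)
From HB Require Import structures.
From mathcomp Require Import all_boot all_order all_algebra.
From mathcomp Require Import all_classical all_reals all_analysis.
From mathcomp.real_closed Require Export complex.

Set Implicit Arguments.
Unset Strict Implicit.
Unset Printing Implicit Defensive.

Import Order.TTheory GRing.Theory Num.Theory.
Import numFieldNormedType.Exports.
Local Open Scope classical_set_scope.
Local Open Scope ring_scope.
Local Open Scope complex_scope.

(** Complex-valued functions of real variables are treated through their real
    and imaginary parts. *)

Section Preliminaries.
Context {R : realType}.

Definition enorm n (xi : 'rV[R]_n) : R := Num.sqrt (\sum_(j < n) xi ord0 j ^+ 2).

(* All bounds below are up to multiplicative constants that may depend on the
   size of the matrices, so the choice of matrix norm is immaterial. *)
Definition cmxnorm m p (B : 'M[R[i]]_(m, p)) : R :=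
  \big[Num.max/0]_(i < m) \big[Num.max/0]_(j < p) Normc.normc (B i j).

Definition cexp (z : R[i]) : R[i] :=
  expR (complex.Re z) * cos (complex.Im z) +i* (expR (complex.Re z) * sin (complex.Im z)).

(* Used only for [a <= b]. *)
Definition cintegral (a b : R) (f : R -> R[i]) : R[i] :=
  (\int[lebesgue_measure]_(x in `[a, b]) complex.Re (f x))
  +i* (\int[lebesgue_measure]_(x in `[a, b]) complex.Im (f x)).

Definition diag_part d (B : 'M[R[i]]_d) : 'M[R[i]]_d := diag_mx (\row_i B i i).

End Preliminaries.

(** ** Partial derivatives on a subset of space-time

    The domains of interest ([t >= 0], hyperbolic zones) are not open.  On such
    a domain [D] the difference quotients at [p] are restricted to increments
    staying in [D]; at interior points of [D] these are the usual partial
    derivatives, at [t = 0] the one-sided ones. *)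

Section Derivatives.
Context {R : realType} {n : nat}.
Implicit Types (D : set (R * 'rV[R]_n)) (p : R * 'rV[R]_n).

(* [None] is the time direction, [Some j] the [j]-th frequency direction. *)
Definition dir (o : option 'I_n) : R * 'rV[R]_n :=
  if o is Some j then (0, delta_mx ord0 j) else (1, 0).

Definition increments D o p : set_system R :=
  within [set h : R | D (p + h *: dir o)] (0^').

Definition quotient (g : R * 'rV[R]_n -> R) o p (h : R) : R :=
  h^-1 * (g (p + h *: dir o) - g p).

Definition partial_exists D o (f : R * 'rV[R]_n -> R[i]) p : Prop :=
  cvg (quotient (fun q => complex.Re (f q)) o p @ increments D o p) /\
  cvg (quotient (fun q => complex.Im (f q)) o p @ increments D o p).

(* D = -i times the partial derivative. *)
Definition Dpartial D o (f : R * 'rV[R]_n -> R[i]) : R * 'rV[R]_n -> R[i] :=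
  fun p => - 'i * (lim (quotient (fun q => complex.Re (f q)) o p @ increments D o p)
                   +i* lim (quotient (fun q => complex.Im (f q)) o p @ increments D o p)).

(* The last letter of the word is the direction differentiated first. *)
Definition Dword D (w : seq (option 'I_n)) (f : R * 'rV[R]_n -> R[i]) :=
  foldr (Dpartial D) f w.

Definition mi_size (alpha : {ffun 'I_n -> nat}) : nat := (\sum_j alpha j)%N.

Definition mi_word (alpha : {ffun 'I_n -> nat}) : seq 'I_n :=
  flatten [seq nseq (alpha j) j | j <- enum 'I_n].

Definition Dxi D alpha f := Dword D (map Some (mi_word alpha)) f.

Definition Dt_Dxi D k alpha f := Dword D (nseq k None) (Dxi D alpha f).

Definition smooth_on D (f : R * 'rV[R]_n -> R[i]) : Prop :=
  forall w,
    [/\ {within D, continuous (fun p => complex.Re (Dword D w f p))},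
        {within D, continuous (fun p => complex.Im (Dword D w f p))} &
        forall o p, D p -> partial_exists D o (Dword D w f) p].

(* Continuous differentiability in the frequency variable, up to order [r]. *)
Definition xi_differentiable_on D (r : R) (f : R * 'rV[R]_n -> R[i]) : Prop :=
  (forall (w : seq 'I_n) (j : 'I_n) p, (size (j :: w))%:R <= r -> D p ->
     partial_exists D (Some j) (Dword D (map Some w) f) p) /\
  (forall (w : seq 'I_n) (t : R), (size w)%:R <= r ->
     {within [set xi | D (t, xi)],
        continuous (fun xi => complex.Re (Dword D (map Some w) f (t, xi)))} /\
     {within [set xi | D (t, xi)],
        continuous (fun xi => complex.Im (Dword D (map Some w) f (t, xi)))}).

Definition entry m q (B : R -> 'rV[R]_n -> 'M[R[i]]_(m, q)) i j :
  R * 'rV[R]_n -> R[i] := fun p => B p.1 p.2 i j.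

Definition Dxi_mx m q D alpha (B : R -> 'rV[R]_n -> 'M[R[i]]_(m, q)) :
  R -> 'rV[R]_n -> 'M[R[i]]_(m, q) :=
  fun t xi => \matrix_(i, j) Dxi D alpha (entry B i j) (t, xi).

Definition nonneg_time : set (R * 'rV[R]_n) := [set p | 0 <= p.1].

Definition Dt_exists m q (B : R -> 'rV[R]_n -> 'M[R[i]]_(m, q)) t xi : Prop :=
  forall i j, partial_exists nonneg_time None (entry B i j) (t, xi).

Definition Dt_mx m q (B : R -> 'rV[R]_n -> 'M[R[i]]_(m, q)) :
  R -> 'rV[R]_n -> 'M[R[i]]_(m, q) :=
  fun t xi => \matrix_(i, j) Dpartial nonneg_time None (entry B i j) (t, xi).

End Derivatives.

Section Symbols.
Context {R : realType} {n : nat}.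

Definition Zhyp (N : R) : set (R * 'rV[R]_n) :=
  [set p | 0 <= p.1 /\ N <= (1 + p.1) * enorm p.2].

Definition txi (N : R) (xi : 'rV[R]_n) : R := Num.max (N / enorm xi - 1) 0.

(* Symbols are only meaningful for large zone constants; their values outside
   the zone are irrelevant. *)
Definition in_some_Zhyp (P : R -> 'rV[R]_n -> Prop) : Prop :=
  exists2 N : R, 0 < N & forall t xi, Zhyp N (t, xi) -> P t xi.

Definition symbol_on (N m1 m2 : R) (a : R * 'rV[R]_n -> R[i]) : Prop :=
  smooth_on (Zhyp N) a /\
  forall (k : nat) (alpha : {ffun 'I_n -> nat}), exists C : R,
    forall t xi, Zhyp N (t, xi) ->
      Normc.normc (Dt_Dxi (Zhyp N) k alpha a (t, xi))
      <= C * enorm xi `^ (m1 - (mi_size alpha)%:R) * (1 + t) `^ (- m2 - k%:R).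

Definition symbol (m1 m2 : R) (a : R * 'rV[R]_n -> R[i]) : Prop :=
  exists2 N : R, 0 < N & symbol_on N m1 m2 a.

Definition symbol_mx m q (m1 m2 : R) (B : R -> 'rV[R]_n -> 'M[R[i]]_(m, q)) : Prop :=
  forall i j, symbol m1 m2 (entry B i j).

Definition bi_symbol_mx d (B : R -> 'rV[R]_n -> 'M[R[i]]_d) : Prop :=
  [/\ symbol_mx 0 0 B,
      in_some_Zhyp (fun t xi => B t xi \in unitmx) &
      symbol_mx 0 0 (fun t xi => invmx (B t xi))].

End Symbols.

Section HyperbolicSystems.
Context {R : realType} {n d : nat}.
Local Notation matrix_symbol := (R -> 'rV[R]_n -> 'M[R[i]]_d).
Implicit Types (A Ahom M : matrix_symbol) (lambda : 'I_d -> R -> 'rV[R]_n -> R).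

Definition fundamental_solution A (E : R -> R -> 'rV[R]_n -> 'M[R[i]]_d) : Prop :=
  forall (s : R) (xi : 'rV[R]_n), 0 <= s ->
    E s s xi = 1%:M /\
    forall t : R, 0 <= t ->
      Dt_exists (fun t => E t s) t xi /\
      Dt_mx (fun t => E t s) t xi = A t xi *m E t s xi.

Definition uniformly_strictly_hyperbolic A Ahom lambda : Prop :=
  [/\ symbol_mx 1 0 Ahom,
      forall (rho t : R) (xi : 'rV[R]_n), 0 < rho -> 0 <= t -> xi != 0 ->
        Ahom t (rho *: xi) = rho%:C *: Ahom t xi,
      symbol_mx 0 1 (fun t xi => A t xi - Ahom t xi),
      forall (t : R) (xi : 'rV[R]_n), 0 <= t -> xi != 0 ->
        forall z : R[i],
          eigenvalue (Ahom t xi) z <-> exists i, z = (lambda i t xi)%:C &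
      exists2 delta : R, 0 < delta &
        forall (t : R) (xi : 'rV[R]_n) (i j : 'I_d), 0 <= t -> xi != 0 -> i != j ->
          delta * enorm xi <= `|lambda i t xi - lambda j t xi|].

Definition Dsym lambda : matrix_symbol :=
  fun t xi => diag_mx (\row_i (lambda i t xi)%:C).

Definition diagonaliser Ahom lambda M : Prop :=
  bi_symbol_mx M /\
  in_some_Zhyp (fun t xi => invmx (M t xi) *m Ahom t xi *m M t xi = Dsym lambda t xi).

Definition R0sym A Ahom M : matrix_symbol := fun t xi =>
  invmx (M t xi) *m (A t xi - Ahom t xi) *m M t xi
  + Dt_mx (fun t xi => invmx (M t xi)) t xi *m M t xi.

Definition F0sym A Ahom M : matrix_symbol := fun t xi => diag_part (R0sym A Ahom M t xi).

Definition subprincipal A Ahom M (kappap kappam : R) : Prop :=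
  exists N Cp Cm : R, 0 < N /\
    forall (xi : 'rV[R]_n) (s t : R) (i : 'I_d), xi != 0 -> txi N xi <= s -> s <= t ->
      let I := complex.Im (cintegral s t (fun tau => F0sym A Ahom M tau xi i i)) in
      kappap * ln ((1 + t) / (1 + s)) + Cp <= I /\
      I <= kappam * ln ((1 + t) / (1 + s)) + Cm.

(* The operator D_t - B applied to V. *)
Definition Dt_minus (B : matrix_symbol) (V : R -> 'rV[R]_n -> 'cV[R[i]]_d) :
  R -> 'rV[R]_n -> 'cV[R[i]]_d :=
  fun t xi => Dt_mx V t xi - B t xi *m V t xi.

(* [Nd k], [F k], [Rem k] are N_k, F_k, R_k; [Nd 0] and [Rem 0] play no role. *)
Definition diagonalisation_scheme A Ahom lambda M (Nd F Rem : nat -> matrix_symbol) : Prop :=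
  [/\ in_some_Zhyp (fun t xi => F 0%N t xi = F0sym A Ahom M t xi),
      symbol_mx (-1) 1 (fun t xi => Nd 1%N t xi - 1%:M),
      forall k : nat, (1 < k)%N ->
        symbol_mx (1 - k%:R) k%:R (fun t xi => F k.-1 t xi - F k.-2 t xi) /\
        symbol_mx (- k%:R) k%:R (fun t xi => Nd k t xi - Nd k.-1 t xi),
      forall k : nat, (1 <= k)%N ->
        [/\ bi_symbol_mx (Nd k),
            in_some_Zhyp (fun t xi => is_diag_mx (F k.-1 t xi)),
            symbol_mx 0 1 (F k.-1) &
            symbol_mx (- k%:R) (k%:R + 1) (Rem k)] &
      forall k : nat, (1 <= k)%N ->
        in_some_Zhyp (fun t xi =>
          forall V : R -> 'rV[R]_n -> 'cV[R[i]]_d, Dt_exists V t xi ->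
            Dt_minus (fun t xi => Dsym lambda t xi + R0sym A Ahom M t xi)
                     (fun t xi => Nd k t xi *m V t xi) t xi
            = Nd k t xi *m
              Dt_minus (fun t xi => Dsym lambda t xi + F k.-1 t xi + Rem k t xi) V t xi)].

(* Exponential of i times the integral of the diagonal matrix D + F, taken
   entrywise on the diagonal. *)
Definition Etilde lambda (F : matrix_symbol) (t s : R) (xi : 'rV[R]_n) : 'M[R[i]]_d :=
  diag_mx (\row_i
    cexp ('i * cintegral s t (fun tau => (Dsym lambda tau xi + F tau xi) i i))).

End HyperbolicSystems.

(* Main.v *)
Require Import Defs.
From mathcomp Require Import all_boot all_order all_algebra.
From mathcomp Require Import all_classical all_reals all_analysis.
From mathcomp Require Import ring lra.

Import Order.TTheory GRing.Theory Num.Theory.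
Import numFieldNormedType.Exports.
Local Open Scope classical_set_scope.
Local Open Scope ring_scope.
Local Open Scope complex_scope.

Set Implicit Arguments.
Unset Strict Implicit.
Unset Printing Implicit Defensive.

(* Put
     Q(t,s) = E_k(t,s)^-1 N_k(t)^-1 M(t)^-1 E(t,s) M(s) N_k(s),
   where E_k is the diagonal exponential.  Then Q(s,s) = I and D_t Q = P Q with
   P = E_k^-1 R_k E_k.  As F_{k-1} - F_0 is integrable in time uniformly in the
   zone, the subprincipal condition controls both E_k and its inverse, and P is
   O(((1+t)/(1+s))^kappa |xi|^-k (1+t)^(-k-1)) with kappa = kappam - kappap < k - 1.
   In the variable y = ln((1+t)/(1+s)) >= 0 the equation reads dQ/dy = B Q with
   B = O(e^-y / N), so Q is close to I once N is large.

   For s = t_xi a frequency derivative of E_k costs a factor 1 + t rather than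
   1/|xi|, that is, a loss of (1+t)|xi| >= e^y with respect to symbols.  After
   |alpha| <= k - 1 - kappa derivatives B is still O(e^-y), and
   d_xi Q = Q int_0^y Q^-1 (d_xi B) Q gives the estimates of Q by induction. *)

(** The obstacle is the initial time t_xi: it depends on xi, so that frequency derivatives of Q(t,
    t_xi, xi) also hit the lower limit of every phase integral, and it has a kink on |xi| = N. In
    the variables (y, xi) with 1 + t = (1 + t_xi) e^y the initial surface is y = 0 for all xi:
    derivatives pass under integrals from 0 without boundary terms, and the zone without the kink
    becomes the product of y >= 0 with an open set of frequencies. On the way back a frequency
    derivative at fixed t picks up a y-derivative, hence y-derivatives are estimated as well
    although only those in xi are claimed.

    None of the domains is open, so derivatives are limits along admissible increments, and symbol
    estimates are given for one order of differentiation only. They extend to every order on a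
    strictly smaller zone, where mixed derivatives commute by second differences on a quadrant.

    Two zone constants [N1] < [N] result: on the zone of [N1] the hypotheses hold and all constants
    are fixed; [N] is enlarged afterwards until Q stays near I. *)

Local Notation cRe := (@complex.Re _).
Local Notation cIm := (@complex.Im _).
Local Notation normc := Normc.normc.

(** * Limits of complex-valued functions *)

Section ComplexLimits.
Context {R : realType}.
Implicit Types (z w : R[i]).

Lemma cReD z w : cRe (z + w) = cRe z + cRe w. Proof. by case: z w => ? ? []. Qed.
Lemma cImD z w : cIm (z + w) = cIm z + cIm w. Proof. by case: z w => ? ? []. Qed.
Lemma cReN z : cRe (- z) = - cRe z. Proof. by case: z. Qed.
Lemma cImN z : cIm (- z) = - cIm z. Proof. by case: z. Qed.
Lemma cReM z w : cRe (z * w) = cRe z * cRe w - cIm z * cIm w.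
Proof. by case: z w => ? ? []. Qed.
Lemma cImM z w : cIm (z * w) = cRe z * cIm w + cIm z * cRe w.
Proof. by case: z w => ? ? []. Qed.

Lemma eq_complexP z w : cRe z = cRe w -> cIm z = cIm w -> z = w.
Proof. by case: z w => a b [c e] /= -> ->. Qed.

Lemma normc_ge0 z : 0 <= normc z.
Proof. by case: z => a b; rewrite /Normc.normc sqrtr_ge0. Qed.

Lemma normc_eq0 z : (normc z == 0) = (z == 0).
Proof.
by apply/eqP/eqP => [/Normc.eq0_normc//|->]; rewrite Normc.normc0.
Qed.

Lemma absRe_le z : `|cRe z| <= normc z.
Proof.
case: z => a b /=; rewrite -sqrtr_sqr ler_sqrt ?addr_ge0 ?sqr_ge0//.
by rewrite lerDl sqr_ge0.
Qed.

Lemma absIm_le z : `|cIm z| <= normc z.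
Proof.
case: z => a b /=; rewrite -sqrtr_sqr ler_sqrt ?addr_ge0 ?sqr_ge0//.
by rewrite lerDr sqr_ge0.
Qed.

Lemma normc_le z : normc z <= `|cRe z| + `|cIm z|.
Proof.
case: z => a b /=.
rewrite -(@ler_sqr R) ?nnegrE ?sqrtr_ge0 ?addr_ge0//.
rewrite sqr_sqrtr ?addr_ge0 ?sqr_ge0// sqrrD !real_normK ?num_real//.
by rewrite -addrA lerD2l lerDr mulrn_wge0// mulr_ge0.
Qed.

Lemma le_normcB z w : normc (z - w) <= normc z + normc w.
Proof. by apply: le_trans (le_normcD _ _) _; rewrite normcN. Qed.

Lemma normc_real (a : R) : normc a%:C = `|a|.
Proof. by rewrite /= expr0n/= addr0 sqrtr_sqr. Qed.

Lemma normc_i : normc ('i : R[i]) = 1.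
Proof. by rewrite /= expr0n/= expr1n add0r sqrtr1. Qed.

Lemma normc_sum I (r : seq I) (P : pred I) (f : I -> R[i]) :
  normc (\sum_(i <- r | P i) f i) <= \sum_(i <- r | P i) normc (f i).
Proof.
elim/big_ind2: _ => //; first by rewrite Normc.normc0.
by move=> x a y b xa yb; apply: le_trans (le_normcD _ _) _; exact: lerD.
Qed.

(** Componentwise, as in [partial_exists] and [Dpartial]; [ccvgP] recovers the formulation with the
    modulus. *)
Definition ccvg {T} (F : set_system T) (f : T -> R[i]) (l : R[i]) : Prop :=
  cRe (f x) @[x --> F] --> cRe l /\ cIm (f x) @[x --> F] --> cIm l.

Section Filters.
Context {T : Type} {F : set_system T} {FF : Filter F}.
Implicit Types (f g : T -> R[i]) (l : R[i]).

Lemma ccvg_cst l : ccvg F (fun=> l) l.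
Proof. by split; exact: cvg_cst. Qed.

Lemma ccvgD f g l l' : ccvg F f l -> ccvg F g l' -> ccvg F (fun x => f x + g x) (l + l').
Proof.
move=> [fr fi] [gr gi]; split.
  rewrite cReD (_ : (fun x => _) = (fun x => cRe (f x) + cRe (g x))); first exact: cvgD.
  by apply/funext => x; rewrite cReD.
rewrite cImD (_ : (fun x => _) = (fun x => cIm (f x) + cIm (g x))); first exact: cvgD.
by apply/funext => x; rewrite cImD.
Qed.

Lemma ccvgN f l : ccvg F f l -> ccvg F (fun x => - f x) (- l).
Proof.
move=> [fr fi]; split.
  rewrite cReN (_ : (fun x => _) = (fun x => - cRe (f x))); first exact: cvgN.
  by apply/funext => x; rewrite cReN.
rewrite cImN (_ : (fun x => _) = (fun x => - cIm (f x))); first exact: cvgN.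
by apply/funext => x; rewrite cImN.
Qed.

Lemma ccvgM f g l l' : ccvg F f l -> ccvg F g l' -> ccvg F (fun x => f x * g x) (l * l').
Proof.
move=> [fr fi] [gr gi]; split.
  rewrite cReM (_ : (fun x => _) =
    (fun x => cRe (f x) * cRe (g x) - cIm (f x) * cIm (g x))).
    by apply: cvgB; exact: cvgM.
  by apply/funext => x; rewrite cReM.
rewrite cImM (_ : (fun x => _) =
  (fun x => cRe (f x) * cIm (g x) + cIm (f x) * cRe (g x))).
  by apply: cvgD; exact: cvgM.
by apply/funext => x; rewrite cImM.
Qed.

Lemma ccvg_sum I (r : seq I) (f : I -> T -> R[i]) (l : I -> R[i]) :
  (forall i, ccvg F (f i) (l i)) ->
  ccvg F (fun x => \sum_(i <- r) f i x) (\sum_(i <- r) l i).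
Proof.
move=> fl; elim: r => [|i r ih].
  rewrite big_nil (_ : (fun x => _) = fun=> 0); first exact: ccvg_cst.
  by apply/funext => x; rewrite big_nil.
rewrite big_cons (_ : (fun x => _) = (fun x => f i x + \sum_(j <- r) f j x)).
  exact: ccvgD.
by apply/funext => x; rewrite big_cons.
Qed.

Lemma ccvgP f l :
  ccvg F f l <-> forall e : R, 0 < e -> \forall x \near F, normc (f x - l) <= e.
Proof.
split=> [[/cvgrPdist_le fr /cvgrPdist_le fi] e e0|fl].
  have e2 : 0 < e / 2 by rewrite divr_gt0.
  near=> x; apply: le_trans (normc_le _) _.
  rewrite cReD cImD cReN cImN [leRHS]splitr; apply: lerD.
    by rewrite distrC; near: x; exact: fr.
  by rewrite distrC; near: x; exact: fi.
split; apply/cvgrPdist_le => e e0; near=> x.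
  rewrite distrC -cReN -cReD; apply: le_trans (absRe_le _) _.
  by near: x; exact: fl.
rewrite distrC -cImN -cImD; apply: le_trans (absIm_le _) _.
by near: x; exact: fl.
Unshelve. all: by end_near. Qed.

Lemma ccvg_near f g l :
  (\forall x \near F, f x = g x) -> ccvg F f l -> ccvg F g l.
Proof.
move=> fg /ccvgP fl; apply/ccvgP => e e0.
near=> x; rewrite -(near fg x)//; near: x; exact: fl.
Unshelve. all: by end_near. Qed.

Lemma ccvg_ext f g l : (forall x, f x = g x) -> ccvg F f l -> ccvg F g l.
Proof. by move=> /funext ->. Qed.

Lemma ccvg_filter (G : set_system T) f l : F `<=` G -> ccvg F f l -> ccvg G f l.
Proof. by move=> FG [fr fi]; split => A /= ?; apply: FG; [exact: fr|exact: fi]. Qed.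

Lemma ccvg_comp (S : Type) (G : set_system S) (h : S -> T) f l :
  h @ G --> F -> ccvg F f l -> ccvg G (f \o h) l.
Proof.
by move=> hGF [fr fi]; split => A; [move/fr|move/fi] => FA; exact: (hGF _ FA).
Qed.

End Filters.

End ComplexLimits.

(** * Restricted difference quotients *)

Section DifferenceQuotients.
Context {R : realType}.

(* [phi h] is the value after an increment [h], [v] the value at [h = 0]. *)
Definition dquot (F : set_system R) (phi : R -> R[i]) (v l : R[i]) : Prop :=
  ccvg F (fun h => h^-1%:C * (phi h - v)) l.

(** [F0] says that [F] refines the punctured neighbourhoods of 0. The rules below thus hold for
    every set of admissible increments, even one that is empty near 0 and makes [F] improper. *)
Context {F : set_system R} {FF : Filter F} (F0 : (0 : R)^' `<=` F).
Implicit Types (phi psi : R -> R[i]) (v w l : R[i]).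

Lemma F_neq0 : \forall h \near F, h != 0.
Proof. exact (F0 (@nbhs_dnbhs_neq R 0)). Qed.

Lemma F_cvg0 : id @ F --> (0 : R).
Proof. by move=> A A0; apply: F0; exact: nbhs_dnbhs A0. Qed.

Lemma F_cvgC0 : ccvg F (fun h => h%:C) 0.
Proof. by split => /=; [exact: F_cvg0|exact: cvg_cst]. Qed.

Lemma invC_mulK (h : R) (z : R[i]) : h != 0 -> h%:C * (h^-1%:C * z) = z.
Proof. by move=> h0; rewrite mulrA -rmorphM/= divff// mul1r. Qed.

Lemma dquot_ccvg phi v l : dquot F phi v l -> ccvg F phi v.
Proof.
move=> pl; rewrite -[v]addr0 -(mul0r l).
apply: (ccvg_near _ (ccvgD (ccvg_cst v) (ccvgM F_cvgC0 pl))); near=> h.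
rewrite invC_mulK ?subrKC//; near: h; exact: F_neq0.
Unshelve. all: by end_near. Qed.

Lemma dquot_near phi psi v l :
  (\forall h \near F, phi h = psi h) -> dquot F phi v l -> dquot F psi v l.
Proof.
by move=> pp; apply: ccvg_near; apply: filterS pp => h ->.
Qed.

Lemma dquot_cst v : dquot F (fun=> v) v 0.
Proof.
rewrite /dquot (_ : (fun _ => _) = fun=> 0); first exact: ccvg_cst.
by apply/funext => h; rewrite subrr mulr0.
Qed.

Lemma dquotD phi psi v w l l' : dquot F phi v l -> dquot F psi w l' ->
  dquot F (fun h => phi h + psi h) (v + w) (l + l').
Proof.
move=> pl ql; apply: ccvg_ext (ccvgD pl ql) => h; ring.
Qed.

Lemma dquotN phi v l : dquot F phi v l -> dquot F (fun h => - phi h) (- v) (- l).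
Proof.
move=> pl; apply: ccvg_ext (ccvgN pl) => h; ring.
Qed.

Lemma dquotB phi psi v w l l' : dquot F phi v l -> dquot F psi w l' ->
  dquot F (fun h => phi h - psi h) (v - w) (l - l').
Proof. by move=> pl ql; apply: dquotD => //; exact: dquotN. Qed.

Lemma dquotM phi psi v w l l' : dquot F phi v l -> dquot F psi w l' ->
  dquot F (fun h => phi h * psi h) (v * w) (l * w + v * l').
Proof.
move=> pl ql; have pv := dquot_ccvg pl.
apply: ccvg_ext (ccvgD (ccvgM pl (ccvg_cst w)) (ccvgM pv ql)) => h; ring.
Qed.

Lemma dquotZ c phi v l : dquot F phi v l -> dquot F (fun h => c * phi h) (c * v) (c * l).
Proof.
move=> pl; have := dquotM (dquot_cst c) pl.
by rewrite mul0r add0r.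
Qed.

Lemma dquot_sum I (r : seq I) (phi : I -> R -> R[i]) (v l : I -> R[i]) :
  (forall i, dquot F (phi i) (v i) (l i)) ->
  dquot F (fun h => \sum_(i <- r) phi i h) (\sum_(i <- r) v i) (\sum_(i <- r) l i).
Proof.
move=> pl; apply: ccvg_ext (ccvg_sum r pl) => h.
by rewrite -mulr_sumr big_split/= sumrN.
Qed.

End DifferenceQuotients.

Lemma dquot_filter {R : realType} (F G : set_system R) phi v l :
  F `<=` G -> dquot F phi v l -> dquot G phi v l.
Proof. exact: ccvg_filter. Qed.

Section RestrictedDerivatives.
Context {R : realType}.
Implicit Types (S : set R) (f : R -> R[i]) (x : R).

Lemma near_within T (F : set_system T) (A P : set T) :
  (\forall h \near within A F, P h) = (\forall h \near F, A h -> P h).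
Proof. by []. Qed.

Lemma within_dnbhsP (A P : set R) :
  within A (0 : R)^' P <->
  exists2 d : R, 0 < d & forall h, h != 0 -> `|h| < d -> A h -> P h.
Proof.
split.
  move=> /nbhs_ballP[d /= d0 dP]; exists d => // h h0 hd Ah.
  by apply: dP => //=; rewrite /ball/= sub0r normrN.
move=> [d d0 dP]; apply/nbhs_ballP; exists d => //= h.
by rewrite /ball/= sub0r normrN => hd h0 Ah; exact: dP.
Qed.

Lemma within_dnbhs_le (A : set R) : (0 : R)^' `<=` within A (0 : R)^'.
Proof. by move=> P P0; apply: filterS P0 => h. Qed.
Hint Resolve within_dnbhs_le : core.

Lemma cvg_within_dnbhs (A : set R) (u v : R -> R) (l : R) :
  u @ (0 : R)^' --> l -> (forall h, A h -> u h = v h) -> v @ within A (0 : R)^' --> l.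
Proof.
move=> /cvgrPdist_le ul uv; apply/cvgrPdist_le => e /ul.
rewrite near_within; apply: filterS => h He Ah; rewrite -uv//.
Qed.

Definition cwder S f x (l : R[i]) : Prop :=
  dquot (within [set h | S (x + h)] (0 : R)^') (fun h => f (x + h)) (f x) l.

Lemma cwderP S f x l : cwder S f x l <-> forall e : R, 0 < e ->
  exists2 d : R, 0 < d & forall h, h != 0 -> `|h| < d -> S (x + h) ->
    normc (h^-1%:C * (f (x + h) - f x) - l) <= e.
Proof.
split=> [/ccvgP fl e e0|fl]; first by have /within_dnbhsP := fl e e0.
by apply/ccvgP => e /fl ?; exact/within_dnbhsP.
Qed.

Lemma cwderW S S' f x l : S' `<=` S -> cwder S f x l -> cwder S' f x l.
Proof.
move=> SS /cwderP fl; apply/cwderP => e /fl[d d0 dP].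
by exists d => // h h0 hd /SS; exact: dP.
Qed.

Lemma cwder_local S S' f x l : (\forall y \near x, S' y -> S y) ->
  cwder S f x l -> cwder S' f x l.
Proof.
move=> /nbhs_ballP[r /= r0 rP] /cwderP fl; apply/cwderP => e /fl[d d0 dP].
exists (Num.min d r); first by rewrite lt_min d0.
move=> h h0; rewrite lt_min => /andP[hd hr] S'h; apply: dP => //.
apply: rP => //; rewrite /ball/=.
by rewrite opprD addNKr normrN.
Qed.

Lemma cwder_cvg S f x l : cwder S f x l -> ccvg (within S (nbhs x)) f (f x).
Proof.
move=> /(dquot_ccvg (within_dnbhs_le _))/ccvgP fl; apply/ccvgP => e e0.
have /within_dnbhsP[d d0 dP] := fl e e0.
apply/nbhs_ballP; exists d => //= y; rewrite /ball/= => yd Sy.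
have [->|yx] := eqVneq y x; first by rewrite subrr Normc.normc0 ltW.
rewrite -(subrKC x y); apply: dP.
- by rewrite subr_eq0.
- by rewrite distrC.
- by rewrite /= subrKC.
Qed.

Lemma cwder_is_derive S f x l : (\forall y \near x, S y) -> cwder S f x l ->
  is_derive x 1 (cRe \o f) (cRe l) /\ is_derive x 1 (cIm \o f) (cIm l).
Proof.
move=> Sx fl; have {fl}[] : cwder setT f x l.
  by apply: cwder_local fl; apply: filterS Sx.
have aux (g : R -> R) (k : R) :
    (h^-1 * (g (x + h) - g x)) @[h --> within [set h : R | setT (x + h)] 0^'] --> k ->
    is_derive x 1 g k.
  move=> gk; have gk' : h^-1 *: ((g \o shift x) (h *: 1) - g x) @[h --> (0:R)^'] --> k.
    move: gk => /cvgrPdist_le gk; apply/cvgrPdist_le => e /gk.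
    rewrite near_within; apply: filterS => h /(_ Logic.I).
    by rewrite /= /GRing.scale/= mulr1 [x + h]addrC.
  apply: (@DeriveDef _ _ _ _ _ _ _ (cvgP _ gk')).
  exact: cvg_lim gk'.
move=> fr fi; split; apply: aux.
  apply: cvg_trans fr; apply: near_eq_cvg; near=> h; cbv beta.
  by rewrite cReM /= cReD cReN mul0r subr0.
apply: cvg_trans fi; apply: near_eq_cvg; near=> h; cbv beta.
by rewrite cImM /= cImD cImN mul0r addr0.
Unshelve. all: by end_near. Qed.

Lemma is_derive_cwder S (g : R -> R) x l : is_derive x 1 g l ->
  cwder S (fun y => (g y)%:C) x l%:C.
Proof.
move=> gl; apply: (@cwderW setT) => //.
have gl' : h^-1 *: ((g \o shift x) (h *: 1) - g x) @[h --> (0:R)^'] --> l.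
  have [gd <-] := gl; exact: gd.
split; last first.
  rewrite (_ : (fun _ => _) = fun=> 0); first exact: cvg_cst.
  by apply/funext => h; rewrite cImM /=; ring.
apply: cvg_within_dnbhs gl' _ => h _.
by rewrite cReM /GRing.scale/= mulr1 [h + x]addrC; ring.
Qed.

Lemma cwder_within_continuous a b f f' :
  (forall x, a <= x <= b -> cwder `[a, b] f x (f' x)) ->
  {within `[a, b], continuous (cRe \o f)} /\ {within `[a, b], continuous (cIm \o f)}.
Proof.
move=> fd; split; apply/subspace_continuousP => x /=; rewrite in_itv/= => xab;
  by have [] := cwder_cvg (fd x xab).
Qed.

Lemma itv_near (a b x : R) : a < x < b -> \forall y \near x, `[a, b]%classic y.
Proof.
move=> xab; have : \forall y \near x, y \in `]a, b[ by exact: near_in_itvoo.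
by apply: filterS => y; rewrite /= !in_itv/= => /andP[/ltW -> /ltW ->].
Qed.

(** The real mean value theorem for g + H and g - H, with g the real and then the imaginary part of
    [f]; adding the two bounds produces the factor 2. A comparison function instead of a constant
    lets decaying or growing majorants be integrated, and all integrals below are estimated in this
    way. *)
Lemma mean_value_ineq a b f f' (H H' : R -> R) : a <= b ->
  (forall x, a <= x <= b -> cwder `[a, b] f x (f' x)) ->
  (forall x, a <= x <= b -> is_derive x 1 H (H' x)) ->
  (forall x, a < x < b -> normc (f' x) <= H' x) ->
  normc (f b - f a) <= 2 * (H b - H a).
Proof.
move=> ab fd Hd fH; have [->|nab] := eqVneq a b.
  by rewrite !subrr Normc.normc0 mulr0.
have {}ab : a < b by rewrite lt_neqAle nab.
have cH : {within `[a, b], continuous H}.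
  apply: derivable_within_continuous => x; rewrite in_itv/= => /Hd[]//.
have [cr ci] := cwder_within_continuous fd.
have aux (g g' : R -> R) : {within `[a, b], continuous g} ->
    (forall x, a < x < b -> is_derive x 1 g (g' x)) ->
    (forall x, a < x < b -> `|g' x| <= H' x) -> `|g b - g a| <= H b - H a.
  move=> cg dg gH; rewrite ler_norml; apply/andP; split.
    have cgH : {within `[a, b], continuous (g + H)}.
      by move=> x; apply: cvgD; [exact: cg|exact: cH].
    have /MVT-/(_ ab cgH)[x] : forall x, x \in `]a, b[ ->
        is_derive x 1 (g + H) (g' x + H' x).
      move=> x; rewrite in_itv/= => xab; apply: is_deriveD; first exact: dg.
      by apply: Hd; case/andP: xab => /ltW -> /ltW ->.
    rewrite in_itv/= => xab E.
    have : 0 <= (g' x + H' x) * (b - a).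
      rewrite mulr_ge0 ?subr_ge0 ?(ltW ab)//.
      by have := gH x xab; rewrite ler_norml => /andP[]; lra.
    by rewrite -E /= !fctE; lra.
  have cgH : {within `[a, b], continuous (g - H)}.
    by move=> x; apply: cvgB; [exact: cg|exact: cH].
  have /MVT-/(_ ab cgH)[x] : forall x, x \in `]a, b[ ->
      is_derive x 1 (g - H) (g' x - H' x).
    move=> x; rewrite in_itv/= => xab; apply: is_deriveB; first exact: dg.
    by apply: Hd; case/andP: xab => /ltW -> /ltW ->.
  rewrite in_itv/= => xab E.
  have : (g' x - H' x) * (b - a) <= 0.
    rewrite mulr_le0_ge0 ?subr_ge0 ?(ltW ab)//.
    by have := gH x xab; rewrite ler_norml => /andP[]; lra.
  by rewrite -E /= !fctE; lra.
have dd x : a < x < b ->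
    is_derive x 1 (cRe \o f) (cRe (f' x)) /\ is_derive x 1 (cIm \o f) (cIm (f' x)).
  move=> xab; apply: cwder_is_derive (itv_near xab) _.
  by apply: fd; case/andP: xab => /ltW -> /ltW ->.
apply: le_trans (normc_le _) _; rewrite cReD cImD cReN cImN mulr2n mulrDl !mul1r.
apply: lerD; [apply: (aux (cRe \o f) (cRe \o f'))|apply: (aux (cIm \o f) (cIm \o f'))] => //.
- by move=> x /dd[].
- by move=> x xab; apply: le_trans (absRe_le _) (fH x xab).
- by move=> x /dd[].
- by move=> x xab; apply: le_trans (absIm_le _) (fH x xab).
Qed.

Lemma mean_value_bound a b f f' (K : R) : a <= b ->
  (forall x, a <= x <= b -> cwder `[a, b] f x (f' x)) ->
  (forall x, a < x < b -> normc (f' x) <= K) ->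
  normc (f b - f a) <= 2 * (K * (b - a)).
Proof.
move=> ab fd fK; rewrite mulrBr.
apply: (@mean_value_ineq a b f f' (fun x => K * x) (fun=> K)) => // x _.
have := @is_deriveZ _ _ _ id K x 1 1 (is_derive_id _ _).
by rewrite /GRing.scale/= mulr1.
Qed.

Lemma cintegral_id a (f : R -> R[i]) : cintegral a a f = 0.
Proof.
rewrite /cintegral set_itv1 !Rintegral_set1.
by apply: eq_complexP.
Qed.

(* Constant extension to the left of [a] gives a two-sided derivative at [a]. *)
Lemma Rintegral_cvg_quotient (a : R) (g : R -> R) (x : R) :
  (forall y : R, a <= y -> g @ within `[a, +oo[ (nbhs y) --> g y) -> a <= x ->
  (h^-1 * (\int[lebesgue_measure]_(t in `[a, (x + h)%R]) g t
           - \int[lebesgue_measure]_(t in `[a, x]) g t))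
     @[h --> within [set h | `[a, +oo[%classic (x + h)] 0^'] --> g x.
Proof.
move=> cg ax.
pose G := fun t : R => g (Num.max a t).
have cG : continuous G.
  move=> y; have ay : a <= Num.max a y by rewrite le_max lexx.
  have cm : Num.max a t @[t --> y] --> within `[a, +oo[ (nbhs (Num.max a y)).
    move=> A wA; suff : \forall t \near y, A (Num.max a t) by [].
    have : \forall t \near y, `[a, +oo[%classic (Num.max a t) -> A (Num.max a t).
      have : {for y, continuous (fun t : R => Num.max a t)}.
        by apply: (@continuous_max _ _ (fun=> a) id); [exact: cvg_cst|exact: cvg_id].
      by move=> H; exact: (H _ wA).
    by apply: filterS => t; apply; rewrite /= in_itv/= le_max lexx.
  exact: cvg_comp cm (cg _ ay).
have iG (b c : R) : lebesgue_measure.-integrable `[b, c] (EFin \o G).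
  apply: continuous_compact_integrable; first exact: segment_compact.
  by apply: continuous_subspaceT.
(* With base point a - 1 the point x = a becomes interior; the primitive changes by a constant,
   which cancels in the quotient. *)
have EG (z : R) : a <= z -> \int[lebesgue_measure]_(t in `[a, z]) g t =
    \int[lebesgue_measure]_(t in `[(a - 1)%R, z]) G t
    - \int[lebesgue_measure]_(t in `[(a - 1)%R, a]) G t.
  move=> az; have a1 : a - 1 <= a by lra.
  have eG : {in [set` Interval (BRight a) (BRight z)], EFin \o G =1 EFin \o g}.
    move=> t; rewrite inE/= in_itv/= => /andP[at_ _].
    by rewrite /G /= max_r// ltW.
  rewrite Rintegral_itvB ?bnd_simp// -[LHS]Rintegral_itv_obnd_cbnd.
    by apply: eq_Rintegral => t /eG[].
  apply: (@eq_integrable _ _ R lebesgue_measure `]a, z] _ (EFin \o G) (EFin \o g)) => //.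
  apply: integrableS (iG a z) => //.
  by apply: subset_itvr; rewrite bnd_simp.
have [FD FE] : derivable (fun z : R => \int[lebesgue_measure]_(t in `[(a - 1)%R, z]) G t) x 1
   /\ ((fun z : R => \int[lebesgue_measure]_(t in `[(a - 1)%R, z]) G t)^`()%classic x = G x).
  apply: (@continuous_FTC1_closed _ G (a - 1) x (x + 1)) => //; [lra|lra|exact: cG].
have := FD; rewrite /derivable.
move/cvgP : (FD) => _ Fc.
have {}Fc : h^-1 *: ((fun z : R => \int[lebesgue_measure]_(t in `[(a - 1)%R, z]) G t) (h *: 1 + x)
   - \int[lebesgue_measure]_(t in `[(a - 1)%R, x]) G t) @[h --> (0:R)^'] --> G x.
  by rewrite -FE derive1E; exact: FD.
have -> : g x = G x by rewrite /G max_r.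
apply: cvg_within_dnbhs Fc _ => h /=; rewrite in_itv/= andbT => axh.
rewrite /GRing.scale/= mulr1 [h + x]addrC (EG _ axh) (EG _ ax).
by congr (_ * _); ring.
Qed.

Lemma cintegral_cwder a (f : R -> R[i]) x :
  (forall y, a <= y -> ccvg (within `[a, +oo[ (nbhs y)) f (f y)) -> a <= x ->
  cwder `[a, +oo[ (fun y => cintegral a y f) x (f x).
Proof.
move=> cf ax; split.
  have := @Rintegral_cvg_quotient a (fun y => cRe (f y)) x (fun y ay => (cf y ay).1) ax.
  apply: cvg_trans; apply: near_eq_cvg; near=> h; cbv beta.
  by rewrite cReM /= mul0r subr0.
have := @Rintegral_cvg_quotient a (fun y => cIm (f y)) x (fun y ay => (cf y ay).2) ax.
apply: cvg_trans; apply: near_eq_cvg; near=> h; cbv beta.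
by rewrite cImM /= mul0r addr0.
Unshelve. all: by end_near. Qed.

End RestrictedDerivatives.
#[global] Hint Resolve within_dnbhs_le : core.

Section PartialDerivatives.
Context {R : realType} {n : nat}.
Implicit Types (D : set (R * 'rV[R]_n)) (p q : R * 'rV[R]_n).
Implicit Types (f g : R * 'rV[R]_n -> R[i]).

(** A relation without the factor -i of [Dpartial], so that no default value of [lim] can
    intervene. *)
Definition has_pd D o f p (l : R[i]) : Prop :=
  dquot (increments D o p) (fun h => f (p + h *: dir o)) (f p) l.

Definition cont_on D f : Prop := forall p, D p -> ccvg (within D (nbhs p)) f (f p).

Lemma increments_dnbhs D o p : (0 : R)^' `<=` increments D o p.
Proof. exact: within_dnbhs_le. Qed.

Lemma incrementsP D o p (P : set R) : increments D o p P <->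
  exists2 d : R, 0 < d &
    forall h, h != 0 -> `|h| < d -> D (p + h *: dir o) -> P h.
Proof. exact: within_dnbhsP. Qed.

Lemma increments_filter D o p : Filter (increments D o p).
Proof. exact: within_filter. Qed.

Lemma has_pd_quotient D o f p l : has_pd D o f p l <->
  quotient (fun q => cRe (f q)) o p @ increments D o p --> cRe l /\
  quotient (fun q => cIm (f q)) o p @ increments D o p --> cIm l.
Proof.
rewrite /has_pd /dquot /ccvg.
rewrite (_ : (fun x => cRe _) = quotient (fun q => cRe (f q)) o p); last first.
  by apply/funext => h; rewrite cReM /= cReD cReN mul0r subr0.
rewrite (_ : (fun x => cIm _) = quotient (fun q => cIm (f q)) o p)//.
by apply/funext => h; rewrite cImM /= cImD cImN mul0r addr0.
Qed.

Lemma has_pd_exists D o f p l : has_pd D o f p l -> partial_exists D o f p.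
Proof. by move=> /has_pd_quotient[fr fi]; split; apply/cvg_ex; eexists; eassumption. Qed.

Lemma partial_exists_has_pd D o f p :
  partial_exists D o f p -> has_pd D o f p ('i * Dpartial D o f p).
Proof.
move=> [fr fi]; apply/has_pd_quotient; rewrite /Dpartial.
set l := _ +i* _; have -> : 'i * (- 'i * l) = l by rewrite mulrA mulrN -expr2 sqr_i opprK mul1r.
by split.
Qed.

(** Properness gives uniqueness of the limit: some admissible increments must be arbitrarily small
    for [lim] to be the derivative. *)
Lemma Dpartial_has_pd D o f p l : ProperFilter (increments D o p) ->
  has_pd D o f p l -> Dpartial D o f p = - 'i * l.
Proof.
move=> PF /has_pd_quotient[fr fi]; rewrite /Dpartial; congr (_ * _).
by apply: eq_complexP => /=; apply: cvg_lim.
Qed.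

Lemma has_pd_eq D o f g p l : (forall q, D q -> f q = g q) -> D p ->
  has_pd D o f p l -> has_pd D o g p l.
Proof.
move=> fg Dp; rewrite /has_pd (fg _ Dp); apply: dquot_near.
by apply/incrementsP; exists 1 => // h _ _; exact: fg.
Qed.

Lemma has_pd_sub D D' o f p l : (forall q, D' q -> D q) ->
  has_pd D o f p l -> has_pd D' o f p l.
Proof.
move=> DD; apply: dquot_filter => P /incrementsP[d d0 dP]; apply/incrementsP.
by exists d => // h h0 hd /DD; exact: dP.
Qed.

Lemma cont_on_sub D D' f : (forall q, D' q -> D q) -> cont_on D f -> cont_on D' f.
Proof.
move=> DD fc p /DD Dp; apply: ccvg_filter (fc p Dp) => P.
by rewrite /within/=; apply: filterS => q + /DD; apply.
Qed.

Lemma cont_on_eq D f g : (forall q, D q -> f q = g q) -> cont_on D f -> cont_on D g.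
Proof.
move=> fg fc p Dp; rewrite -(fg _ Dp); apply: ccvg_near (fc p Dp).
by rewrite near_within; apply: filterE => q Dq; exact: fg.
Qed.

Lemma cont_onD D f g : cont_on D f -> cont_on D g -> cont_on D (fun p => f p + g p).
Proof. by move=> fc gc p Dp; apply: ccvgD; [exact: fc|exact: gc]. Qed.

Lemma cont_onM D f g : cont_on D f -> cont_on D g -> cont_on D (fun p => f p * g p).
Proof. by move=> fc gc p Dp; apply: ccvgM; [exact: fc|exact: gc]. Qed.

Lemma cont_on_cst D c : cont_on D (fun=> c).
Proof. by move=> p Dp; exact: ccvg_cst. Qed.

Lemma cont_on_comp D D' f (h : R * 'rV[R]_n -> R * 'rV[R]_n) :
  (forall p, D p -> D' (h p)) -> (forall p, D p -> h @ within D (nbhs p) --> h p) ->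
  cont_on D' f -> cont_on D (f \o h).
Proof.
move=> DD hc fc p Dp; apply: (ccvg_comp _ (fc _ (DD _ Dp))) => P wP.
suff : \forall q \near p, D q -> P (h q) by [].
have : \forall q \near p, D q -> D' (h q) -> P (h q) := hc p Dp _ wP.
by apply: filterS => q H Dq; apply: H => //; exact: DD.
Qed.

Lemma cont_onP D f : cont_on D f <->
  {within D, continuous (fun p => cRe (f p))} /\
  {within D, continuous (fun p => cIm (f p))}.
Proof.
split=> [fc|[/subspace_continuousP fr /subspace_continuousP fi] p Dp].
  by split; apply/subspace_continuousP => p /fc[].
by split; [exact: fr|exact: fi].
Qed.

Lemma dir_shift p o (x h : R) :
  p + (x + h) *: dir o = (p + x *: dir o) + h *: dir o.
Proof. by rewrite scalerDl addrA. Qed.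

Lemma has_pd_line D o f q (S : set R) x l :
  (forall y, S y -> D (q + y *: dir o)) -> has_pd D o f (q + x *: dir o) l ->
  cwder S (fun y => f (q + y *: dir o)) x l.
Proof.
move=> SD; rewrite /has_pd /cwder => fl.
apply: (@dquot_near _ _ _ (fun h => f (q + x *: dir o + h *: dir o))).
  by apply: filterE => h; rewrite dir_shift.
apply: dquot_filter fl => P /incrementsP[d d0 dP]; apply/within_dnbhsP.
by exists d => // h h0 hd /SD; rewrite dir_shift; exact: dP.
Qed.

Lemma dir_time p (h : R) : p + h *: dir None = (p.1 + h, p.2).
Proof.
by case: p => t xi; apply/pair_equal_spec; split => /=; [rewrite /GRing.scale/= mulr1|rewrite scaler0 addr0].
Qed.

Lemma dir_freq p j (h : R) :
  p + h *: dir (Some j) = (p.1, p.2 + h *: delta_mx ord0 j).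
Proof.
by case: p => t xi; apply/pair_equal_spec; split => //=; rewrite /GRing.scale/= mulr0 addr0.
Qed.

Lemma has_pd_time D f t xi l :
  has_pd D None f (t, xi) l <-> cwder [set s | D (s, xi)] (fun s => f (s, xi)) t l.
Proof.
rewrite /has_pd /cwder /increments.
have E h : (t, xi) + h *: dir None = (t + h, xi) by rewrite dir_time.
rewrite (_ : (fun h => f (_ + _)) = (fun h => f (t + h, xi))); last first.
  by apply/funext => h; rewrite E.
rewrite (_ : [set h : R | D _] = [set h : R | D (t + h, xi)])//.
by apply/seteqP; split => h /=; rewrite E.
Qed.

Lemma pair_near (p : R * 'rV[R]_n) (P : set (R * 'rV[R]_n)) : nbhs p P <->
  exists2 d : R, 0 < d & forall q, `|q.1 - p.1| < d -> `|q.2 - p.2| < d -> P q.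
Proof.
split=> [/nbhs_ballP[d /= d0 dP]|[d d0 dP]].
  by exists d => // q q1 q2; apply: dP; split; rewrite -ball_normE /= distrC.
apply/nbhs_ballP; exists d => // q [q1 q2]; apply: dP.
  by move: q1; rewrite -ball_normE /= distrC.
by move: q2; rewrite -ball_normE /= distrC.
Qed.

End PartialDerivatives.
#[global] Hint Resolve increments_dnbhs : core.
#[global] Instance increments_filterI {R : realType} {n : nat} (D : set (R * 'rV[R]_n)) o p :
  Filter (increments D o p) := increments_filter D o p.

(** * Mixed derivatives and composition with a change of time *)

Section PartialDerivatives.
Context {R : realType} {n : nat}.
Implicit Types (D : set (R * 'rV[R]_n)) (p q : R * 'rV[R]_n).
Implicit Types (f g : R * 'rV[R]_n -> R[i]).

Lemma cwder_lin (S : set R) x (c : R[i]) : cwder S (fun y => y%:C * c) x c.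
Proof.
have := dquotM (within_dnbhs_le _) (is_derive_cwder S (is_derive_id x 1)) (dquot_cst c).
by move=> /(_ _ _); rewrite mul1r mulr0 addr0; apply.
Qed.

(** Mean value inequality twice: in direction [o] for the increment of [f] in direction [o'], then
    in direction [o'] for [fo]; each contributes a factor 2. Only the quadrant of nonnegative
    increments is visited, which is available at boundary points such as t = 0. *)
Lemma second_difference D o o' f fo fo'o p r : 0 < r ->
  (forall x y, 0 <= x <= r -> 0 <= y <= r -> D (p + x *: dir o + y *: dir o')) ->
  (forall q, D q -> has_pd D o f q (fo q)) ->
  (forall q, D q -> has_pd D o' fo q (fo'o q)) ->
  ccvg (within D (nbhs p)) fo'o (fo'o p) ->
  forall e, 0 < e -> exists2 d, 0 < d & forall h, 0 < h -> h < d ->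
    normc (f (p + h *: dir o + h *: dir o') - f (p + h *: dir o)
           - f (p + h *: dir o') + f p - (h ^+ 2)%:C * fo'o p) <= 4 * (e * h ^+ 2).
Proof.
move=> r0 rD fd fod /ccvgP fc e e0.
have /nbhs_ballP[d /= d0 dP] := fc e e0.
pose K : R := `|dir o : R * 'rV[R]_n| + `|dir o' : R * 'rV[R]_n| + 1.
have K0 : 0 < K by rewrite ltr_wpDl// addr_ge0.
have near_p x y h : 0 <= x <= h -> 0 <= y <= h -> h < Num.min r (d / K) ->
    D (p + x *: dir o + y *: dir o') /\
    normc (fo'o (p + x *: dir o + y *: dir o') - fo'o p) <= e.
  move=> xh yh; rewrite lt_min => /andP[hr hd].
  have Dq : D (p + x *: dir o + y *: dir o').
    by apply: rD; lra.
  split => //; apply: dP => //; rewrite -ball_normE /=.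
  rewrite -addrA opprD addrA subrr sub0r normrN.
  apply: le_lt_trans (ler_normD _ _) _; rewrite !normrZ.
  have h0 : 0 <= h by lra.
  rewrite !ger0_norm; try lra.
  apply: (@le_lt_trans _ _ (h * K)); last by rewrite -ltr_pdivlMr.
  rewrite /K !mulrDr mulr1 -addrA; apply: lerD; first by rewrite ler_wpM2r//; lra.
  by rewrite -[leLHS]addr0; apply: lerD => //; rewrite ler_wpM2r//; lra.
exists (Num.min r (d / K)); first by rewrite lt_min r0 divr_gt0.
move=> h h0 hd; set c := fo'o p.
have hh (x : R) : 0 <= x <= h -> D (p + x *: dir o + h *: dir o') /\ D (p + x *: dir o).
  have h00 : 0 <= (0 : R) <= h by rewrite lexx ltW.
  have hhh : 0 <= h <= h by rewrite lexx ltW.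
  move=> xh; split; first by have [] := near_p x h h xh hhh hd.
  by have [] := near_p x 0 h xh h00 hd; rewrite scale0r addr0.
pose G x := f (p + h *: dir o' + x *: dir o) - f (p + x *: dir o) - x%:C * (h%:C * c).
pose G' x := fo (p + h *: dir o' + x *: dir o) - fo (p + x *: dir o) - h%:C * c.
have GG' x : 0 <= x <= h -> cwder `[0, h] G x (G' x).
  move=> xh; have [Dq Dq'] := hh x xh.
  apply: dquotB; last exact: cwder_lin.
  apply: dquotB.
    apply: has_pd_line; last by apply: fd; rewrite addrAC.
    by move=> y; rewrite /= in_itv/= addrAC => /hh[].
  apply: has_pd_line; last exact: fd.
  by move=> y; rewrite /= in_itv/= => /hh[].
have G'e x : 0 < x < h -> normc (G' x) <= 2 * (e * (h - 0)).
  move=> xh; have {}xh : 0 <= x <= h by lra.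
  pose g y := fo (p + x *: dir o + y *: dir o') - y%:C * c.
  have -> : G' x = g h - g 0.
    rewrite /G' /g scale0r addr0 [p + h *: _ + _]addrAC; ring.
  apply: (@mean_value_bound _ 0 h g (fun y => fo'o (p + x *: dir o + y *: dir o') - c)).
  - exact: ltW.
  - move=> y yh; apply: dquotB; last exact: cwder_lin.
    apply: (@has_pd_line _ _ D).
      by move=> z; rewrite /= in_itv/= => zh; have [] := near_p x z h xh zh hd.
    by apply: fod; have [] := near_p x y h xh yh hd.
  - move=> y /andP[/ltW y0 /ltW yh]; have yh' : 0 <= y <= h by rewrite y0.
    by have [] := near_p x y h xh yh' hd.
have := mean_value_bound (ltW h0) GG' G'e.
rewrite /G scale0r !addr0 mul0r !subr0.
set L := normc _; set L' := normc _ => LL; suff -> : L' = L by lra.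
rewrite /L /L'; congr normc; rewrite [p + h *: dir o' + _]addrAC rmorphXn/=; ring.
Qed.

(** The second difference is symmetric in the two directions and, divided by h^2, approximates both
    mixed derivatives. *)
Lemma pd_comm D o o' f fo fo' fo'o foo' p r : 0 < r ->
  (forall x y, 0 <= x <= r -> 0 <= y <= r -> D (p + x *: dir o + y *: dir o')) ->
  (forall q, D q -> has_pd D o f q (fo q)) ->
  (forall q, D q -> has_pd D o' fo q (fo'o q)) ->
  (forall q, D q -> has_pd D o' f q (fo' q)) ->
  (forall q, D q -> has_pd D o fo' q (foo' q)) ->
  ccvg (within D (nbhs p)) fo'o (fo'o p) -> ccvg (within D (nbhs p)) foo' (foo' p) ->
  fo'o p = foo' p.
Proof.
move=> r0 rD fd fod fd' fod' c1 c2; apply/eqP; rewrite -subr_eq0 -normc_eq0.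
rewrite eq_le normc_ge0 andbT; apply/ler_addgt0Pl => e e0; rewrite addr0.
(* Each of the two second differences errs by at most 4 (e / 8) h^2. *)
have e8 : 0 < e / 8 by rewrite divr_gt0.
have [d1 d10 P1] := second_difference r0 rD fd fod c1 e8.
have rD' x y : 0 <= x <= r -> 0 <= y <= r -> D (p + x *: dir o' + y *: dir o).
  by move=> xr yr; rewrite addrAC; exact: rD.
have [d2 d20 P2] := second_difference r0 rD' fd' fod' c2 e8.
pose h := Num.min d1 d2 / 2.
have h0 : 0 < h by rewrite divr_gt0// lt_min d10.
have hm : h < Num.min d1 d2.
  by rewrite /h ltr_pdivrMr// ltr_pMr ?lt_min ?d10//; lra.
move: (hm); rewrite lt_min => /andP[h1 h2].
have {P1}P1 := P1 h h0 h1; have {P2}P2 := P2 h h0 h2.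
have h20 : 0 < h ^+ 2 by rewrite exprn_gt0.
rewrite -(ler_pM2l h20) -[X in X * _ <= _](ger0_norm (ltW h20)) -normc_real -Normc.normcM.
have := le_trans (le_normcB _ _) (lerD P2 P1).
set L := normc _; set L' := normc _ => LL; suff -> : L' = L by lra.
rewrite /L /L'; congr normc; rewrite [p + h *: dir o' + _]addrAC; ring.
Qed.

(* The composition [q |-> f (tau q, q.2)]; no openness of [D] is needed since
   [D] is stable under increasing the time. *)
Lemma has_pd_time_comp D D' o f fN (tau : R * 'rV[R]_n -> R) tau' p l :
  (forall s s' xi, D (s, xi) -> s <= s' -> D (s', xi)) ->
  (forall q, D' q -> D (tau q, q.2)) -> D' p ->
  (forall q, D q -> has_pd D None f q (fN q)) ->
  ccvg (within D (nbhs (tau p, p.2))) fN (fN (tau p, p.2)) ->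
  has_pd D' o (fun q => (tau q)%:C) p tau'%:C ->
  dquot (increments D' o p) (fun h => f (tau p, (p + h *: dir o).2)) (f (tau p, p.2)) l ->
  (\forall h \near increments D' o p, D (tau p, (p + h *: dir o).2)) ->
  has_pd D' o (fun q => f (tau q, q.2)) p (fN (tau p, p.2) * tau'%:C + l).
Proof.
move=> Dup DD' D'p fd /ccvgP fc tc fl Dnear.
set F := increments D' o p; have FF : Filter F by exact: increments_filter.
set s0 := tau p; pose th h := tau (p + h *: dir o); pose xh h := (p + h *: dir o).2.
set c := fN (s0, p.2).
(* The increment splits into a change of time at the displaced frequency, treated here, and a change
   of frequency at the fixed time [s0], which is the hypothesis [fl]. *)
suff E : ccvg F (fun h => h^-1%:C * (f (th h, xh h) - f (s0, xh h))) (c * tau'%:C).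
  apply: ccvg_ext (ccvgD E fl) => h; rewrite /th /xh; ring.
have tq := tc; rewrite /has_pd /dquot -/F in tq.
have tcv : ccvg F (fun h => (th h)%:C) s0%:C := dquot_ccvg (@increments_dnbhs _ _ D' o p) tc.
apply/ccvgP => e e0.
pose K := `|tau'| + 1.
have K0 : 0 < K by rewrite ltr_wpDl.
(* [K] bounds the difference quotient of [tau] near 0. The choices make 2 [e1] [K] and [e2] (|c| +
   1) both equal to e / 2. *)
pose e1 := e / (4 * K).
have e10 : 0 < e1 by rewrite divr_gt0// mulr_gt0.
pose e2 := e / (2 * (normc c + 1)).
have c10 : 0 < normc c + 1 by rewrite ltr_wpDl// normc_ge0.
have e20 : 0 < e2 by rewrite divr_gt0// mulr_gt0.
have /pair_near[d d0 dP] := fc e1 e10.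
have xcv : \forall h \near F, `|xh h - p.2| < d.
  pose k : R := `|dir o : R * 'rV[R]_n| + 1.
  have k0 : 0 < k by rewrite ltr_wpDl.
  apply/incrementsP; exists (d / k); first by rewrite divr_gt0.
  move=> h _; rewrite ltr_pdivlMr// => hd _.
  rewrite /xh /= addrC addKr normrZ; apply: le_lt_trans hd.
  by rewrite ler_wpM2l// (@le_trans _ _ `|dir o : R * 'rV[R]_n|)// ?le_max ?lexx ?orbT// lerDl.
have tnear : \forall h \near F, `|th h - s0| < d.
  have [/cvgrPdist_lt tr _] := tcv.
  by have := tr d d0; apply: filterS => h /=; rewrite distrC.
have tK : \forall h \near F, normc (h^-1%:C * ((th h)%:C - s0%:C)) <= K.
  have := (@ccvgP _ _ F FF _ _).1 tq 1 ltr01.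
  apply: filterS => h H; rewrite /K -normc_real.
  rewrite -[X in normc X](subrK tau'%:C); apply: le_trans (le_normcD _ _) _.
  by rewrite addrC lerD2l.
have te : \forall h \near F, normc (h^-1%:C * ((th h)%:C - s0%:C) - tau'%:C) <= e2.
  exact: (@ccvgP _ _ F FF _ _).1 tq e2 e20.
have Dth : \forall h \near F, D (th h, xh h).
  by apply/incrementsP; exists 1 => // h _ _ /DD'.
near=> h.
have key : normc (f (th h, xh h) - f (s0, xh h) - ((th h)%:C - s0%:C) * c)
    <= 2 * (e1 * `|th h - s0|).
  have Dh : D (th h, xh h) by near: h.
  have Ds : D (s0, xh h) by near: h.
  have hx : `|xh h - p.2| < d by near: h.
  have ht : `|th h - s0| < d by near: h.
  have aux a b : a <= b -> D (a, xh h) -> (forall s, a <= s <= b -> `|s - s0| < d) ->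
      normc (f (b, xh h) - f (a, xh h) - (b%:C - a%:C) * c) <= 2 * (e1 * (b - a)).
    move=> ab Da sd.
    have Dab s : a <= s <= b -> D (s, xh h) by move=> /andP[? _]; exact: Dup Da _.
    pose g s := f (s, xh h) - s%:C * c.
    have -> : f (b, xh h) - f (a, xh h) - (b%:C - a%:C) * c = g b - g a by rewrite /g; ring.
    apply: (@mean_value_bound _ a b g (fun s => fN (s, xh h) - c)) => //.
      move=> s sab; apply: dquotB; last exact: cwder_lin.
      have /has_pd_time := fd _ (Dab s sab).
      by apply: cwderW => z /=; rewrite in_itv/=; exact: Dab.
    move=> s sab; have sab' : a <= s <= b by lra.
    by apply: dP => //=; [exact: sd|exact: Dab].
  have [le_t|/ltW le_t] := leP s0 (th h).
    rewrite ger0_norm ?subr_ge0//; apply: aux => // s sh.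
    by move: ht; rewrite !ger0_norm; lra.
  rewrite -normcN distrC ger0_norm ?subr_ge0//.
  have -> : - (f (th h, xh h) - f (s0, xh h) - ((th h)%:C - s0%:C) * c) =
    f (s0, xh h) - f (th h, xh h) - (s0%:C - (th h)%:C) * c by ring.
  apply: aux => // s sh.
  by move: ht; rewrite !ler0_norm; lra.
have hn : 0 <= `|h^-1| by [].
have key2 : normc (h^-1%:C * (f (th h, xh h) - f (s0, xh h))
    - h^-1%:C * ((th h)%:C - s0%:C) * c) <= e / 2.
  rewrite -mulrA -mulrBr Normc.normcM normc_real.
  apply: le_trans (ler_wpM2l hn key) _.
  have : normc (h^-1%:C * ((th h)%:C - s0%:C)) <= K by near: h.
  rewrite -rmorphB Normc.normcM !normc_real => tk.
  have -> : `|h^-1| * (2 * (e1 * `|th h - s0|)) = 2 * e1 * (`|h^-1| * `|th h - s0|) by ring.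
  apply: (@le_trans _ _ (2 * e1 * K)); first by rewrite ler_wpM2l// mulr_ge0// ltW.
  by rewrite /e1 le_eqVlt; apply/orP; left; apply/eqP; field; lra.
have key3 : normc (h^-1%:C * ((th h)%:C - s0%:C) * c - c * tau'%:C) <= e / 2.
  rewrite [c * _]mulrC -mulrBl Normc.normcM.
  apply: (@le_trans _ _ (e2 * (normc c + 1))).
    apply: ler_pM; rewrite ?normc_ge0 ?lerDl//; near: h; exact: te.
  by rewrite /e2 le_eqVlt; apply/orP; left; apply/eqP; field; lra.
have := le_trans (le_normcD _ _) (lerD key2 key3).
by rewrite -splitr addrA subrK.
Unshelve. all: by end_near. Qed.

End PartialDerivatives.

Section ChainRule.
Context {R : realType} (F : set_system R) {FF : Filter F} (F0 : (0 : R)^' `<=` F).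

(** The slope [s] of [G] at [v], completed by [G'] at [v] itself, is continuous there, and G (psi h)
    - G v = s (psi h) (psi h - v) also when psi h = v. *)
Lemma dquot_real_comp (psi : R -> R) v l (G : R -> R) G' :
  dquot F (fun h => (psi h)%:C) v%:C l%:C -> is_derive v 1 G G' ->
  dquot F (fun h => (G (psi h))%:C) (G v)%:C (G' * l)%:C.
Proof.
move=> pl Gd; pose s u := if u == v then G'%:C else (u - v)^-1%:C * ((G u)%:C - (G v)%:C).
have sl : ccvg F (fun h => s (psi h)) G'%:C.
  apply/ccvgP => e e0.
  have /cwderP/(_ e e0)[d d0 dP] := is_derive_cwder setT Gd.
  have [/cvgrPdist_lt/(_ d d0) pd _] := dquot_ccvg F0 pl.
  apply: filterS pd => h; rewrite /= distrC /s => hd.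
  have [_|hv] := eqVneq (psi h) v; first by rewrite subrr Normc.normc0 ltW.
  have := dP (psi h - v) _ hd Logic.I; rewrite subrKC; apply.
  by rewrite subr_eq0.
rewrite rmorphM/= mulrC; apply: ccvg_ext (ccvgM pl sl) => h; rewrite /s.
have [->|hv] := eqVneq (psi h) v; first by rewrite !subrr !mulr0 mul0r.
rewrite -!mulrA; congr (_ * _); rewrite mulrA -rmorphB -rmorphM/= divff ?subr_eq0//.
by rewrite mul1r.
Qed.

Lemma dquotRe phi v l : dquot F phi v l -> dquot F (fun h => (cRe (phi h))%:C) (cRe v)%:C (cRe l)%:C.
Proof.
move=> [pr pi]; split.
  move: pr; rewrite (_ : (fun x => _) = (fun x => cRe (x^-1%:C * ((cRe (phi x))%:C - (cRe v)%:C))))//.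
  by apply/funext => h; rewrite !cReM /= !cReD !cReN /=; ring.
rewrite (_ : (fun x => _) = fun=> 0); first exact: cvg_cst.
by apply/funext => h; rewrite cImM cImD cImN /=; ring.
Qed.

Lemma dquotIm phi v l : dquot F phi v l -> dquot F (fun h => (cIm (phi h))%:C) (cIm v)%:C (cIm l)%:C.
Proof.
move=> pl; have /(_ FF) := dquotRe (dquotZ F0 (- 'i) pl).
have E z : cRe (- 'i * z) = cIm z :> R by rewrite cReM /=; ring.
by rewrite !E => pI; apply: (dquot_near _ pI); apply: filterE => h; rewrite E.
Qed.

Lemma cexpE z : cexp z = (expR (cRe z))%:C * ((cos (cIm z))%:C + 'i * (sin (cIm z))%:C) :> R[i].
Proof. by rewrite /cexp; apply: eq_complexP; rewrite ?cReM ?cImM ?cReD ?cImD ?cReM ?cImM /=; ring. Qed.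

Lemma dquot_cexp phi v l : dquot F phi v l ->
  dquot F (fun h => cexp (phi h)) (cexp v) (l * cexp v).
Proof.
move=> pl; have pr := dquotRe pl; have pi := dquotIm pl.
have er := dquot_real_comp pr (is_derive_expR (cRe v)).
have ec := dquot_real_comp pi (is_derive_cos (cIm v)).
have es := dquot_real_comp pi (is_derive_sin (cIm v)).
have -> : l * cexp v =
    (expR (cRe v) * cRe l)%:C * ((cos (cIm v))%:C + 'i * (sin (cIm v))%:C)
    + (expR (cRe v))%:C * ((- sin (cIm v) * cIm l)%:C + 'i * (cos (cIm v) * cIm l)%:C).
  rewrite cexpE; apply: eq_complexP;
  rewrite ?(cReM, cImM, cReD, cImD) /= ?(cReM, cImM, cReD, cImD) /=; ring.
rewrite cexpE; apply: (dquot_near _ (dquotM F0 er (dquotD ec (dquotZ F0 'i es)))).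
by apply: filterE => h; rewrite cexpE.
Qed.

Lemma normc_cexp (z : R[i]) : normc (cexp z) = expR (cRe z).
Proof.
rewrite /cexp /= !exprMn -mulrDr cos2Dsin2 mulr1 sqrtr_sqr ger0_norm // expR_ge0.
Qed.

Lemma ccvg_cexp T (H : set_system T) (FH : Filter H) (f : T -> R[i]) l :
  ccvg H f l -> ccvg H (fun x => cexp (f x)) (cexp l).
Proof.
move=> [fr fi].
have er : expR (cRe (f x)) @[x --> H] --> expR (cRe l).
  by apply: cvg_comp fr _; exact: continuous_expR.
have ec : cos (cIm (f x)) @[x --> H] --> cos (cIm l).
  by apply: cvg_comp fi _; exact: continuous_cos.
have es : sin (cIm (f x)) @[x --> H] --> sin (cIm l).
  by apply: cvg_comp fi _; exact: continuous_sin.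
by split => /=; exact: cvgM.
Qed.

End ChainRule.

(** * Weighted estimates for derivatives of finite order *)

Section WeightedSmoothness.
Context {R : realType} {n : nat}.
Local Notation point := (R * 'rV[R]_n)%type.
Implicit Types (D : set point) (dirs : pred (option 'I_n)).
Implicit Types (wt : option 'I_n -> point -> R) (g : point -> R) (f : point -> R[i]).

(* [f] and its iterated partial derivatives of order at most [m] are continuous,
   and the derivative along the word [w] is [O(g * \prod_(o <- w) wt o)]. *)
Fixpoint wsmooth D dirs wt (m : nat) g f : Prop :=
  [/\ cont_on D f,
      exists C : R, forall p, D p -> normc (f p) <= C * g p &
      if m is m'.+1 then
        forall o, dirs o -> exists2 fo, (forall p, D p -> has_pd D o f p (fo p)) &
          wsmooth D dirs wt m' (fun p => g p * wt o p) fo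
      else True].

Lemma wsmooth_cont D dirs wt m g f : wsmooth D dirs wt m g f -> cont_on D f.
Proof. by case: m => [|m] []. Qed.

Lemma wsmooth_bound D dirs wt m g f : wsmooth D dirs wt m g f ->
  exists C : R, forall p, D p -> normc (f p) <= C * g p.
Proof. by case: m => [|m] []. Qed.

Lemma wsmooth0P D dirs wt g f : cont_on D f ->
  (exists C : R, forall p, D p -> normc (f p) <= C * g p) -> wsmooth D dirs wt 0 g f.
Proof. by move=> fc fb; split. Qed.

Lemma wsmoothSP D dirs wt m g f : cont_on D f ->
  (exists C : R, forall p, D p -> normc (f p) <= C * g p) ->
  (forall o, dirs o -> exists2 fo, (forall p, D p -> has_pd D o f p (fo p)) &
    wsmooth D dirs wt m (fun p => g p * wt o p) fo) ->
  wsmooth D dirs wt m.+1 g f.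
Proof. by move=> fc fb fd; split. Qed.

Lemma wsmoothW D dirs wt m g f : wsmooth D dirs wt m.+1 g f -> wsmooth D dirs wt m g f.
Proof.
elim: m g f => [|m ih] g f [fc fb fd]; first by split.
by split => // o /fd[fo fod fos]; exists fo => //; exact: ih.
Qed.

Lemma wsmooth_leq D dirs wt m m' g f : (m <= m')%N ->
  wsmooth D dirs wt m' g f -> wsmooth D dirs wt m g f.
Proof.
move=> /subnK <-; elim: (m' - m)%N => // k ih; rewrite addSn.
by move=> /wsmoothW/ih.
Qed.

Lemma wsmooth_eq D dirs wt m g f f' : (forall p, D p -> f p = f' p) ->
  wsmooth D dirs wt m g f -> wsmooth D dirs wt m g f'.
Proof.
move=> ff'; case: m => [|m] [fc [C fC] fd]; split => //.
- exact: cont_on_eq fc.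
- by exists C => p Dp; rewrite -ff'//; exact: fC.
- exact: cont_on_eq fc.
- by exists C => p Dp; rewrite -ff'//; exact: fC.
- move=> o /fd[fo fod fos]; exists fo => // p Dp.
  by apply: has_pd_eq (fod p Dp).
Qed.

Lemma wsmooth_mono D dirs wt wt' m g g' f (K : R) :
  (forall p, D p -> 0 <= g p /\ g p <= K * g' p) ->
  (forall o, dirs o -> exists K', forall p, D p -> 0 <= wt o p /\ wt o p <= K' * wt' o p) ->
  wsmooth D dirs wt m g f -> wsmooth D dirs wt' m g' f.
Proof.
move=> + ww; elim: m g g' f K => [|m ih] g g' f K gg [fc [C fC] fd].
  split => //; exists (`|C| * K) => p Dp; have [g0 gK] := gg p Dp.
  apply: le_trans (fC p Dp) _; rewrite -mulrA; apply: (@le_trans _ _ (`|C| * g p)).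
    by rewrite ler_wpM2r// ler_norm.
  by rewrite ler_wpM2l.
split => //.
  exists (`|C| * K) => p Dp; have [g0 gK] := gg p Dp.
  apply: le_trans (fC p Dp) _; rewrite -mulrA; apply: (@le_trans _ _ (`|C| * g p)).
    by rewrite ler_wpM2r// ler_norm.
  by rewrite ler_wpM2l.
move=> o oD; have [K' oK'] := ww o oD; have [fo fod fos] := fd o oD.
exists fo => //; apply: (ih _ _ _ (K * K')) fos => p Dp.
have [g0 gK] := gg p Dp; have [w0 wK] := oK' p Dp.
split; first exact: mulr_ge0.
by rewrite mulrACA; exact: ler_pM.
Qed.

Lemma wsmooth_eqw D dirs wt m g g' f : (forall p, D p -> g p = g' p) ->
  wsmooth D dirs wt m g f -> wsmooth D dirs wt m g' f.
Proof.
elim: m g g' f => [|m ih] g g' f gg [fc [C fC] fd]; split => //.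
- by exists C => p Dp; rewrite -gg//; exact: fC.
- by exists C => p Dp; rewrite -gg//; exact: fC.
- move=> o /fd[fo fod fos]; exists fo => //; apply: ih fos => p Dp.
  by rewrite gg.
Qed.

Section FixedDomain.
Context (D : set point) (dirs : pred (option 'I_n)) (wt : option 'I_n -> point -> R).
Hypothesis wt_ge0 : forall o p, D p -> 0 <= wt o p.

Lemma wsmooth_weight m g g' f (K : R) :
  (forall p, D p -> 0 <= g p /\ g p <= K * g' p) ->
  wsmooth D dirs wt m g f -> wsmooth D dirs wt m g' f.
Proof.
move=> gg; apply: wsmooth_mono gg _ => o _; exists 1 => p Dp.
by rewrite mul1r wt_ge0.
Qed.

Lemma wsmooth0 m g : wsmooth D dirs wt m g (fun=> 0).
Proof.
elim: m g => [|m ih] g; split => //; try exact: cont_on_cst.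
- by exists 0 => p Dp; rewrite Normc.normc0 mul0r.
- by exists 0 => p Dp; rewrite Normc.normc0 mul0r.
- by move=> o _; exists (fun=> 0) => // p Dp; exact: dquot_cst.
Qed.

Lemma wsmooth_cst m c : wsmooth D dirs wt m (fun=> 1) (fun=> c).
Proof.
case: m => [|m]; split => //; try exact: cont_on_cst.
- by exists (normc c) => p Dp; rewrite mulr1.
- by exists (normc c) => p Dp; rewrite mulr1.
- move=> o _; exists (fun=> 0); last exact: wsmooth0.
  by move=> p Dp; exact: dquot_cst.
Qed.

Lemma wsmoothD m g f f' : wsmooth D dirs wt m g f -> wsmooth D dirs wt m g f' ->
  wsmooth D dirs wt m g (fun p => f p + f' p).
Proof.
elim: m g f f' => [|m ih] g f f' [fc [C fC] fd] [fc' [C' fC'] fd'];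
  split => //; try exact: cont_onD.
- by exists (C + C') => p Dp; rewrite mulrDl (le_trans (le_normcD _ _))// lerD ?fC ?fC'.
- by exists (C + C') => p Dp; rewrite mulrDl (le_trans (le_normcD _ _))// lerD ?fC ?fC'.
- move=> o oD; have [fo fod fos] := fd o oD; have [fo' fod' fos'] := fd' o oD.
  exists (fun p => fo p + fo' p); last exact: ih.
  by move=> p Dp; apply: dquotD; [exact: fod|exact: fod'].
Qed.

Lemma wsmoothM m g g' f f' : wsmooth D dirs wt m g f -> wsmooth D dirs wt m g' f' ->
  wsmooth D dirs wt m (fun p => g p * g' p) (fun p => f p * f' p).
Proof.
elim: m g g' f f' => [|m ih] g g' f f' ws ws';
  have [fc [C fC] fd] := ws; have [fc' [C' fC'] fd'] := ws';
  split => //; try exact: cont_onM.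
- exists (C * C') => p Dp; rewrite Normc.normcM mulrACA.
  by apply: ler_pM; rewrite ?normc_ge0 ?fC ?fC'.
- exists (C * C') => p Dp; rewrite Normc.normcM mulrACA.
  by apply: ler_pM; rewrite ?normc_ge0 ?fC ?fC'.
- move=> o oD; have [fo fod fos] := fd o oD; have [fo' fod' fos'] := fd' o oD.
  exists (fun p => fo p * f' p + f p * fo' p).
    move=> p Dp; apply: dquotM; [exact: increments_dnbhs|exact: fod|exact: fod'].
  apply: wsmoothD.
    apply: wsmooth_eqw (ih _ _ _ _ fos (wsmoothW ws')) => p Dp.
    by rewrite mulrAC.
  apply: wsmooth_eqw (ih _ _ _ _ (wsmoothW ws) fos') => p Dp.
  by rewrite mulrA.
Qed.

Lemma wsmoothZ m g c f : wsmooth D dirs wt m g f -> wsmooth D dirs wt m g (fun p => c * f p).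
Proof.
move=> /(wsmoothM (wsmooth_cst m c)); apply: wsmooth_eqw => p _.
by rewrite mul1r.
Qed.

Lemma wsmoothN m g f : wsmooth D dirs wt m g f -> wsmooth D dirs wt m g (fun p => - f p).
Proof. by move=> /(wsmoothZ (-1)); apply: wsmooth_eq => p _; rewrite mulN1r. Qed.

Lemma wsmoothB m g f f' : wsmooth D dirs wt m g f -> wsmooth D dirs wt m g f' ->
  wsmooth D dirs wt m g (fun p => f p - f' p).
Proof. by move=> ws /wsmoothN; exact: wsmoothD. Qed.

Lemma wsmooth_sum m g I (r : seq I) (f : I -> point -> R[i]) :
  (forall i, wsmooth D dirs wt m g (f i)) ->
  wsmooth D dirs wt m g (fun p => \sum_(i <- r) f i p).
Proof.
move=> fi; elim: r => [|i r ih].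
  by apply: wsmooth_eq (wsmooth0 m g) => p _; rewrite big_nil.
by apply: wsmooth_eq (wsmoothD (fi i) ih) => p _; rewrite big_cons.
Qed.

Lemma wsmooth_mulmx m g g' a b c (A : point -> 'M[R[i]]_(a, b)) (B : point -> 'M[R[i]]_(b, c)) :
  (forall i j, wsmooth D dirs wt m g (fun p => A p i j)) ->
  (forall i j, wsmooth D dirs wt m g' (fun p => B p i j)) ->
  forall i j, wsmooth D dirs wt m (fun p => g p * g' p) (fun p => (A p *m B p) i j).
Proof.
move=> Am Bm i j.
apply: (wsmooth_eq (f := fun p => \sum_k A p i k * B p k j)).
  by move=> p _; rewrite mxE.
by apply: wsmooth_sum => k; exact: wsmoothM (Am i k) (Bm k j).
Qed.

(** Each of the m derivatives loses a factor [rho], so the size [g] can pay in advance for the total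
    loss rho^m; as rho >= 1, lower orders lose less. This trade limits the number of derivatives in
    the final estimate. *)
Lemma wsmooth_absorb m g g' f (rho : point -> R) (K : R) :
  (forall p, D p -> 1 <= rho p) ->
  (forall p, D p -> 0 <= g p /\ g p * rho p ^+ m <= K * g' p) ->
  wsmooth D dirs (fun o p => wt o p * rho p) m g f -> wsmooth D dirs wt m g' f.
Proof.
move=> r1; elim: m g g' f => [|m ih] g g' f gg [fc [C fC] fd].
  split => //; exists (`|C| * K) => p Dp; have [g0] := gg p Dp.
  rewrite expr0 mulr1 => gK; rewrite -mulrA; apply: le_trans (fC p Dp) _.
  apply: (@le_trans _ _ (`|C| * g p)); first by rewrite ler_wpM2r// ler_norm.
  by rewrite ler_wpM2l.
split => //.
  exists (`|C| * K) => p Dp; have [g0 gK] := gg p Dp.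
  apply: le_trans (fC p Dp) _; rewrite -mulrA; apply: (@le_trans _ _ (`|C| * g p)).
    by rewrite ler_wpM2r// ler_norm.
  rewrite ler_wpM2l// (le_trans _ gK)// ler_peMr//.
  by apply: exprn_ege1; exact: r1.
move=> o oD; have [fo fod fos] := fd o oD; exists fo => //.
apply: ih fos => p Dp; have [g0 gK] := gg p Dp.
have r0 : 0 <= rho p by apply: le_trans (r1 p Dp).
split; first by rewrite !mulr_ge0// wt_ge0.
rewrite (_ : _ * _ = g p * rho p ^+ m.+1 * wt o p); last by rewrite exprS; ring.
by rewrite mulrA ler_wpM2r// wt_ge0.
Qed.

(** Induction on the order through (e^f)' = f' e^f. The function f may be large: only its
    derivatives and the modulus of e^f are bounded. *)
Lemma wsmooth_cexp m g f (fo : option 'I_n -> point -> R[i]) :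
  cont_on D f -> (forall o p, dirs o -> D p -> has_pd D o f p (fo o p)) ->
  (forall o, dirs o -> wsmooth D dirs wt m (wt o) (fo o)) ->
  (exists C : R, forall p, D p -> normc (cexp (f p)) <= C * g p) ->
  wsmooth D dirs wt m.+1 g (fun p => cexp (f p)).
Proof.
move=> fc fd fos fC.
have ec : cont_on D (fun p => cexp (f p)) by move=> p Dp; apply: ccvg_cexp; exact: fc.
have : forall k, (k <= m.+1)%N -> wsmooth D dirs wt k g (fun p => cexp (f p)).
  elim=> [|k ih] km; first by split.
  split => // o oD; exists (fun p => fo o p * cexp (f p)).
    by move=> p Dp; apply: dquot_cexp => //; exact: fd.
  have fok := @wsmooth_leq _ _ _ k m _ _ km (fos o oD).
  apply: wsmooth_eqw (wsmoothM fok (ih (ltnW km))) => p _.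
  by rewrite mulrC.
exact.
Qed.

End FixedDomain.
End WeightedSmoothness.

(** * Norms, limits and inverses of matrices *)

Section MatrixNorm.
Context {R : realType}.

Lemma cmxnorm_ge0 m p (A : 'M[R[i]]_(m, p)) : 0 <= cmxnorm A.
Proof. by rewrite /cmxnorm; elim/big_rec: _ => // i x _ x0; rewrite le_max x0 orbT. Qed.

Lemma cmxnorm_entry m p (A : 'M[R[i]]_(m, p)) i j : normc (A i j) <= cmxnorm A.
Proof.
rewrite /cmxnorm (le_trans _ (le_bigmax_cond _ _ (erefl : xpredT i)))//.
exact: le_bigmax_cond.
Qed.

Lemma cmxnorm_le m p (A : 'M[R[i]]_(m, p)) (c : R) : 0 <= c ->
  (forall i j, normc (A i j) <= c) -> cmxnorm A <= c.
Proof.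
by move=> c0 Ac; apply/bigmax_leP; split => // i _; apply/bigmax_leP; split.
Qed.

Lemma cmxnormM m p q (A : 'M[R[i]]_(m, p)) (B : 'M[R[i]]_(p, q)) :
  cmxnorm (A *m B) <= p%:R * (cmxnorm A * cmxnorm B).
Proof.
apply: cmxnorm_le => [|i j]; first by rewrite !mulr_ge0 ?cmxnorm_ge0.
rewrite mxE; apply: le_trans (normc_sum _ _ _) _.
apply: (@le_trans _ _ (\sum_(k < p) cmxnorm A * cmxnorm B)).
  apply: ler_sum => k _; rewrite Normc.normcM.
  by apply: ler_pM; rewrite ?normc_ge0 ?cmxnorm_entry.
by rewrite sumr_const card_ord mulr_natl.
Qed.

Lemma cmxnormD m p (A B : 'M[R[i]]_(m, p)) : cmxnorm (A + B) <= cmxnorm A + cmxnorm B.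
Proof.
apply: cmxnorm_le => [|i j]; first by rewrite addr_ge0 ?cmxnorm_ge0.
by rewrite mxE (le_trans (le_normcD _ _))// lerD ?cmxnorm_entry.
Qed.

Lemma cmxnormN m p (A : 'M[R[i]]_(m, p)) : cmxnorm (- A) = cmxnorm A.
Proof.
have le (B : 'M[R[i]]_(m, p)) : cmxnorm (- B) <= cmxnorm B.
  apply: cmxnorm_le => [|i j]; first exact: cmxnorm_ge0.
  by rewrite mxE normcN cmxnorm_entry.
by apply/eqP; rewrite eq_le le -{1}[A]opprK le.
Qed.

(* A matrix [1 + D] with [d |D| <= 1/2] is invertible: if [v (1 + D) = 0] then
   [v = - v D], so [|v| <= |v| / 2]. *)
Lemma near_identity_unit d (A : 'M[R[i]]_d) :
  d%:R * cmxnorm (A - 1%:M) <= 2^-1 ->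
  A \in unitmx /\ cmxnorm (invmx A) <= 2 * cmxnorm (1%:M : 'M[R[i]]_d).
Proof.
move=> dA.
(* Used with W = 0 for the kernel and with W = 1 for the inverse. *)
have half m (V W : 'M[R[i]]_(m, d)) : V *m A = W -> cmxnorm V <= 2 * cmxnorm W.
  move=> VA; have E : V = W - V *m (A - 1%:M).
    by rewrite mulmxBr VA mulmx1 opprB addrC subrK.
  have : cmxnorm V <= cmxnorm W + cmxnorm V * 2^-1.
    rewrite {1}E (le_trans (cmxnormD _ _))// cmxnormN lerD2l.
    rewrite (le_trans (cmxnormM _ _))// mulrCA ler_wpM2l ?cmxnorm_ge0//.
  by have := cmxnorm_ge0 V; lra.
have Au : A \in unitmx.
  rewrite -row_free_unit -kermx_eq0; apply/eqP/matrixP => i j.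
  have /half : kermx A *m A = 0 by exact: mulmx_ker.
  have -> : cmxnorm (0 : 'M[R[i]]_d) = 0.
    apply/eqP; rewrite eq_le cmxnorm_ge0 andbT; apply: cmxnorm_le => // a b.
    by rewrite mxE Normc.normc0.
  rewrite mulr0 => /(le_trans (cmxnorm_entry _ i j)) k0.
  by apply/eqP; rewrite [X in _ == X]mxE -normc_eq0 eq_le k0 normc_ge0.
by split => //; apply: half; rewrite mulVmx.
Qed.

End MatrixNorm.

Section MatrixLimits.
Context {R : realType} {T : Type} {F : set_system T} {FF : Filter F}.

Definition mccvg m p (A : T -> 'M[R[i]]_(m, p)) (L : 'M[R[i]]_(m, p)) : Prop :=
  forall i j, ccvg F (fun x => A x i j) (L i j).

Lemma mccvgM m p q (A : T -> 'M[R[i]]_(m, p)) (B : T -> 'M[R[i]]_(p, q)) L L' :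
  mccvg A L -> mccvg B L' -> mccvg (fun x => A x *m B x) (L *m L').
Proof.
move=> AL BL i j; rewrite mxE.
apply: (ccvg_ext _ (ccvg_sum (index_enum _) (fun k => ccvgM (AL i k) (BL k j)))).
by move=> x; rewrite mxE.
Qed.

Lemma mccvg_cst m p (L : 'M[R[i]]_(m, p)) : mccvg (fun=> L) L.
Proof. by move=> i j; exact: ccvg_cst. Qed.

Lemma mccvgN m p (A : T -> 'M[R[i]]_(m, p)) L : mccvg A L -> mccvg (fun x => - A x) (- L).
Proof.
move=> AL i j; rewrite mxE; apply: ccvg_ext (ccvgN (AL i j)) => x.
by rewrite mxE.
Qed.

Lemma mccvg_norm m p (A : T -> 'M[R[i]]_(m, p)) L : mccvg A L <->
  forall e : R, 0 < e -> \forall x \near F, cmxnorm (A x - L) <= e.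
Proof.
split=> [AL e e0|AL i j].
  have H : \forall x \near F, forall ij : 'I_m * 'I_p, normc (A x ij.1 ij.2 - L ij.1 ij.2) <= e.
    by apply: filter_forall => -[i j]; exact: (ccvgP _ _).1 (AL i j) e e0.
  apply: filterS H => x H; apply: cmxnorm_le => [|i j]; first exact: ltW.
  by rewrite !mxE; exact: H (i, j).
apply/ccvgP => e /AL; apply: filterS => x; apply: le_trans.
by have := cmxnorm_entry (A x - L) i j; rewrite !mxE.
Qed.

(** A^-1 - L^-1 = - A^-1 (A - L) L^-1, where the a priori bound on A^-1 takes the place of a
    discussion of determinants. *)
Lemma mccvg_inv d (A : T -> 'M[R[i]]_d) L (C : R) : mccvg A L -> L \in unitmx ->
  (\forall x \near F, A x \in unitmx /\ cmxnorm (invmx (A x)) <= C) ->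
  mccvg (fun x => invmx (A x)) (invmx L).
Proof.
move=> /mccvg_norm AL Lu AC; apply/mccvg_norm => e e0.
pose K := `|C| * (d%:R * d%:R * cmxnorm (invmx L)) + 1.
have K0 : 0 < K by rewrite ltr_wpDl// !mulr_ge0// cmxnorm_ge0.
have eK : 0 < e / K by rewrite divr_gt0.
apply: filterS2 AC (AL _ eK) => x [Au AC] Ae.
have -> : invmx (A x) - invmx L = - (invmx (A x) *m (A x - L) *m invmx L).
  by rewrite mulmxBr mulVmx// mulmxBl mul1mx -mulmxA mulmxV// mulmx1 opprB.
rewrite cmxnormN (le_trans (cmxnormM _ _))//.
have H : cmxnorm (invmx (A x) *m (A x - L)) <= d%:R * (`|C| * (e / K)).
  rewrite (le_trans (cmxnormM _ _))// ler_wpM2l//.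
  by apply: ler_pM; rewrite ?cmxnorm_ge0//; exact: le_trans AC (ler_norm _).
apply: (@le_trans _ _ (d%:R * (d%:R * (`|C| * (e / K)) * cmxnorm (invmx L)))).
  by rewrite ler_wpM2l// ler_wpM2r// cmxnorm_ge0.
have -> : d%:R * (d%:R * (`|C| * (e / K)) * cmxnorm (invmx L)) = (K - 1) * e / K.
  by rewrite /K; ring.
by rewrite ler_pdivrMr// mulrC ler_wpM2l//; [exact: ltW|lra].
Qed.

End MatrixLimits.
Arguments mccvg {R T} F {m p} A L.

Section MatrixQuotients.
Context {R : realType} {F : set_system R} {FF : Filter F} (F0 : (0 : R)^' `<=` F).

Definition mdquot m p (A : R -> 'M[R[i]]_(m, p)) (V L : 'M[R[i]]_(m, p)) : Prop :=
  forall i j, dquot F (fun h => A h i j) (V i j) (L i j).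

Lemma mdquotP m p (A : R -> 'M[R[i]]_(m, p)) V L :
  mdquot A V L <-> mccvg F (fun h => h^-1%:C *: (A h - V)) L.
Proof.
by split=> AL i j; apply: ccvg_ext (AL i j) => h /=; rewrite !mxE.
Qed.

Lemma mdquot_mccvg m p (A : R -> 'M[R[i]]_(m, p)) V L : mdquot A V L -> mccvg F A V.
Proof. by move=> AL i j; exact: dquot_ccvg (AL i j). Qed.

Lemma mdquotM m p q (A : R -> 'M[R[i]]_(m, p)) (B : R -> 'M[R[i]]_(p, q)) V L V' L' :
  mdquot A V L -> mdquot B V' L' ->
  mdquot (fun h => A h *m B h) (V *m V') (L *m V' + V *m L').
Proof.
move=> AL BL i j; rewrite !mxE -big_split/=.
apply: (dquot_near _ (dquot_sum (index_enum _) (fun k => dquotM F0 (AL i k) (BL k j)))).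
by apply: filterE => h /=; rewrite mxE.
Qed.

Lemma mdquot_cst m p (V : 'M[R[i]]_(m, p)) : mdquot (fun=> V) V 0.
Proof. by move=> i j; rewrite mxE; exact: dquot_cst. Qed.

Lemma mdquot_inv d (A : R -> 'M[R[i]]_d) V L (C : R) : mdquot A V L -> V \in unitmx ->
  (\forall h \near F, A h \in unitmx /\ cmxnorm (invmx (A h)) <= C) ->
  mdquot (fun h => invmx (A h)) (invmx V) (- (invmx V *m L *m invmx V)).
Proof.
move=> AL Vu AC; have iA : mccvg F (fun x => invmx (A x)) (invmx V).
  by apply: mccvg_inv AC => //; exact: mdquot_mccvg AL.
apply/mdquotP; have /mdquotP qA := AL.
have H : mccvg F (fun h => - (invmx (A h) *m (h^-1%:C *: (A h - V)) *m invmx V))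
    (- (invmx V *m L *m invmx V)).
  by apply: mccvgN; apply: mccvgM; [exact: mccvgM iA qA|exact: mccvg_cst].
move=> i j; apply: ccvg_near (H i j).
apply: filterS AC => h [Au _]; congr (fun_of_matrix _ i j).
rewrite -scalemxAr -scalemxAl -scalerN; congr (_ *: _).
by rewrite mulmxBr mulVmx// mulmxBl mul1mx -mulmxA mulmxV// mulmx1 opprB.
Qed.

End MatrixQuotients.
Arguments mdquot {R} F {m p} A V L.

(** * Functions on a half-space *)

Section HalfSpace.
Context {R : realType} {n : nat} (U : set 'rV[R]_n).
Hypothesis Uopen : forall xi, U xi -> \forall xi' \near xi, U xi'.
Local Notation point := (R * 'rV[R]_n)%type.
Implicit Types (f : point -> R[i]) (xi : 'rV[R]_n).

Definition halfspace : set point := [set p | 0 <= p.1 /\ U p.2].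
Local Notation Y := halfspace.

Lemma freq_near xi j (P : set 'rV[R]_n) : (\forall xi' \near xi, P xi') ->
  exists2 d : R, 0 < d & forall h : R, `|h| < d -> P (xi + h *: delta_mx ord0 j).
Proof.
move=> /nbhs_ballP[d /= d0 dP].
pose k : R := `|delta_mx ord0 j : 'rV[R]_n| + 1.
have k0 : 0 < k by rewrite ltr_wpDl.
exists (d / k); first by rewrite divr_gt0.
move=> h; rewrite ltr_pdivlMr// => hd; apply: dP.
rewrite -ball_normE /= opprD addrA subrr sub0r normrN normrZ.
by apply: le_lt_trans hd; rewrite ler_wpM2l// lerDl.
Qed.

(** Tube lemma: compactness of [0, K] makes continuity in xi uniform in y. Neighbourhoods of y may
    leave the half-space, hence the guard 0 <= y in [P]. *)
Lemma uniform_cont f xi (K e : R) : cont_on Y f -> U xi -> 0 < e ->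
  \forall xi' \near xi, forall y, 0 <= y <= K -> normc (f (y, xi') - f (y, xi)) <= e.
Proof.
move=> fc Uxi e0.
have e2 : 0 < e / 2 by rewrite divr_gt0.
pose P xi' y := 0 <= y -> normc (f (y, xi') - f (y, xi)) <= e.
have H : forall y, `[0, K]%classic y -> \forall y' \near y & xi' \near xi, P xi' y'.
  move=> y; rewrite /= in_itv/= => /andP[y0 yK].
  have /ccvgP/(_ _ e2)/pair_near[d d0 dP] := fc (y, xi) (conj y0 Uxi).
  exists ([set y' | `|y' - y| < d], [set xi' | `|xi' - xi| < d /\ U xi']); first split => /=.
  - by apply/nbhs_ballP; exists d => // z; rewrite /ball/= distrC.
  - near=> z; split; last by near: z; exact: Uopen.
    near: z; apply/nbhs_ballP; exists d => // z.
    by rewrite -ball_normE /= distrC.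
  - move=> [y' xi'] /= [yd [xd Uxi']] y'0.
    have D0 : `|xi - xi| < d by rewrite subrr normr0.
    have H1 := dP (y', xi') yd xd (conj y'0 Uxi').
    have H2 := dP (y', xi) yd D0 (conj y'0 Uxi).
    have := le_trans (le_normcB _ _) (lerD H1 H2).
    by rewrite -splitr opprB addrA subrK.
apply: filterS ((compact_near_coveringP _).1 (@segment_compact _ 0 K) _ _ _ _ H).
by move=> xi' HP y yK; apply: HP; rewrite /= ?in_itv//; case/andP: yK.
Unshelve. all: by end_near. Qed.

(** By the mean value inequality on the frequency segment, the error of the quotient is governed by
    the variation of [fj], which is small uniformly in y by [uniform_cont]. *)
Lemma uniform_quotient f fj j xi (K e : R) :
  (forall p, Y p -> has_pd Y (Some j) f p (fj p)) -> cont_on Y fj -> U xi -> 0 < e ->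
  exists2 d : R, 0 < d & forall h : R, h != 0 -> `|h| < d ->
    U (xi + h *: delta_mx ord0 j) /\
    forall y, 0 <= y <= K ->
      normc (h^-1%:C * (f (y, xi + h *: delta_mx ord0 j) - f (y, xi)) - fj (y, xi)) <= e.
Proof.
move=> fd fjc Uxi e0; have e2 : 0 < e / 2 by rewrite divr_gt0.
have [d d0 dP] : exists2 d : R, 0 < d & forall h : R, `|h| < d ->
    U (xi + h *: delta_mx ord0 j) /\ forall y, 0 <= y <= K ->
      normc (fj (y, xi + h *: delta_mx ord0 j) - fj (y, xi)) <= e / 2.
  apply: (@freq_near xi j (fun xi' => U xi' /\ forall y, 0 <= y <= K ->
    normc (fj (y, xi') - fj (y, xi)) <= e / 2)).
  by apply: filterS2 (Uopen Uxi) (@uniform_cont fj xi K _ fjc Uxi e2).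
exists d => // h h0 hd; split=> [|y yK]; first by have [] := dP h hd.
set c := fj (y, xi).
pose g s := f ((y, xi) + s *: dir (Some j)) - s%:C * c.
pose g' s := fj ((y, xi) + s *: dir (Some j)) - c.
have Ys s : `|s| < d -> Y ((y, xi) + s *: dir (Some j)).
  by move=> /dP[Us _]; rewrite dir_freq; split => //=; case/andP: yK.
have gd (S : set R) s : (forall z, S z -> `|z| < d) -> `|s| < d -> cwder S g s (g' s).
  move=> Sd sd; apply: dquotB; last exact: cwder_lin.
  apply: (@has_pd_line _ _ Y); first by move=> z /Sd/Ys.
  by apply: fd; exact: Ys.
have gb s : `|s| < d -> normc (g' s) <= e / 2.
  by move=> /dP[_ H]; rewrite /g' dir_freq; exact: H.
have key : normc (g h - g 0) <= 2 * (e / 2 * `|h|).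
  have [hp|hn] := leP 0 h.
    have hh z : 0 <= z <= h -> `|z| < d.
      by move=> zh; apply: le_lt_trans hd; rewrite !ger0_norm; lra.
    rewrite (ger0_norm hp) -[X in _ * (_ * X)]subr0; apply: mean_value_bound hp _ _.
      by move=> z zh; apply: gd; [move=> w; rewrite /= in_itv/=; exact: hh|exact: hh].
    by move=> z zh; apply: gb; apply: hh; lra.
  have hh z : h <= z <= 0 -> `|z| < d.
    by move=> zh; apply: le_lt_trans hd; rewrite !ler0_norm; lra.
  rewrite -normcN opprB (ltr0_norm hn) -[X in _ * (_ * X)]add0r.
  apply: mean_value_bound (ltW hn) _ _.
    by move=> z zh; apply: gd; [move=> w; rewrite /= in_itv/=; exact: hh|exact: hh].
  by move=> z zh; apply: gb; apply: hh; lra.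
have -> : h^-1%:C * (f (y, xi + h *: delta_mx ord0 j) - f (y, xi)) - c
    = h^-1%:C * (g h - g 0).
  rewrite /g !dir_freq scale0r addr0 mul0r subr0 /= -[in LHS](mul1r c).
  rewrite -[in LHS](_ : h^-1%:C * h%:C = 1 :> R[i]); first by ring.
  by rewrite -rmorphM/= mulVf.
rewrite Normc.normcM normc_real normfV mulrC ler_pdivrMr ?normr_gt0//.
by apply: le_trans key _; rewrite le_eqVlt; apply/orP; left; apply/eqP; field.
Qed.

Lemma joint_cont f :
  (forall xi, U xi -> forall K e : R, 0 < e ->
    \forall xi' \near xi, forall y, 0 <= y <= K -> normc (f (y, xi') - f (y, xi)) <= e) ->
  (forall xi, U xi -> forall y : R, 0 <= y ->
    ccvg (within `[0, +oo[ (nbhs y)) (fun y : R => f (y, xi)) (f (y, xi))) ->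
  cont_on Y f.
Proof.
move=> fu ft [y xi] [/= y0 Uxi]; apply/ccvgP => e e0.
have e2 : 0 < e / 2 by rewrite divr_gt0.
have /ccvgP/(_ _ e2)/nbhs_ballP[d /= d0 dP] := ft xi Uxi y y0.
have /nbhs_ballP[r /= r0 rP] := fu xi Uxi (y + d) _ e2.
apply/pair_near; exists (Num.min d r); first by rewrite lt_min d0.
move=> [y' xi'] /=; rewrite !lt_min => /andP[yd _] /andP[_ xr] [/= y'0 Uxi'].
have H1 : normc (f (y', xi') - f (y', xi)) <= e / 2.
  apply: rP; first by rewrite -ball_normE /= distrC.
  by move: yd; rewrite ltr_norml y'0 /= => /andP[_]; lra.
have H2 : normc (f (y', xi) - f (y, xi)) <= e / 2.
  by apply: dP; rewrite /ball/= ?in_itv/= ?y'0// distrC.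
have := le_trans (le_normcD _ _) (lerD H1 H2).
by rewrite -splitr addrA subrK.
Qed.

Lemma halfspace_time f (y : R) xi l : U xi ->
  has_pd Y None f (y, xi) l <-> cwder `[0, +oo[ (fun y => f (y, xi)) y l.
Proof.
move=> Uxi; rewrite has_pd_time (_ : [set s | Y (s, xi)] = `[0, +oo[%classic)//.
by apply/seteqP; split => z /=; rewrite in_itv/= andbT; [case|].
Qed.

Lemma cont_on_time f xi (y : R) : cont_on Y f -> U xi -> 0 <= y ->
  ccvg (within `[0, +oo[ (nbhs y)) (fun y => f (y, xi)) (f (y, xi)).
Proof.
move=> fc Uxi y0; apply/ccvgP => e e0.
have /ccvgP/(_ e e0)/pair_near[d d0 dP] := fc (y, xi) (conj y0 Uxi).
apply/nbhs_ballP; exists d => // z /=; rewrite /ball/= in_itv/= andbT => zd z0.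
by apply: dP => //=; rewrite ?subrr ?normr0// distrC.
Qed.

Definition primitive f : point -> R[i] := fun p => cintegral 0 p.1 (fun y => f (y, p.2)).

Lemma primitive0 f xi : primitive f (0, xi) = 0.
Proof. exact: cintegral_id. Qed.

Lemma primitive_time f (y : R) xi : cont_on Y f -> U xi -> 0 <= y ->
  cwder `[0, +oo[ (fun y => primitive f (y, xi)) y (f (y, xi)).
Proof.
move=> fc Uxi y0; apply: (@cintegral_cwder _ 0 (fun y => f (y, xi))) => // z z0.
exact: cont_on_time.
Qed.

Lemma has_pd_primitive_time f p : cont_on Y f -> Y p ->
  has_pd Y None (primitive f) p (f p).
Proof.
case: p => y xi fc [/= y0 Uxi]; apply/halfspace_time => //.
exact: primitive_time.
Qed.

Lemma segment_ray (y : R) : (`[0, y] `<=` `[0, +oo[)%classic.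
Proof. by move=> z /=; rewrite !in_itv/= andbT => /andP[]. Qed.

(** The difference of the primitives at two frequencies vanishes at y = 0, and its y-derivative is
    uniformly small on [0, K]. Dividing by K + 1 keeps the denominator positive. *)
Lemma primitive_cont f : cont_on Y f -> cont_on Y (primitive f).
Proof.
move=> fc; apply: joint_cont => xi Uxi; last first.
  by move=> y y0; apply: cwder_cvg; exact: primitive_time.
move=> K e e0.
have [K0|K0] := ltP K 0.
  by near=> xi' => y /andP[y0 yK]; have := le_trans y0 yK; rewrite leNgt K0.
have eK : 0 < e / (2 * (K + 1)) by rewrite divr_gt0//; lra.
apply: filterS2 (Uopen Uxi) (@uniform_cont f xi K _ fc Uxi eK) => xi' Uxi' H y /andP[y0 yK].
pose g z := primitive f (z, xi') - primitive f (z, xi).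
have -> : primitive f (y, xi') - primitive f (y, xi) = g y - g 0.
  by rewrite /g !primitive0; ring.
apply: (@le_trans _ _ (2 * (e / (2 * (K + 1)) * (y - 0)))).
  apply: (@mean_value_bound _ 0 y g (fun z => f (z, xi') - f (z, xi))) => //.
    move=> x /andP[x0 xy]; apply: (cwderW (@segment_ray y)).
    by apply: dquotB; exact: primitive_time.
  by move=> x /andP[/ltW x0 /ltW xy]; apply: H; rewrite x0 (le_trans xy).
rewrite subr0 (_ : 2 * _ = e * (y / (K + 1))); last by field; lra.
by rewrite ger_pMr// ler_pdivrMr ?mul1r; lra.
Unshelve. all: by end_near. Qed.

(** Differentiation under the integral sign: the error of the difference quotient of the primitive
    vanishes at y = 0, and its y-derivative is the error for [f], small by [uniform_quotient]. *)
Lemma has_pd_primitive_freq f fj j p : cont_on Y f ->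
  (forall p, Y p -> has_pd Y (Some j) f p (fj p)) -> cont_on Y fj -> Y p ->
  has_pd Y (Some j) (primitive f) p (primitive fj p).
Proof.
case: p => y xi fc fd fjc [/= y0 Uxi]; apply/ccvgP => e e0.
have y1 : 0 < 2 * (y + 1) by lra.
have ey : 0 < e / (2 * (y + 1)) by rewrite divr_gt0.
have [d d0 dP] := @uniform_quotient f fj j xi y _ fd fjc Uxi ey.
apply/incrementsP; exists d => // h h0 hd _; have [Uh dh] := dP h h0 hd.
set xi' := xi + h *: delta_mx ord0 j in Uh dh.
pose g z := h^-1%:C * (primitive f (z, xi') - primitive f (z, xi)) - primitive fj (z, xi).
have -> : h^-1%:C * (primitive f ((y, xi) + h *: dir (Some j)) - primitive f (y, xi))
    - primitive fj (y, xi) = g y - g 0.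
  by rewrite dir_freq /g !primitive0; ring.
apply: (@le_trans _ _ (2 * (e / (2 * (y + 1)) * (y - 0)))).
  apply: (@mean_value_bound _ 0 y g
    (fun z => h^-1%:C * (f (z, xi') - f (z, xi)) - fj (z, xi))) => //.
    move=> z /andP[z0 zy]; apply: (cwderW (@segment_ray y)).
    apply: dquotB; last exact: primitive_time.
    by apply: dquotZ => //; apply: dquotB; exact: primitive_time.
  by move=> z /andP[/ltW z0 /ltW zy]; apply: dh; rewrite z0.
rewrite subr0 (_ : 2 * _ = e * (y / (y + 1))); last by field; lra.
by rewrite ger_pMr// ler_pdivrMr ?mul1r; lra.
Qed.

Section WeightedPrimitive.
Variable w : 'I_n -> 'rV[R]_n -> R.
Hypothesis w_ge0 : forall j xi, U xi -> 0 <= w j xi.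

(* The frequency weights do not depend on [y], so that they commute with the
   integration in [y]. *)
Definition hwt (o : option 'I_n) (p : point) : R := if o is Some j then w j p.2 else 1.

Lemma hwt_ge0 o p : Y p -> 0 <= hwt o p.
Proof. by case: p => y xi [_ /= Uxi]; case: o => [j|] //=; exact: w_ge0. Qed.

(** [H] is an antiderivative of [h]. As the time weight is 1, [G] has to dominate the integral H y -
    H 0 and also the integrand [h], which is the size of the y-derivative. The lemma serves for h =
    H = G = e^y (phases) and for h = e^-y, G = 1 (variation of Q). *)
Lemma wsmooth_primitive m (a : 'rV[R]_n -> R) (h H G : R -> R) (K : R) f :
  (forall xi, U xi -> 0 <= a xi) ->
  (forall y : R, is_derive y 1 H (h y)) ->
  (forall y : R, 0 <= y -> [/\ 0 <= h y, h y <= K * G y & H y - H 0 <= K * G y]) ->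
  wsmooth Y predT hwt m (fun p => a p.2 * h p.1) f ->
  wsmooth Y predT hwt m (fun p => a p.2 * G p.1) (primitive f).
Proof.
move=> a0 Hd hG.
have bd a' f' : (forall xi, U xi -> 0 <= a' xi) -> cont_on Y f' ->
    (exists C : R, forall p, Y p -> normc (f' p) <= C * (a' p.2 * h p.1)) ->
    exists C : R, forall p, Y p -> normc (primitive f' p) <= C * (a' p.2 * G p.1).
  move=> a'0 f'c [C fC]; exists (2 * (`|C| * K)) => -[y xi] Yp; have [y0 Uxi] : 0 <= y /\ U xi := Yp.
  have [hy hK HK] := hG y y0.
  rewrite -[X in normc X]subr0 -(primitive0 f' xi).
  apply: (@le_trans _ _ (2 * (`|C| * a' xi * H y - `|C| * a' xi * H 0))).
    apply: (@mean_value_ineq _ 0 y (fun y => primitive f' (y, xi)) (fun y => f' (y, xi))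
      (fun y => `|C| * a' xi * H y) (fun y => `|C| * a' xi * h y)) => //.
    - move=> x /andP[x0 _]; apply: (cwderW (@segment_ray y)).
      exact: primitive_time.
    - move=> x /andP[/ltW x0 _]; apply: le_trans (fC (x, xi) (conj x0 Uxi)) _.
      rewrite /= -mulrA ler_wpM2r ?ler_norm// mulr_ge0 ?a'0//.
      by have [] := hG x x0.
  rewrite -mulrBr -!mulrA ler_wpM2l// ler_wpM2l//.
  rewrite (_ : K * _ = a' xi * (K * G y)); last by ring.
  by rewrite ler_wpM2l// a'0.
elim: m a f a0 => [|m ih] a f a0 [fc fb fd].
  by split => //; [exact: primitive_cont|exact: bd].
split; [exact: primitive_cont|exact: bd|].
move=> [j|] _.
  have [fj fjd fjs] := fd (Some j) isT; have fjc := wsmooth_cont fjs.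
  exists (primitive fj); first by move=> p Yp; exact: has_pd_primitive_freq.
  apply: (wsmooth_eqw (g := fun p => a p.2 * w j p.2 * G p.1)).
    by move=> p _ /=; rewrite mulrAC.
  apply: (ih (fun xi => a xi * w j xi)).
    by move=> xi Uxi; rewrite mulr_ge0 ?a0 ?w_ge0.
  by apply: wsmooth_eqw fjs => p _ /=; rewrite mulrAC.
exists f; first by move=> p Yp; exact: has_pd_primitive_time.
have fs : wsmooth Y predT hwt m (fun p => a p.2 * h p.1) f by apply: wsmoothW; split.
apply: (wsmooth_weight hwt_ge0 (K := K)) fs => -[y xi] [/= y0 Uxi].
have [hy hK _] := hG y y0; rewrite mulr1 mulr_ge0 ?a0//; split => //.
by rewrite mulrCA ler_wpM2l// a0.
Qed.

End WeightedPrimitive.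
End HalfSpace.

Lemma filter_forall_mx T (F : set_system T) {FF : Filter F} a b (P : 'I_a -> 'I_b -> set T) :
  (forall i j, F (P i j)) -> F [set x | forall i j, P i j x].
Proof.
move=> FP.
have H : \forall x \near F, forall ij : 'I_a * 'I_b, P ij.1 ij.2 x.
  by apply: filter_forall => -[i j]; exact: FP.
by apply: filterS H => x H i j; exact: (H (i, j)).
Qed.

Lemma scale_sub_entry {R : realType} m p (k : R[i]) (A B : 'M[R[i]]_(m, p)) a c :
  (k *: A - B) a c = k * A a c - B a c.
Proof. by rewrite !mxE. Qed.

(** * Linear systems depending on a parameter *)

Section LinearODE.
Context {R : realType} {n : nat} (U : set 'rV[R]_n).
Hypothesis Uopen : forall xi, U xi -> \forall xi' \near xi, U xi'.
Local Notation point := (R * 'rV[R]_n)%type.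
Local Notation Y := (halfspace U).
(** [V] is a given solution, bounded together with its inverse; its regularity in the frequency,
    continuity included, is derived from that of [B]. *)
Context {d : nat} (V B : point -> 'M[R[i]]_d) (C : R).
Hypothesis C_ge0 : 0 <= C.
Hypothesis V0 : forall xi, U xi -> V (0, xi) = 1%:M.
Hypothesis Vd : forall p, Y p ->
  mdquot (increments Y None p) (fun h => V (p + h *: dir None)) (V p) (B p *m V p).
Hypothesis Vb : forall p, Y p ->
  [/\ V p \in unitmx, cmxnorm (V p) <= C & cmxnorm (invmx (V p)) <= C].
Hypothesis Bc : forall i j, cont_on Y (fun p => B p i j).

Let ray (y : R) : set_system R := within [set h | `[0, +oo[%classic (y + h)] (0 : R)^'.

Lemma ode_time (y : R) xi : U xi -> 0 <= y ->
  mdquot (ray y) (fun h => V (y + h, xi)) (V (y, xi)) (B (y, xi) *m V (y, xi)).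
Proof.
move=> Uxi y0 i j; apply/(@halfspace_time _ _ U (fun p => V p i j)) => //.
exact: (Vd (conj y0 Uxi : Y (y, xi)) i j).
Qed.

Lemma ode_inv_time (y : R) xi : U xi -> 0 <= y ->
  mdquot (ray y) (fun h => invmx (V (y + h, xi))) (invmx (V (y, xi)))
    (- (invmx (V (y, xi)) *m B (y, xi))).
Proof.
move=> Uxi y0; have [Vu _ _] := Vb (conj y0 Uxi : Y (y, xi)).
have -> : invmx (V (y, xi)) *m B (y, xi) =
    invmx (V (y, xi)) *m (B (y, xi) *m V (y, xi)) *m invmx (V (y, xi)).
  by rewrite -!mulmxA mulmxV// mulmx1.
apply: (@mdquot_inv _ _ _ _ _ _ _ _ C) => //.
- exact: within_dnbhs_le.
- exact: ode_time.
- apply/within_dnbhsP; exists 1 => // h _ _; rewrite /= in_itv/= andbT => yh.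
  by have [] := Vb (conj yh Uxi : Y (y + h, xi)).
Qed.

(* [invmx (V xi) *m V xi'] is constant [1] when [xi' = xi]; its time derivative
   measures the variation of the coefficient [B]. *)
Lemma ode_compare_time (y : R) xi xi' : U xi -> U xi' -> 0 <= y ->
  mdquot (ray y) (fun h => invmx (V (y + h, xi)) *m V (y + h, xi'))
    (invmx (V (y, xi)) *m V (y, xi'))
    (invmx (V (y, xi)) *m (B (y, xi') - B (y, xi)) *m V (y, xi')).
Proof.
move=> Uxi Uxi' y0.
have -> : invmx (V (y, xi)) *m (B (y, xi') - B (y, xi)) *m V (y, xi') =
    - (invmx (V (y, xi)) *m B (y, xi)) *m V (y, xi')
    + invmx (V (y, xi)) *m (B (y, xi') *m V (y, xi')).
  by rewrite mulmxBr mulmxBl mulNmx -!mulmxA addrC.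
apply: mdquotM; [exact: within_dnbhs_le|exact: ode_inv_time|exact: ode_time].
Qed.

Lemma mx_mean_value_bound a b (f f' : R -> 'M[R[i]]_d) (K : R) : a <= b -> 0 <= K ->
  (forall x, a <= x <= b -> mdquot (within [set h | `[a, b]%classic (x + h)] (0 : R)^')
     (fun h => f (x + h)) (f x) (f' x)) ->
  (forall x, a <= x <= b -> cmxnorm (f' x) <= K) ->
  cmxnorm (f b - f a) <= 2 * (K * (b - a)).
Proof.
move=> ab K0 fd fK; apply: cmxnorm_le => [|i j].
  by rewrite !mulr_ge0// subr_ge0.
rewrite !mxE; apply: (@mean_value_bound _ a b (fun x => f x i j) (fun x => f' x i j)) => //.
  by move=> x xab; exact: fd.
move=> x /andP[/ltW ax /ltW xb]; apply: le_trans (cmxnorm_entry _ _ _) (fK x _).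
by rewrite ax.
Qed.

Lemma mdquot_segment (y x : R) (f : R -> 'M[R[i]]_d) v l :
  mdquot (ray x) f v l ->
  mdquot (within [set h | `[0, y]%classic (x + h)] (0 : R)^') f v l.
Proof.
move=> fl i j; apply: dquot_filter (fl i j) => P; rewrite /ray /within/=.
by apply: filterS => h + yh; apply; exact: segment_ray yh.
Qed.

Lemma mx_uniform_cont (A : point -> 'M[R[i]]_d) xi (K e : R) :
  (forall i j, cont_on Y (fun p => A p i j)) -> U xi -> 0 < e ->
  \forall xi' \near xi, forall y, 0 <= y <= K -> cmxnorm (A (y, xi') - A (y, xi)) <= e.
Proof.
move=> Ac Uxi e0.
have H : \forall xi' \near xi, forall i j (y : R), 0 <= y <= K ->
    normc (A (y, xi') i j - A (y, xi) i j) <= e.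
  apply: filter_forall_mx => i j.
  exact: (@uniform_cont _ _ U Uopen (fun p => A p i j)).
apply: filterS H => xi' H y yK; apply: cmxnorm_le => [|i j]; first exact: ltW.
by rewrite !mxE; exact: H.
Qed.

(** Variation of constants: with Z = V(xi)^-1 V(xi') the difference is V(xi) (Z y - Z 0), and the
    derivative of Z contains the small factor B(xi') - B(xi). *)
Lemma ode_uniform xi (K e : R) : U xi -> 0 < e ->
  \forall xi' \near xi, forall y, 0 <= y <= K -> cmxnorm (V (y, xi') - V (y, xi)) <= e.
Proof.
move=> Uxi e0.
(* Three matrix products give d^3, three factors [V] or its inverse give C^3, and 2 |K| comes from
   the mean value inequality over [0, K]. *)
pose L : R := 2 * d%:R ^+ 3 * C ^+ 3 * `|K| + 1.
have L0 : 0 < L by rewrite ltr_wpDl// !mulr_ge0// exprn_ge0.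
have eL : 0 < e / L by rewrite divr_gt0.
apply: filterS2 (Uopen Uxi) (@mx_uniform_cont B xi K _ Bc Uxi eL) => xi' Uxi' BB y yK.
have /andP[y0 yK'] := yK.
pose Z z := invmx (V (z, xi)) *m V (z, xi').
have Vu z : 0 <= z -> V (z, xi) \in unitmx.
  by move=> z0; have [] := Vb (conj z0 Uxi : Y (z, xi)).
have -> : V (y, xi') - V (y, xi) = V (y, xi) *m (Z y - Z 0).
  rewrite /Z !V0// invmx1 mul1mx mulmxBr mulmx1 mulmxA mulmxV ?Vu// mul1mx//.
have [_ VC _] := Vb (conj y0 Uxi : Y (y, xi)).
pose M : R := d%:R * (d%:R * (C * (e / L)) * C).
have M0 : 0 <= M by rewrite /M; move: (e / L) (ltW eL) => z z0; rewrite !mulr_ge0.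
have ZM : cmxnorm (Z y - Z 0) <= 2 * (M * (y - 0)).
  apply: (@mx_mean_value_bound 0 y Z
    (fun z => invmx (V (z, xi)) *m (B (z, xi') - B (z, xi)) *m V (z, xi'))) => //.
    by move=> z /andP[z0 zy]; apply: mdquot_segment; exact: ode_compare_time.
  move=> z /andP[z0 zy].
  have [_ _ VC1] := Vb (conj z0 Uxi : Y (z, xi)).
  have [_ VC2 _] := Vb (conj z0 Uxi' : Y (z, xi')).
  rewrite (le_trans (cmxnormM _ _))// ler_wpM2l// ler_pM ?cmxnorm_ge0//.
  rewrite (le_trans (cmxnormM _ _))// ler_wpM2l// ler_pM ?cmxnorm_ge0//.
  by apply: BB; rewrite z0 (le_trans zy).
rewrite (le_trans (cmxnormM _ _))//.
apply: (@le_trans _ _ (d%:R * (C * (2 * (M * (y - 0)))))).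
  by rewrite ler_wpM2l// ler_pM ?cmxnorm_ge0.
have -> : d%:R * (C * (2 * (M * (y - 0)))) = (2 * d%:R ^+ 3 * C ^+ 3 * y) * e / L.
  by rewrite /M; ring.
rewrite ler_pdivrMr// mulrC ler_wpM2l//; first exact: ltW.
rewrite /L ler_wpDr// ler_wpM2l//; first by rewrite !mulr_ge0// exprn_ge0.
by rewrite (le_trans yK')// ler_norm.
Qed.

Lemma ode_cont i j : cont_on Y (fun p => V p i j).
Proof.
apply: joint_cont => // xi Uxi; last first.
  by move=> y y0; exact: cwder_cvg (ode_time Uxi y0 i j).
move=> K e e0; apply: filterS (@ode_uniform xi K e Uxi e0) => xi' H y yK.
by have := le_trans (cmxnorm_entry _ i j) (H y yK); rewrite !mxE.
Qed.

Lemma ode_inv_cont i j : cont_on Y (fun p => invmx (V p) i j).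
Proof.
move=> p Yp; have [Vu _ _] := Vb Yp.
apply: (mccvg_inv (C := C)) => //.
  by move=> a b; exact: ode_cont.
by rewrite near_within; apply: filterE => q Yq; have [] := Vb Yq.
Qed.

Section FrequencyDerivative.
Variables (j : 'I_n) (Bj : point -> 'M[R[i]]_d).
Hypothesis Bjd : forall p, Y p ->
  mdquot (increments Y (Some j) p) (fun h => B (p + h *: dir (Some j))) (B p) (Bj p).
Hypothesis Bjc : forall a b, cont_on Y (fun p => Bj p a b).
Hypothesis Bjb : forall xi, U xi -> exists b : R, forall y, 0 <= y -> cmxnorm (Bj (y, xi)) <= b.

Definition ode_variation (p : point) : 'M[R[i]]_d :=
  \matrix_(a, b) primitive (fun q => (invmx (V q) *m Bj q *m V q) a b) p.

Lemma ode_integrand_cont a b : cont_on Y (fun q => (invmx (V q) *m Bj q *m V q) a b).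
Proof.
move=> p Yp; apply: (@mccvgM _ _ (within Y (nbhs p))).
  by apply: mccvgM => c e; [exact: ode_inv_cont|exact: Bjc].
by move=> c e; exact: ode_cont.
Qed.

(** The error of the quotient equals V (g y - g 0) with g = h^-1 V(xi)^-1 V(xi') - [ode_variation].
    The y-derivative [g'] of g compares two integrands and is uniformly small on [0, y]. *)
Lemma ode_freq p : Y p ->
  mdquot (increments Y (Some j) p) (fun h => V (p + h *: dir (Some j))) (V p)
    (V p *m ode_variation p).
Proof.
case: p => y xi [y0 Uxi]; rewrite /= in y0 Uxi.
apply/mdquotP/mccvg_norm => e e0.
have [b bP] := Bjb Uxi.
pose L : R := d%:R * C * 2 * y * (d%:R * (C * (d%:R * C + d%:R * `|b|))) + 1.
have L0 : 0 < L by rewrite ltr_wpDl// !mulr_ge0// ?addr_ge0 ?mulr_ge0.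
pose e1 := e / L; have e10 : 0 < e1 by rewrite divr_gt0.
pose xih h := xi + h *: delta_mx ord0 j : 'rV[R]_n.
have HB : increments Y (Some j) (y, xi) (fun h => forall z, 0 <= z <= y ->
    cmxnorm (h^-1%:C *: (B (z, xih h) - B (z, xi)) - Bj (z, xi)) <= e1).
  have H : increments Y (Some j) (y, xi) (fun h => forall a c (z : R), 0 <= z <= y ->
      normc (h^-1%:C * (B (z, xih h) a c - B (z, xi) a c) - Bj (z, xi) a c) <= e1).
    apply: filter_forall_mx => a c.
    have [r r0 rP] := @uniform_quotient _ _ U Uopen (fun p => B p a c) (fun p => Bj p a c) j xi y _
      (fun p Yp => Bjd Yp a c) (Bjc a c) Uxi e10.
    by apply/incrementsP; exists r => // h h0 hr _; have [_] := rP h h0 hr.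
  apply: filterS H => h H z zy; apply: cmxnorm_le => [|a c]; first exact: ltW.
  by rewrite !mxE; exact: H.
have HV : increments Y (Some j) (y, xi) (fun h => forall z, 0 <= z <= y ->
    cmxnorm (V (z, xih h) - V (z, xi)) <= e1).
  have [r r0 rP] := @freq_near _ _ xi j _ (@ode_uniform xi y _ Uxi e10).
  by apply/incrementsP; exists r => // h _ hr _; exact: rP.
have HU : increments Y (Some j) (y, xi) (fun h => U (xih h)).
  by apply/incrementsP; exists 1 => // h _ _; rewrite dir_freq => -[].
apply: filterS3 HB HV HU => h HB HV Uh.
rewrite dir_freq -/(xih h).
pose Z z := invmx (V (z, xi)) *m V (z, xih h).
pose g z := h^-1%:C *: Z z - ode_variation (z, xi).
pose g' z := h^-1%:C *: (invmx (V (z, xi)) *m (B (z, xih h) - B (z, xi)) *m V (z, xih h))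
  - invmx (V (z, xi)) *m Bj (z, xi) *m V (z, xi).
have Vu : V (y, xi) \in unitmx by have [] := Vb (conj y0 Uxi : Y (y, xi)).
have var0 : ode_variation (0, xi) = 0.
  by apply/matrixP => a c; rewrite !mxE primitive0.
have -> : h^-1%:C *: (V (y, xih h) - V (y, xi)) - V (y, xi) *m ode_variation (y, xi)
    = V (y, xi) *m (g y - g 0).
  rewrite /g /Z var0 !V0// invmx1 mul1mx subr0 !mulmxBr -!scalemxAr mulmxA.
  by rewrite mulmxV// mul1mx mulmx1 scalerBr addrAC.
pose K : R := d%:R * (C * (d%:R * C + d%:R * `|b|)) * e1.
have K0 : 0 <= K by rewrite /K; move: (ltW e10); move: (e1) => z z0; rewrite !mulr_ge0 ?addr_ge0 ?mulr_ge0.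
have gK : cmxnorm (g y - g 0) <= 2 * (K * (y - 0)).
  apply: (@mx_mean_value_bound 0 y g g') => //.
    move=> z /andP[z0 zy]; apply: mdquot_segment => a c.
    have H1 := ode_compare_time Uxi Uh z0 a c.
    have H2 := @primitive_time _ _ U _ z xi (@ode_integrand_cont a c) Uxi z0.
    have varE q : ode_variation q a c
        = primitive (fun q => (invmx (V q) *m Bj q *m V q) a c) q by rewrite mxE.
    rewrite /g /g' !scale_sub_entry varE.
    apply: (dquot_near _ (dquotB (dquotZ (within_dnbhs_le _) h^-1%:C H1) H2)).
    by apply: filterE => k; rewrite scale_sub_entry varE.
  move=> z zy; have /andP[z0 zy'] := zy.
  have [_ _ VC1] := Vb (conj z0 Uxi : Y (z, xi)).
  have [_ VC2 _] := Vb (conj z0 Uh : Y (z, xih h)).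
  (* One term for the error of the quotient of [B], one for replacing [V] at the displaced frequency
     by [V] at xi. *)
  have -> : g' z = invmx (V (z, xi)) *m
      ((h^-1%:C *: (B (z, xih h) - B (z, xi)) - Bj (z, xi)) *m V (z, xih h)
       + Bj (z, xi) *m (V (z, xih h) - V (z, xi))).
    rewrite /g' [_ *m V (z, xih h) in RHS]mulmxBl [Bj _ *m _]mulmxBr addrA subrK.
    by rewrite [RHS]mulmxBr -scalemxAl -scalemxAr !mulmxA.
  rewrite (le_trans (cmxnormM _ _))//.
  rewrite (_ : K = d%:R * (C * ((d%:R * C + d%:R * `|b|) * e1))); last by rewrite /K; ring.
  rewrite ler_wpM2l// ler_pM ?cmxnorm_ge0//.
  rewrite (le_trans (cmxnormD _ _))// mulrDl lerD//.
    rewrite (le_trans (cmxnormM _ _))// -mulrA ler_wpM2l// mulrC.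
    by rewrite ler_pM ?cmxnorm_ge0// HB.
  rewrite (le_trans (cmxnormM _ _))// -mulrA ler_wpM2l//.
  by rewrite ler_pM ?cmxnorm_ge0// ?HV// (le_trans (bP z z0))// ler_norm.
have [_ VC _] := Vb (conj y0 Uxi : Y (y, xi)).
rewrite (le_trans (cmxnormM _ _))//.
apply: (@le_trans _ _ (d%:R * (C * (2 * (K * (y - 0)))))).
  by rewrite ler_wpM2l// ler_pM ?cmxnorm_ge0.
have -> : d%:R * (C * (2 * (K * (y - 0)))) = (L - 1) * e / L.
  by rewrite /K /e1 /L; ring.
rewrite ler_pdivrMr// mulrC ler_wpM2l//; first exact: ltW.
by rewrite lerBlDr lerDl.
Qed.

Lemma ode_inv_freq p : Y p ->
  mdquot (increments Y (Some j) p) (fun h => invmx (V (p + h *: dir (Some j))))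
    (invmx (V p)) (- (ode_variation p *m invmx (V p))).
Proof.
move=> Yp; have [Vu _ _] := Vb Yp.
have -> : ode_variation p *m invmx (V p) = invmx (V p) *m (V p *m ode_variation p) *m invmx (V p).
  by rewrite mulmxA mulVmx// mul1mx.
apply: (@mdquot_inv _ _ _ _ _ _ _ _ C) => //.
- exact: ode_freq.
- by apply/incrementsP; exists 1 => // h _ _ Yh; have [] := Vb Yh.
Qed.

End FrequencyDerivative.

Variable w : 'I_n -> 'rV[R]_n -> R.
Hypothesis w_ge0 : forall j xi, U xi -> 0 <= w j xi.
Local Notation wt := (hwt w).

Lemma is_derive_NexpRN (y : R) : is_derive y 1 (fun y => - expR (- y)) (expR (- y)).
Proof.
apply: is_derive_eq.
by rewrite /GRing.scale/= mulrN1 opprK.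
Qed.

(** Induction on the order k. The variation W = int V^-1 (d_j B) V has order k when V and V^-1 do,
    so d_j V = V W and d_j V^-1 = - W V^-1 raise the order of both; hence the two are treated
    together. Integrability of e^-y keeps W of size 1/w-free in y, that is, bounded by the frequency
    weight alone. *)
Theorem ode_wsmooth m :
  (forall i j, wsmooth Y predT wt m (fun p => expR (- p.1)) (fun p => B p i j)) ->
  (forall i j, wsmooth Y predT wt m (fun=> 1) (fun p => V p i j)) /\
  (forall i j, wsmooth Y predT wt m (fun=> 1) (fun p => invmx (V p) i j)).
Proof.
move=> Bs; suff : forall k, (k <= m)%N ->
    (forall i j, wsmooth Y predT wt k (fun=> 1) (fun p => V p i j)) /\
    (forall i j, wsmooth Y predT wt k (fun=> 1) (fun p => invmx (V p) i j)) by exact.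
have Vbd i j : exists C : R, forall p, Y p -> normc (V p i j) <= C * 1.
  exists C => p Yp; have [_ H _] := Vb Yp.
  by rewrite mulr1 (le_trans (cmxnorm_entry _ _ _)).
have Vbi i j : exists C : R, forall p, Y p -> normc (invmx (V p) i j) <= C * 1.
  exists C => p Yp; have [_ _ H] := Vb Yp.
  by rewrite mulr1 (le_trans (cmxnorm_entry _ _ _)).
have wt_ge0 := hwt_ge0 w_ge0.
elim=> [|k ih] km.
  by split=> i j; split => //; [exact: ode_cont|exact: ode_inv_cont].
have [Vs Vis] := ih (ltnW km).
have Bk i j := wsmooth_leq (ltnW km) (Bs i j).
have exp1 p : Y p -> 0 <= expR (- p.1) <= 1.
  by case: p => y xi [/= y0 _]; rewrite expR_ge0 -[leRHS]expR0 ler_expR oppr_le0.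
have BVs i j : wsmooth Y predT wt k (fun=> 1) (fun p => (B p *m V p) i j).
  apply: (@wsmooth_weight _ _ _ _ _ wt_ge0 _ _ _ _ 1 _ (wsmooth_mulmx Bk Vs i j)) => p Yp.
  by rewrite !mulr1; apply/andP; exact: exp1.
have VBs i j : wsmooth Y predT wt k (fun=> 1) (fun p => (- (invmx (V p) *m B p)) i j).
  apply: (@wsmooth_eq _ _ _ _ _ _ _ (fun p => - (invmx (V p) *m B p) i j)).
    by move=> p _; rewrite [RHS]mxE.
  apply: wsmoothN.
  apply: (@wsmooth_weight _ _ _ _ _ wt_ge0 _ _ _ _ 1 _ (wsmooth_mulmx Vis Bk i j)) => p Yp.
  by rewrite mul1r mulr1; apply/andP; exact: exp1.
have freq j : exists W : point -> 'M[R[i]]_d, [/\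
    forall p, Y p -> mdquot (increments Y (Some j) p) (fun h => V (p + h *: dir (Some j)))
      (V p) (V p *m W p),
    forall p, Y p -> mdquot (increments Y (Some j) p) (fun h => invmx (V (p + h *: dir (Some j))))
      (invmx (V p)) (- (W p *m invmx (V p))) &
    forall a b, wsmooth Y predT wt k (fun p => w j p.2) (fun p => W p a b)].
  have /choice[bj bjP] : forall ab : 'I_d * 'I_d, exists fj : point -> R[i],
      (forall p, Y p -> has_pd Y (Some j) (fun p => B p ab.1 ab.2) p (fj p)) /\
      wsmooth Y predT wt k (fun p => expR (- p.1) * w j p.2) fj.
    move=> [a b]; have [_ _ /(_ (Some j) isT)[fj fjd fjs]] := wsmooth_leq km (Bs a b).
    by exists fj.
  pose Bj p := \matrix_(a, b) bj (a, b) p.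
  have Bjs a b : wsmooth Y predT wt k (fun p => expR (- p.1) * w j p.2) (fun p => Bj p a b).
    by apply: wsmooth_eq (bjP (a, b)).2 => p _; rewrite mxE.
  have Bjd p : Y p ->
      mdquot (increments Y (Some j) p) (fun h => B (p + h *: dir (Some j))) (B p) (Bj p).
    by move=> Yp a b; rewrite mxE; exact: (bjP (a, b)).1.
  have Bjc a b : cont_on Y (fun p => Bj p a b) by exact: wsmooth_cont (Bjs a b).
  have Bjb xi : U xi -> exists b : R, forall y, 0 <= y -> cmxnorm (Bj (y, xi)) <= b.
    move=> Uxi; have /choice[c cP] : forall ab : 'I_d * 'I_d, exists c : R, forall p, Y p ->
        normc (Bj p ab.1 ab.2) <= c * (expR (- p.1) * w j p.2).
      by move=> [a b]; have := wsmooth_bound (Bjs a b).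
    exists (\sum_ab `|c ab| * w j xi) => y y0.
    apply: cmxnorm_le => [|a b]; first by rewrite sumr_ge0// => ? _; rewrite mulr_ge0 ?w_ge0.
    rewrite (bigD1 (a, b))//= ler_wpDr//.
      by rewrite sumr_ge0// => ? _; rewrite mulr_ge0 ?w_ge0.
    have Yp : Y (y, xi) by [].
    apply: le_trans (cP (a, b) _ Yp) _; rewrite /= mulrA ler_wpM2r ?w_ge0//.
    have /andP[ey0 ey1] := exp1 _ Yp; rewrite /= in ey0 ey1.
    by rewrite (@le_trans _ _ (`|c (a, b)| * expR (- y)))// ?ler_wpM2r ?ler_norm// ler_piMr.
  exists (ode_variation Bj); split.
  - by move=> p Yp; exact: ode_freq.
  - by move=> p Yp; exact: ode_inv_freq.
  move=> a b.
  apply: (@wsmooth_eq _ _ _ _ _ _ _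
    (primitive (fun q => (invmx (V q) *m Bj q *m V q) a b))).
    by move=> p _; rewrite mxE.
  apply: (@wsmooth_eqw _ _ _ _ _ _ (fun p => w j p.2 * 1)) => [p _|]; first by rewrite mulr1.
  apply: (@wsmooth_primitive _ _ U Uopen w w_ge0 k (w j) (fun y => expR (- y))
      (fun y => - expR (- y)) (fun=> 1) 1
      (fun q => (invmx (V q) *m Bj q *m V q) a b)) => //.
    + by move=> xi; exact: w_ge0.
    + by move=> y; exact: is_derive_NexpRN.
    + move=> y y0; have := expR_ge0 (- y).
      have : expR (- y) <= 1 by rewrite -[leRHS]expR0 ler_expR oppr_le0.
      by rewrite oppr0 expR0; split; lra.
  apply: wsmooth_eqw (wsmooth_mulmx (wsmooth_mulmx Vis Bjs) Vs a b) => p _ /=.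
  by rewrite mul1r mulr1 mulrC.
split=> a b; apply: wsmoothSP => //.
- exact: ode_cont.
- move=> [j|] _.
    have [W [Wd _ Ws]] := freq j.
    exists (fun p => (V p *m W p) a b); first by move=> p Yp; exact: Wd.
    by apply: wsmooth_eqw (wsmooth_mulmx Vs Ws a b).
  exists (fun p => (B p *m V p) a b); first by move=> p Yp; exact: Vd.
  by apply: wsmooth_eqw (BVs a b) => p _ /=; rewrite mulr1.
- exact: ode_inv_cont.
- move=> [j|] _.
    have [W [_ Wd Ws]] := freq j.
    exists (fun p => (- (W p *m invmx (V p))) a b); first by move=> p Yp; exact: Wd.
    apply: (@wsmooth_eq _ _ _ _ _ _ _ (fun p => - (W p *m invmx (V p)) a b)).
      by move=> p _; rewrite [RHS]mxE.
    apply: wsmoothN; apply: wsmooth_eqw (wsmooth_mulmx Ws Vis a b) => p _ /=.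
    by rewrite mulrC.
  exists (fun p => (- (invmx (V p) *m B p)) a b); last first.
    by apply: wsmooth_eqw (VBs a b) => p _ /=; rewrite mulr1.
  case=> y xi [/= y0 Uxi]; apply/(@halfspace_time _ _ U (fun p => invmx (V p) a b)) => //.
  exact: ode_inv_time.
Qed.

End LinearODE.

(** * Symbols *)

Section Symbols.
Context {R : realType} {n : nat}.
Local Notation point := (R * 'rV[R]_n)%type.
Implicit Types (p q : point) (f : point -> R[i]) (w : seq (option 'I_n)).

Lemma enorm_ge0 (xi : 'rV[R]_n) : 0 <= enorm xi. Proof. exact: sqrtr_ge0. Qed.

Lemma enorm_continuous : continuous (@enorm R n).
Proof.
move=> xi.
have H (r : seq 'I_n) : (fun x : 'rV[R]_n => \sum_(j <- r) x ord0 j ^+ 2) @ nbhs xi -->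
    \sum_(j <- r) xi ord0 j ^+ 2.
  elim: r => [|j r ih].
    rewrite big_nil (_ : (fun x => _) = fun=> 0); first exact: cvg_cst.
    by apply/funext => x; rewrite big_nil.
  rewrite big_cons (_ : (fun x => _) =
    (fun x : 'rV[R]_n => x ord0 j * x ord0 j + \sum_(k <- r) x ord0 k ^+ 2)).
    by apply: cvgD => //; apply: cvgM; exact: coord_continuous.
  by apply/funext => x; rewrite big_cons expr2.
exact: (continuous_cvg _ (@sqrt_continuous R _) (H _)).
Qed.

Lemma enorm_gt0 (xi : 'rV[R]_n) N p : 0 < N -> Zhyp N p -> 0 < enorm p.2.
Proof.
move=> N0 [p0 pN]; rewrite lt_neqAle enorm_ge0 andbT eq_sym; apply/negP => /eqP e0.
by move: pN; rewrite e0 mulr0 leNgt N0.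
Qed.

(** The interior of the zone relative to t >= 0: small increments that keep t >= 0 stay inside, so
    here derivatives within the zone are local and agree with those within [nonneg_time]. *)
Definition Zopen (N : R) : set point := [set p | 0 <= p.1 /\ N < (1 + p.1) * enorm p.2].

Lemma Zopen_Zhyp N p : Zopen N p -> Zhyp N p.
Proof. by move=> [p0 /ltW]. Qed.

Lemma Zhyp_Zopen N N' p : N < N' -> Zhyp N' p -> Zopen N p.
Proof. by move=> NN [p0 pN]; split => //; exact: lt_le_trans pN. Qed.

Lemma Zopen_near N p : Zopen N p -> \forall q \near p, 0 <= q.1 -> Zopen N q.
Proof.
move=> [p0 pN].
have : (1 + q.1) * enorm q.2 @[q --> p] --> (1 + p.1) * enorm p.2.
  apply: cvgM; first by apply: cvgD; [exact: cvg_cst|exact: cvg_fst].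
  by apply: continuous_cvg; [exact: enorm_continuous|exact: cvg_snd].
move=> /cvgrPdist_lt/(_ ((1 + p.1) * enorm p.2 - N)).
rewrite subr_gt0 => /(_ pN); apply: filterS => q H q0; split => //.
by move: H; rewrite ltr_norml => /andP[_]; lra.
Qed.

Lemma dir_near p o o' (P : set point) : (\forall q \near p, P q) ->
  exists2 r : R, 0 < r & forall x y, `|x| <= r -> `|y| <= r -> P (p + x *: dir o + y *: dir o').
Proof.
move=> /nbhs_ballP[d /= d0 dP].
pose K : R := `|dir o : point| + `|dir o' : point| + 1.
have K0 : 0 < K by rewrite ltr_wpDl// addr_ge0.
exists (d / K / 2); first by rewrite !divr_gt0.
move=> x y xr yr; apply: dP; rewrite -ball_normE /=.
rewrite -addrA opprD addrA subrr sub0r normrN.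
apply: le_lt_trans (ler_normD _ _) _; rewrite !normrZ.
have dK : 0 < d / K by rewrite divr_gt0.
apply: (@le_lt_trans _ _ (d / K / 2 * K)).
  rewrite /K mulrDr mulr1 mulrDr ler_wpDr//; first by rewrite !divr_ge0// ltW.
  by rewrite lerD// ler_wpM2r.
by rewrite mulrAC divfK ?gt_eqF// ltr_pdivrMr// ltr_pMr//; lra.
Qed.

Lemma dir_time_ge0 p o (h : R) : 0 <= p.1 -> 0 <= h -> 0 <= (p + h *: dir o).1.
Proof.
by case: o => [j|] p0 h0; rewrite ?dir_freq ?dir_time //= addr_ge0.
Qed.

Lemma Dpartial_near (D : set point) o f g p :
  (\forall h \near increments D o p, f (p + h *: dir o) = g (p + h *: dir o)) -> f p = g p ->
  Dpartial D o f p = Dpartial D o g p.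
Proof.
have aux (u v : point -> R) :
    (\forall h \near increments D o p, u (p + h *: dir o) = v (p + h *: dir o)) -> u p = v p ->
    quotient u o p @ increments D o p = quotient v o p @ increments D o p.
  move=> uv uvp; apply/seteqP; split; apply: near_eq_cvg;
    by apply: filterS uv => h uvh; rewrite /quotient uvh uvp.
move=> fg fgp; rewrite /Dpartial; congr (_ * (_ +i* _)).
  rewrite (aux _ (fun q => cRe (g q)))//; last by rewrite fgp.
  by apply: filterS fg => h ->.
rewrite (aux _ (fun q => cIm (g q)))//; last by rewrite fgp.
by apply: filterS fg => h ->.
Qed.

Lemma mulI_i : injective (fun z : R[i] => 'i * z).
Proof.
move=> x y /(congr1 (fun z => - 'i * z)).
by rewrite !mulrA mulNr -expr2 sqr_i opprK !mul1r.
Qed.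

Section SmoothOnZone.
Variables (N : R) (f : point -> R[i]).
Hypothesis fs : smooth_on (Zhyp N) f.
Local Notation D := (Zhyp N).

Lemma Dword_has_pd w o p : D p -> has_pd D o (Dword D w f) p ('i * Dword D (o :: w) f p).
Proof. by move=> Dp; apply: partial_exists_has_pd; have [_ _] := fs w; exact. Qed.

Lemma Dword_cont w : cont_on D (Dword D w f).
Proof. by apply/cont_onP; have [] := fs w. Qed.

(** Locality, needed to apply an outer derivative to an identity known on [Zopen] only. *)
Lemma Dpartial_ext o (g g' : point -> R[i]) : (forall p, Zopen N p -> g p = g' p) ->
  forall p, Zopen N p -> Dpartial D o g p = Dpartial D o g' p.
Proof.
move=> gg p Op; apply: Dpartial_near; last exact: gg.
have [r r0 rP] := dir_near o o (Zopen_near Op).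
apply/incrementsP; exists r => // h _ hr [Dt _]; apply: gg.
have := rP h 0; rewrite normr0 scale0r addr0; apply => //; exact: ltW.
Qed.

(** Near a point of [Zopen] forward increments stay in the zone, even at t = 0, which provides the
    quadrant for [pd_comm]. The factors i undo the -i in D. *)
Lemma Dword_swap w o o' p : Zopen N p ->
  Dword D (o :: o' :: w) f p = Dword D (o' :: o :: w) f p.
Proof.
move=> Op; have [r r0 rP] := dir_near o o' (Zopen_near Op).
have Dc w' : cont_on D (fun q => 'i * ('i * Dword D w' f q)).
  by apply: cont_onM; [exact: cont_on_cst|apply: cont_onM; [exact: cont_on_cst|exact: Dword_cont]].
have Dd w' a b q : D q ->
    has_pd D b (fun q => 'i * Dword D (a :: w') f q) q ('i * ('i * Dword D (b :: a :: w') f q)).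
  by move=> Dq; apply: dquotZ; [exact: increments_dnbhs|exact: Dword_has_pd].
have Dp := Zopen_Zhyp Op.
have := @pd_comm _ _ D o o' (Dword D w f) (fun q => 'i * Dword D (o :: w) f q)
  (fun q => 'i * Dword D (o' :: w) f q) (fun q => 'i * ('i * Dword D (o' :: o :: w) f q))
  (fun q => 'i * ('i * Dword D (o :: o' :: w) f q)) p r r0.
move=> H; have {}H : 'i * ('i * Dword D (o' :: o :: w) f p) = 'i * ('i * Dword D (o :: o' :: w) f p).
  apply: H.
  - move=> x y /andP[x0 xr] /andP[y0 yr]; apply: Zopen_Zhyp; apply: rP.
    + by rewrite ger0_norm.
    + by rewrite ger0_norm.
    + by do 2 apply: dir_time_ge0 => //; case: Op.
  - by move=> q; exact: Dword_has_pd.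
  - by move=> q; exact: Dd.
  - by move=> q; exact: Dword_has_pd.
  - by move=> q; exact: Dd.
  - exact: Dc.
  - exact: Dc.
by apply/esym; do 2 apply: mulI_i.
Qed.

Lemma Dword_perm w w' : perm_eq w w' ->
  forall p, Zopen N p -> Dword D w f p = Dword D w' f p.
Proof.
have front x v : x \in v -> forall p, Zopen N p -> Dword D v f p = Dword D (x :: rem x v) f p.
  elim: v => [//|y v ih] xyv p Op.
  have [yx|yx] := eqVneq y x.
    by subst y; have -> : rem x (x :: v) = v by rewrite /= eqxx.
  have -> : rem x (y :: v) = y :: rem x v by rewrite /= (negbTE yx).
  have xv : x \in v by move: xyv; rewrite in_cons eq_sym (negbTE yx).
  rewrite Dword_swap//; exact: (Dpartial_ext y (ih xv) Op).
elim: w' w => [|x v ih] w wv p Op.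
  by move: wv => /perm_size/eqP; rewrite size_eq0 => /eqP ->.
have xw : x \in w by rewrite (perm_mem wv) mem_head.
rewrite (front x)//; apply: (Dpartial_ext x _ Op); apply: ih.
by rewrite -(perm_cons x) -(permPl (perm_to_rem xw)).
Qed.

End SmoothOnZone.

Definition word_multi_index w : {ffun 'I_n -> nat} := [ffun j => count_mem (Some j) w].

(** The target is the word for which symbol estimates are stated: frequencies differentiated first,
    times last. *)
Lemma word_perm w :
  perm_eq w (nseq (count_mem None w) None ++ map Some (mi_word (word_multi_index w))).
Proof.
apply/allP => x _ /=; apply/eqP; rewrite count_cat count_nseq count_map.
case: x => [j|] /=.
  rewrite mul0n add0n count_flatten -map_comp sumnE big_map big_enum/=.
  rewrite (bigD1 j)//= count_nseq /= eqxx mul1n ffunE big1 ?addn0// => k kj.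
  by rewrite count_nseq /= (_ : (Some k == Some j) = false) ?mul0n//; apply/negbTE.
by rewrite mul1n (@eq_count _ (preim Some (pred1 None)) pred0)// count_pred0 addn0.
Qed.

Definition zwt (o : option 'I_n) p : R :=
  if o is Some _ then (enorm p.2)^-1 else (1 + p.1)^-1.

Definition zweight (m1 m2 : R) p : R := enorm p.2 `^ m1 * (1 + p.1) `^ (- m2).

Lemma zwt_ge0 N o p : Zhyp N p -> 0 <= zwt o p.
Proof.
move=> [p0 _]; case: o => [j|] /=; first by rewrite invr_ge0 enorm_ge0.
by rewrite invr_ge0 addr_ge0.
Qed.

Lemma zwt_word w p :
  \prod_(o <- w) zwt o p =
  (enorm p.2)^-1 ^+ mi_size (word_multi_index w) * (1 + p.1)^-1 ^+ count_mem None w.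
Proof.
rewrite (perm_big _ (word_perm w)) big_cat/= big_nseq iter_mulr_1 mulrC big_map.
congr (_ * _); rewrite /mi_word big_flatten big_map big_enum /= /mi_size [in RHS]expr_sum.
by apply: eq_bigr => j _; rewrite big_nseq iter_mulr_1.
Qed.

(** For N > N0 the closed zone of [N] lies in [Zopen N0]. There every word can be sorted, and the
    estimate for sorted words covers all iterated derivatives. *)
Lemma symbol_wsmooth m1 m2 a : symbol m1 m2 a ->
  exists2 N0 : R, 0 < N0 & forall N, N0 < N -> forall m,
    wsmooth (Zhyp N) predT zwt m (zweight m1 m2) a.
Proof.
move=> [N0 N00 [asm ab]]; exists N0 => // N NN m.
have NZ p : Zhyp N p -> Zhyp N0 p by move=> /(Zhyp_Zopen NN)/Zopen_Zhyp.
have bound w : exists C : R, forall p, Zhyp N p ->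
    normc (Dword (Zhyp N0) w a p) <= C * (zweight m1 m2 p * \prod_(o <- w) zwt o p).
  have [C aC] := ab (count_mem None w) (word_multi_index w).
  exists C => -[t xi] Np; have Op := Zhyp_Zopen NN Np.
  rewrite (Dword_perm asm (word_perm w) Op) /Dword foldr_cat.
  apply: le_trans (aC t xi (NZ _ Np)) _; rewrite le_eqVlt; apply/orP; left; apply/eqP.
  have xi0 : 0 < enorm xi by exact: (enorm_gt0 xi (lt_trans N00 NN) Np).
  have t0 : 0 < 1 + t by case: Np => /= t0 _; rewrite ltr_pwDl.
  have powB (x r : R) k : 0 < x -> x `^ (r - k%:R) = x `^ r * x^-1 ^+ k.
    by move=> x0; rewrite powRD; last (by rewrite (gt_eqF x0) implybT); rewrite powRN powR_mulrn ?ltW// exprVn.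
  by rewrite zwt_word /zweight /= !powB//; ring.
have : forall w, wsmooth (Zhyp N) predT zwt m
    (fun p => zweight m1 m2 p * \prod_(o <- w) zwt o p) (Dword (Zhyp N0) w a).
  elim: m => [|m ih] v.
    by apply: wsmooth0P (bound v); exact: cont_on_sub NZ (Dword_cont asm v).
  apply: wsmoothSP (bound v) _; first exact: cont_on_sub NZ (Dword_cont asm v).
  move=> o _; exists (fun p => 'i * Dword (Zhyp N0) (o :: v) a p).
    by move=> p Np; apply: (has_pd_sub NZ); apply: Dword_has_pd => //; exact: NZ.
  apply: wsmoothZ; apply: wsmooth_eqw (ih (o :: v)) => p _.
  by rewrite big_cons; ring.
move=> /(_ [::]); apply: wsmooth_eqw => p _.
by rewrite big_nil mulr1.
Qed.

End Symbols.

(** * Logarithmic time coordinates *)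

Section Coordinates.
Context {R : realType} {n : nat} (N : R).
Hypothesis N_gt0 : 0 < N.
Local Notation point := (R * 'rV[R]_n)%type.
Implicit Types (xi : 'rV[R]_n) (p q : point) (D : set point).

(** Away from the sphere |xi| = N, [theta] is N / |xi| inside and 1 outside, hence smooth on an open
    set. *)
Definition Ureg : set 'rV[R]_n := [set xi | 0 < enorm xi /\ enorm xi != N].

Definition theta xi : R := 1 + txi N xi.

(** The derivative of log [theta] in direction j, of size 1/|xi|. *)
Definition dlog_theta (j : 'I_n) xi : R :=
  if enorm xi < N then - xi ord0 j / enorm xi ^+ 2 else 0.

(** Locally constant on [Ureg]; as a factor it turns the case distinction in [dlog_theta] into a
    product of smooth functions. *)
Definition inner xi : R[i] := if enorm xi < N then 1 else 0.

Lemma thetaE xi : theta xi = Num.max (N / enorm xi) 1.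
Proof. by rewrite /theta /txi addr_maxr subrKC addr0. Qed.

Lemma theta_ge1 xi : 1 <= theta xi.
Proof. by rewrite thetaE le_max lexx orbT. Qed.

Lemma theta_gt0 xi : 0 < theta xi.
Proof. exact: lt_le_trans (theta_ge1 xi). Qed.

Lemma theta_enorm xi : 0 < enorm xi -> theta xi * enorm xi = Num.max N (enorm xi).
Proof.
by move=> x0; rewrite thetaE maxr_pMl ?ltW// divfK ?gt_eqF// mul1r.
Qed.

Lemma Zhyp_theta p : 0 < enorm p.2 -> Zhyp N p <-> theta p.2 <= 1 + p.1.
Proof.
move=> x0; rewrite thetaE ge_max ler_pdivrMr// lerDl; split=> [[-> ->]//|/andP[? ?]].
by split.
Qed.

Lemma snd_continuous : continuous (fun q : point => q.2).
Proof. by move=> p; exact: cvg_snd. Qed.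

Lemma fst_continuous : continuous (fun q : point => q.1).
Proof. by move=> p; exact: cvg_fst. Qed.

Lemma enorm_near xi (P : R -> Prop) : (\forall x \near enorm xi, P x) ->
  \forall xi' \near xi, P (enorm xi').
Proof. by move=> H; exact: enorm_continuous H. Qed.

Lemma Ureg_open xi : Ureg xi -> \forall xi' \near xi, Ureg xi'.
Proof.
move=> [x0 xN]; apply: (@enorm_near xi (fun x => 0 < x /\ x != N)).
near=> x; split; first by near: x; exact: lt_nbhsr.
near: x; move: xN; rewrite neq_lt => /orP[xN|xN].
  by apply: filterS (lt_nbhsl xN) => x; rewrite neq_lt => ->.
by apply: filterS (lt_nbhsr xN) => x; rewrite neq_lt orbC => ->.
Unshelve. all: by end_near. Qed.

Lemma enorm_sqr xi : enorm xi ^+ 2 = \sum_(j < n) xi ord0 j ^+ 2.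
Proof. by rewrite sqr_sqrtr// sumr_ge0// => j _; rewrite sqr_ge0. Qed.

Lemma coord_le_enorm xi j : `|xi ord0 j| <= enorm xi.
Proof.
rewrite -sqrtr_sqr ler_sqrt ?sumr_ge0// => [|k _]; last exact: sqr_ge0.
by rewrite (bigD1 j)//= lerDl sumr_ge0// => k _; rewrite sqr_ge0.
Qed.

Lemma enorm_sqr_shift xi j (h : R) :
  enorm (xi + h *: delta_mx ord0 j) ^+ 2 = enorm xi ^+ 2 + h * (2 * xi ord0 j + h).
Proof.
rewrite !enorm_sqr (bigD1 j)//= [in RHS](bigD1 j)//= !mxE !eqxx /=.
rewrite (eq_bigr (fun k => xi ord0 k ^+ 2)) => [|k kj]; first by ring.
by rewrite !mxE eqxx (negbTE kj) mulr0 addr0.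
Qed.

Lemma has_pd_freq_fun D j (G : 'rV[R]_n -> R[i]) p l :
  dquot (0 : R)^' (fun h => G (p.2 + h *: delta_mx ord0 j)) (G p.2) l ->
  has_pd D (Some j) (fun q => G q.2) p l.
Proof.
move=> Gl; rewrite /has_pd.
apply: (@dquot_near _ _ _ (fun h => G (p.2 + h *: delta_mx ord0 j))).
  by apply: filterE => h; rewrite dir_freq.
exact: dquot_filter (@increments_dnbhs _ _ D (Some j) p) Gl.
Qed.

Lemma has_pd_time_fun D (G : 'rV[R]_n -> R[i]) p : has_pd D None (fun q => G q.2) p 0.
Proof.
rewrite /has_pd; apply: (@dquot_near _ _ _ (fun h => G p.2)); last exact: dquot_cst.
by apply: filterE => h; rewrite dir_time.
Qed.

Lemma dquot_enorm_sqr xi j :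
  dquot (0 : R)^' (fun h => (enorm (xi + h *: delta_mx ord0 j) ^+ 2)%:C) (enorm xi ^+ 2)%:C
    (2 * xi ord0 j)%:C.
Proof.
rewrite -[(2 * _)%:C]addr0.
apply: (ccvg_near _ (ccvgD (ccvg_cst (2 * xi ord0 j)%:C) (F_cvgC0 (fun P H => H)))).
near=> h; have h0 : h != 0 by near: h; exact: nbhs_dnbhs_neq.
rewrite enorm_sqr_shift -rmorphB -rmorphM -rmorphD; congr _%:C.
by move: (enorm xi) => z; field.
Unshelve. all: by end_near. Qed.

Lemma dquot_theta xi j : Ureg xi ->
  dquot (0 : R)^' (fun h => (theta (xi + h *: delta_mx ord0 j))%:C) (theta xi)%:C
    (dlog_theta j xi * theta xi)%:C.
Proof.
move=> [x0 xN]; rewrite /dlog_theta.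
have [xlt|xge] := ltP (enorm xi) N.
  (* This form reduces the derivative to that of the polynomial |xi|^2 and two real chain rules. *)
  have thE xi' : 0 < enorm xi' < N -> theta xi' = N * expR (- 2^-1 * ln (enorm xi' ^+ 2)).
    move=> /andP[x'0 x'N]; rewrite thetaE max_l; last by rewrite ler_pdivlMr// mul1r ltW.
    rewrite lnXn// (_ : - 2^-1 * _ = - ln (enorm xi')); last by rewrite mulr2n; field.
    by rewrite expRN lnK.
  have near_xi : \forall xi' \near xi, 0 < enorm xi' < N.
    apply: (@enorm_near xi (fun x => 0 < x < N)); near=> x; apply/andP; split.
      by near: x; exact: lt_nbhsr.
    by near: x; exact: lt_nbhsl.
  have [d d0 dP] := freq_near j near_xi.
  have z0 : 0 < enorm xi ^+ 2 by rewrite exprn_gt0.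
  have F0 : (0 : R)^' `<=` (0 : R)^' by [].
  have FD : Filter (0 : R)^' by exact: dnbhs_filter.
  have D1 := @dquot_real_comp _ _ FD F0 _ _ _ _ _ (dquot_enorm_sqr xi j) (is_derive1_ln z0).
  have D2 : dquot (0 : R)^'
      (fun h => (- 2^-1 * ln (enorm (xi + h *: delta_mx ord0 j) ^+ 2))%:C)
      (- 2^-1 * ln (enorm xi ^+ 2))%:C (- 2^-1 * ((enorm xi ^+ 2)^-1 * (2 * xi ord0 j)))%:C.
    rewrite [(- 2^-1 * ln _)%:C]rmorphM [(- 2^-1 * (_ * _))%:C]rmorphM /=.
    apply: (dquot_near _ (dquotZ F0 (- 2^-1)%:C D1)).
      by apply: filterE => h; rewrite rmorphM.
  have D3 := @dquot_real_comp _ _ FD F0 _ _ _ _ _ D2 (is_derive_expR _).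
  rewrite (thE xi); last by rewrite x0.
  rewrite (_ : - _ / _ * _ = N * (expR (- 2^-1 * ln (enorm xi ^+ 2)) *
    (- 2^-1 * ((enorm xi ^+ 2)^-1 * (2 * xi ord0 j))))); last first.
    by field; rewrite gt_eqF.
  rewrite [(N * expR _)%:C]rmorphM [(N * (_ * _))%:C]rmorphM /=.
  apply: (dquot_near _ (dquotZ F0 N%:C D3)).
  apply/nbhs_ballP; exists d => // h; rewrite /ball/= sub0r normrN => hd h0.
  by rewrite thE ?rmorphM//; exact: dP.
have {xN}xgt : N < enorm xi by rewrite lt_neqAle eq_sym xN.
have near_xi : \forall xi' \near xi, N < enorm xi'.
  by apply: (@enorm_near xi (fun x => N < x)); exact: lt_nbhsr.
have [d d0 dP] := freq_near j near_xi.
have th1 xi' : N < enorm xi' -> theta xi' = 1.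
  move=> x'; rewrite thetaE max_r// ler_pdivrMr ?mul1r ?ltW//.
  exact: lt_trans x'.
rewrite mul0r th1//; apply: dquot_near (dquot_cst _).
apply/nbhs_ballP; exists d => // h; rewrite /ball/= sub0r normrN => hd h0.
by rewrite th1//; exact: dP.
Unshelve. all: by end_near. Qed.

Section FrequencyCoefficients.
(** Domain and weights stay abstract because derivatives of log [theta] occur on the half-space as
    well as in the zone. *)
Context (D : set point) (dirs : pred (option 'I_n)) (wt : option 'I_n -> point -> R).
Hypothesis DU : forall p, D p -> Ureg p.2.
Hypothesis wt_ge0 : forall o p, D p -> 0 <= wt o p.
Hypothesis wtS : forall j p, D p -> wt (Some j) p = (enorm p.2)^-1.

Lemma cont_on_real (g : point -> R) : (forall p, D p -> {for p, continuous g}) ->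
  cont_on D (fun p => (g p)%:C).
Proof.
move=> gc p Dp; split => /=; last exact: cvg_cst.
exact: cvg_within_filter (gc p Dp).
Qed.

Lemma wsmooth_coord m l : wsmooth D dirs wt m (fun p => enorm p.2) (fun p => (p.2 ord0 l)%:C).
Proof.
have cc : cont_on D (fun p => (p.2 ord0 l)%:C).
  apply: cont_on_real => p _.
  exact: (continuous_comp (@snd_continuous p) (@coord_continuous _ _ _ ord0 l p.2)).
have bb : exists C : R, forall p, D p -> normc (p.2 ord0 l)%:C <= C * enorm p.2.
  by exists 1 => p _; rewrite normc_real mul1r coord_le_enorm.
case: m => [|m]; first by apply: wsmooth0P.
apply: wsmoothSP => // -[j|] _; last first.
  exists (fun=> 0); last exact: wsmooth0.
  by move=> p _; exact: (@has_pd_time_fun D (fun xi => (xi ord0 l)%:C)).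
exists (fun=> (l == j)%:R); last first.
  apply: wsmooth_eqw (wsmooth_cst _ _ _ m _) => p Dp.
  by have [x0 _] := DU Dp; rewrite wtS// divff// gt_eqF.
move=> p _; apply: (@has_pd_freq_fun D j (fun xi => (xi ord0 l)%:C)).
apply: (ccvg_near _ (ccvg_cst (l == j)%:R)); near=> h.
have h0 : h != 0 by near: h; exact: nbhs_dnbhs_neq.
have -> : (p.2 + h *: delta_mx ord0 j) ord0 l = p.2 ord0 l + h * (l == j)%:R.
  by rewrite !mxE eqxx.
rewrite -rmorphB -rmorphM (_ : h^-1 * _ = (l == j)%:R) ?rmorph_nat//.
by move: (p.2 ord0 l) => z; field.
Unshelve. all: by end_near. Qed.

Lemma wsmooth_inv_sqr m :
  wsmooth D dirs wt m (fun p => (enorm p.2)^-1 ^+ 2) (fun p => ((enorm p.2 ^+ 2)^-1)%:C).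
Proof.
have cc : cont_on D (fun p => ((enorm p.2 ^+ 2)^-1)%:C).
  apply: cont_on_real => p /DU[x0 _]; apply: cvgV; first by rewrite gt_eqF// exprn_gt0.
  have ec := continuous_comp (@snd_continuous p) (@enorm_continuous _ _ p.2).
  rewrite (_ : (fun q : point => enorm q.2 ^+ 2) = (fun q : point => enorm q.2 * enorm q.2)).
    by rewrite expr2; exact: (cvgM ec ec).
  by apply/funext => q; rewrite expr2.
have bb : exists C : R, forall p, D p -> normc ((enorm p.2 ^+ 2)^-1)%:C <= C * (enorm p.2)^-1 ^+ 2.
  by exists 1 => p _; rewrite normc_real mul1r exprVn ger0_norm// invr_ge0 sqr_ge0.
elim: m => [|m ih]; first by apply: wsmooth0P.
apply: wsmoothSP => // -[j|] _; last first.
  exists (fun=> 0); last exact: wsmooth0.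
  by move=> p _; exact: (@has_pd_time_fun D (fun xi => ((enorm xi ^+ 2)^-1)%:C)).
exists (fun p => - 2 * ((p.2 ord0 j)%:C * (((enorm p.2 ^+ 2)^-1)%:C * ((enorm p.2 ^+ 2)^-1)%:C))).
  move=> p /DU[x0 _]; apply: (@has_pd_freq_fun D j (fun xi => ((enorm xi ^+ 2)^-1)%:C)).
  have z0 : enorm p.2 ^+ 2 != 0 by rewrite gt_eqF// exprn_gt0.
  have dV : is_derive (enorm p.2 ^+ 2) 1 (fun z => z^-1) (- (enorm p.2 ^+ 2)^-2 *: 1).
    exact: is_deriveV.
  have FD : Filter (0 : R)^' by exact: dnbhs_filter.
  have := @dquot_real_comp _ (0 : R)^' FD (fun P H => H) _ _ _ _ _ (dquot_enorm_sqr p.2 j) dV.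
  rewrite (_ : (_ * _)%:C = - 2 * ((p.2 ord0 j)%:C *
    (((enorm p.2 ^+ 2)^-1)%:C * ((enorm p.2 ^+ 2)^-1)%:C))); first by apply.
  transitivity (- 2 * (p.2 ord0 j * ((enorm p.2 ^+ 2)^-1 * (enorm p.2 ^+ 2)^-1)))%:C.
    by congr _%:C; rewrite /GRing.scale/= mulr1; field; rewrite gt_eqF.
  by rewrite !rmorphM rmorphN rmorph_nat.
apply: wsmoothZ => //.
apply: wsmooth_eqw (wsmoothM (wsmooth_coord m j) (wsmoothM ih ih)) => p Dp.
by have [x0 _] := DU Dp; rewrite wtS//; field; rewrite gt_eqF.
Qed.

Lemma wsmooth_inner m : wsmooth D dirs wt m (fun=> 1) (fun p => inner p.2).
Proof.
have loc p : D p -> \forall xi \near p.2, (enorm xi < N) = (enorm p.2 < N).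
  move=> /DU[x0 xN]; apply: (@enorm_near p.2 (fun x => (x < N) = (enorm p.2 < N))).
  have [xlt|xge] := ltP (enorm p.2) N.
    by near=> x; have -> : x < N by near: x; exact: lt_nbhsl.
  have xgt : N < enorm p.2 by rewrite lt_neqAle eq_sym xN.
  near=> x; apply/negbTE; rewrite -leNgt; apply/ltW; near: x; exact: lt_nbhsr.
have cc : cont_on D (fun p => inner p.2).
  move=> p Dp; apply: (ccvg_near _ (ccvg_cst (inner p.2))).
  rewrite near_within; have : \forall q \near p, (enorm q.2 < N) = (enorm p.2 < N).
    exact: (@snd_continuous p _ (loc p Dp)).
  by apply: filterS => q; rewrite /inner => ->.
have bb : exists C : R, forall p : point, D p -> normc (inner p.2) <= C * 1.
  by exists 1 => p _; rewrite /inner; case: (_ < _); rewrite mulr1 ?Normc.normc1 ?Normc.normc0.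
case: m => [|m]; first by apply: wsmooth0P.
apply: wsmoothSP => // o _; exists (fun=> 0); last exact: wsmooth0.
move=> p Dp; case: o => [j|]; last first.
  exact: (@has_pd_time_fun D inner).
apply: (@has_pd_freq_fun D j inner).
have [d d0 dP] := freq_near j (loc p Dp).
apply: (dquot_near _ (dquot_cst (inner p.2))).
apply/nbhs_ballP; exists d => // h; rewrite /ball/= sub0r normrN => hd h0.
by rewrite /inner dP.
Unshelve. all: by end_near. Qed.

Lemma wsmooth_dlog_theta m j :
  wsmooth D dirs wt m (fun p => (enorm p.2)^-1) (fun p => (dlog_theta j p.2)%:C).
Proof.
have := wsmoothN (wsmoothM (wsmooth_inner m) (wsmoothM (wsmooth_coord m j) (wsmooth_inv_sqr m))).
move=> H; apply: (@wsmooth_eqw _ _ _ _ _ _ (fun p => 1 * (enorm p.2 * (enorm p.2)^-1 ^+ 2))).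
  by move=> p Dp; have [x0 _] := DU Dp; field; rewrite gt_eqF.
apply: wsmooth_eq H => p Dp; rewrite /dlog_theta /inner; case: ifP => _.
  by rewrite mul1r -rmorphM -rmorphN mulNr.
by rewrite mul0r oppr0.
Qed.

End FrequencyCoefficients.

End Coordinates.

Section LogCoordinates.
Context {R : realType} {n : nat} (N : R).
Hypothesis N_gt0 : 0 < N.
Local Notation point := (R * 'rV[R]_n)%type.
Implicit Types (xi : 'rV[R]_n) (p q : point) (D : set point).
Local Notation U := (@Ureg R n N).
Local Notation Y := (halfspace U).
Local Notation theta := (@theta R n N).
Local Notation dlog_theta := (@dlog_theta R n N).

Definition fwt (j : 'I_n) xi : R := (enorm xi)^-1.
Local Notation wt := (hwt fwt).

Lemma fwt_ge0 j xi : U xi -> 0 <= fwt j xi.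
Proof. by move=> _; rewrite invr_ge0 enorm_ge0. Qed.

Lemma theta_continuous xi : U xi -> {for xi, continuous theta}.
Proof.
move=> [x0 _].
have -> : theta = (fun x : 'rV[R]_n => N / enorm x) \max (fun=> 1).
  by apply/funext => x; rewrite thetaE.
apply: (@continuous_max _ _ (fun x : 'rV[R]_n => N / enorm x) (fun=> 1) xi).
  suff : (fun x : 'rV[R]_n => N / enorm x) @ nbhs xi --> N / enorm xi by [].
  apply: cvgM; first exact: cvg_cst.
  by apply: cvgV; [rewrite gt_eqF|exact: enorm_continuous].
exact: cst_continuous.
Qed.

Lemma cvg_change_time D p (s : point -> R) : s @ nbhs p --> s p ->
  (fun q => (s q, q.2)) @ within D (nbhs p) --> (s p, p.2).
Proof.
move=> /cvgrPdist_lt sc P /pair_near[d d0 dP].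
suff : \forall q \near p, D q -> P (s q, q.2) by [].
have /cvgrPdist_lt/(_ _ d0) xc := @snd_continuous _ _ p.
apply: filterS2 (sc _ d0) xc => q sq xq _.
by apply: dP; rewrite /= distrC.
Qed.

(** This is 1 + t as a function of (y, xi); y = 0 corresponds to t = t_xi. It reproduces itself
    under d/dy and gains only [dlog_theta] in frequency. *)
Definition logtime p : R := theta p.2 * expR p.1.

Lemma logtime_gt0 p : 0 < logtime p.
Proof. by rewrite mulr_gt0 ?theta_gt0 ?expR_gt0. Qed.

Lemma logtime0 xi : logtime (0 : R, xi) - 1 = txi N xi.
Proof. by rewrite /logtime /= expR0 mulr1 addrAC subrr add0r. Qed.

Lemma txi_le_logtime xi (y : R) : 0 <= y -> txi N xi <= logtime (y, xi) - 1.
Proof.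
move=> y0; rewrite lerBrDl -/(theta xi) /logtime ler_peMr ?(ltW (theta_gt0 N xi))//.
by rewrite -[leLHS]expR0 ler_expR.
Qed.

Lemma logtime_continuous p : U p.2 -> {for p, continuous logtime}.
Proof.
move=> Up; suff : (fun q => theta q.2 * expR q.1) @ nbhs p --> theta p.2 * expR p.1 by [].
apply: cvgM.
  exact: (continuous_comp (@snd_continuous _ _ p) (theta_continuous Up)).
exact: (continuous_comp (@fst_continuous _ _ p) (@continuous_expR R p.1)).
Qed.

Lemma has_pd_theta D j p : U p.2 ->
  has_pd D (Some j) (fun q => (theta q.2)%:C) p (dlog_theta j p.2 * theta p.2)%:C.
Proof.
move=> Up; apply: (@has_pd_freq_fun _ _ D j (fun xi => (theta xi)%:C)).
exact: dquot_theta.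
Qed.

Lemma has_pd_logtime j p : U p.2 ->
  has_pd Y (Some j) (fun q => (logtime q)%:C) p (dlog_theta j p.2 * logtime p)%:C.
Proof.
move=> Up; have H := has_pd_theta Y j Up.
have E : has_pd Y (Some j) (fun q => (expR q.1)%:C) p 0.
  apply: (@dquot_near _ _ _ (fun=> (expR p.1)%:C)); last exact: dquot_cst.
  by apply: filterE => h; rewrite dir_freq.
have -> : (dlog_theta j p.2 * logtime p)%:C =
    (dlog_theta j p.2 * theta p.2)%:C * (expR p.1)%:C + (theta p.2)%:C * 0.
  by rewrite mulr0 addr0 -rmorphM mulrA.
rewrite /has_pd {1}/logtime rmorphM.
apply: (dquot_near _ (dquotM (@increments_dnbhs _ _ Y (Some j) p) H E)).
by apply: filterE => h; rewrite -rmorphM.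
Qed.

Lemma has_pd_logtime_time p : Y p -> has_pd Y None (fun q => (logtime q)%:C) p (logtime p)%:C.
Proof.
case: p => y xi [y0 Uxi]; apply/halfspace_time => //.
apply: is_derive_cwder; rewrite /logtime /=.
by have := @is_deriveZ _ _ _ (@expR R) (theta xi) y 1 _ (is_derive_expR y).
Qed.

Lemma cont_on_logtime : cont_on Y (fun p => (logtime p)%:C).
Proof. by apply: cont_on_real => p [_ Up]; exact: logtime_continuous. Qed.

Lemma dlog_theta_wsmooth m j :
  wsmooth Y predT wt m (fun p => (enorm p.2)^-1) (fun p => (dlog_theta j p.2)%:C).
Proof. by apply: wsmooth_dlog_theta => // p []. Qed.

Lemma logtime_wsmooth m : wsmooth Y predT wt m logtime (fun p => (logtime p)%:C).
Proof.
have bb : exists C : R, forall p, Y p -> normc (logtime p)%:C <= C * logtime p.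
  by exists 1 => p _; rewrite normc_real mul1r ger0_norm// ltW// logtime_gt0.
elim: m => [|m ih]; first by apply: wsmooth0P => //; exact: cont_on_logtime.
apply: wsmoothSP => //; first exact: cont_on_logtime.
move=> [j|] _.
  exists (fun p => (dlog_theta j p.2)%:C * (logtime p)%:C).
    by move=> p [_ Up]; rewrite -rmorphM; exact: has_pd_logtime.
  by apply: wsmooth_eqw (wsmoothM (dlog_theta_wsmooth m j) ih) => p _; rewrite mulrC.
exists (fun p => (logtime p)%:C); first exact: has_pd_logtime_time.
by apply: wsmooth_eqw ih => p _; rewrite mulr1.
Qed.

Lemma Zhyp_logtime p : Y p -> Zhyp N (logtime p - 1, p.2).
Proof.
move=> [p0 [x0 _]]; apply/Zhyp_theta => //=.
have e1 : 1 <= expR p.1 by rewrite -[leLHS]expR0 ler_expR.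
by rewrite subrKC /logtime ler_peMr// ltW// theta_gt0.
Qed.

Lemma Zhyp_up (N1 s s' : R) xi : Zhyp N1 (s, xi) -> s <= s' -> Zhyp N1 (s', xi).
Proof.
move=> [/= s0 sN] ss; split => /=; first exact: le_trans ss.
by apply: le_trans sN _; rewrite ler_wpM2r ?enorm_ge0// lerD2l.
Qed.

Lemma Zopen_freq_near (N1 : R) D j p (s : R) : Zopen N1 (s, p.2) ->
  \forall h \near increments D (Some j) p, Zhyp N1 (s, (p + h *: dir (Some j)).2).
Proof.
move=> O; have [r r0 rP] := dir_near (Some j) (Some j) (Zopen_near O).
apply/incrementsP; exists r => // h _ hr _.
have := rP h 0; rewrite normr0 scale0r addr0 !dir_freq /= => H.
by apply: Zopen_Zhyp; apply: H; [exact: ltW|exact: ltW|case: O].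
Qed.

(** A y-derivative is (1 + t) d_t and cancels the time weight 1/(1 + t). A frequency derivative adds
    (1 + t) d_t times [dlog_theta], again of size 1/|xi|. Symbol weights thus become 1 in y and
    1/|xi| in xi. *)
Lemma to_log_wsmooth (N1 : R) m g f : 0 < N1 -> N1 < N ->
  wsmooth (Zhyp N1) predT zwt m g f ->
  wsmooth Y predT wt m (fun p => g (logtime p - 1, p.2)) (fun p => f (logtime p - 1, p.2)).
Proof.
move=> N10 N1N.
have ZY p : Y p -> Zhyp N1 (logtime p - 1, p.2).
  by move=> /Zhyp_logtime/(Zhyp_Zopen N1N)/Zopen_Zhyp.
have tc p : Y p -> (fun q : point => (logtime q - 1, q.2)) @ within Y (nbhs p) -->
    (logtime p - 1, p.2).
  move=> Yp; have h1 : (fun q : point => logtime q - 1) @ nbhs p --> logtime p - 1.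
    by apply: cvgB; [exact: (logtime_continuous Yp.2)|exact: cvg_cst].
  exact: cvg_change_time h1.
have td o p tau' : has_pd Y o (fun q => (logtime q)%:C) p tau' ->
    has_pd Y o (fun q => (logtime q - 1)%:C) p tau'.
  move=> H; rewrite /has_pd -[tau']subr0 rmorphB.
  apply: (dquot_near _ (dquotB H (dquot_cst 1))).
  by apply: filterE => h; rewrite rmorphB.
elim: m g f => [|m ih] g f [fc [C fC] fd].
  split => //; first exact: (cont_on_comp ZY tc fc).
  by exists C => p Yp; exact: fC (ZY p Yp).
split.
- exact: (cont_on_comp ZY tc fc).
- by exists C => p Yp; exact: fC (ZY p Yp).
have [fN fNd fNs] := fd None isT.
have fNc := wsmooth_cont fNs.
have fN' : wsmooth Y predT wt m (fun p => g (logtime p - 1, p.2))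
    (fun p => fN (logtime p - 1, p.2) * (logtime p)%:C).
  apply: wsmooth_eqw (wsmoothM (ih _ _ fNs) (logtime_wsmooth m)) => p _ /=.
  by rewrite subrKC divfK// gt_eqF// logtime_gt0.
have chain o p tau' l : Y p -> has_pd Y o (fun q => (logtime q)%:C) p tau'%:C ->
    dquot (increments Y o p) (fun h => f (logtime p - 1, (p + h *: dir o).2))
      (f (logtime p - 1, p.2)) l ->
    (\forall h \near increments Y o p, Zhyp N1 (logtime p - 1, (p + h *: dir o).2)) ->
    has_pd Y o (fun q => f (logtime q - 1, q.2)) p (fN (logtime p - 1, p.2) * tau'%:C + l).
  move=> Yp pt pl pn.
  apply: (@has_pd_time_comp _ _ (Zhyp N1) Y o f fN (fun q => logtime q - 1)) => //.
  - exact: Zhyp_up.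
  - exact: fNc (ZY p Yp).
  - exact: td.
move=> [j|] _; last first.
  exists (fun p => fN (logtime p - 1, p.2) * (logtime p)%:C).
    move=> p Yp; rewrite -[X in has_pd _ _ _ _ X]addr0.
    apply: chain => //; first exact: has_pd_logtime_time.
      apply: (dquot_near _ (dquot_cst (f (logtime p - 1, p.2)))).
      by apply: filterE => h; rewrite dir_time.
    by apply: filterE => h; rewrite dir_time; exact: ZY.
  by apply: wsmooth_eqw fN' => p _; rewrite mulr1.
have [fj fjd fjs] := fd (Some j) isT.
exists (fun p => fN (logtime p - 1, p.2) * (dlog_theta j p.2 * logtime p)%:C
                 + fj (logtime p - 1, p.2)).
  move=> p Yp; have Zp := ZY p Yp.
  (* At y = 0 the image may lie on the boundary of the zone of [N]; the strict inequality N1 < N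
     leaves room to move the frequency at fixed time. *)
  have pn : \forall h \near increments Y (Some j) p,
      Zhyp N1 (logtime p - 1, (p + h *: dir (Some j)).2).
    by apply: Zopen_freq_near; apply: Zhyp_Zopen N1N _; exact: Zhyp_logtime.
  apply: chain => //; first by apply: has_pd_logtime; case: Yp.
  apply: (@dquot_near _ _ _ (fun h => f ((logtime p - 1, p.2) + h *: dir (Some j)))).
    by apply: filterE => h; rewrite !dir_freq.
  apply: dquot_filter (fjd _ Zp) => P /incrementsP[r r0 rP].
  have /incrementsP[d d0 dP] := pn.
  apply/incrementsP; exists (Num.min r d); first by rewrite lt_min r0.
  move=> h h0; rewrite lt_min => /andP[hr hd] Yh; apply: rP => //.
  by have := dP h h0 hd Yh; rewrite !dir_freq.
apply: wsmoothD; last exact: wsmooth_eqw (ih _ _ fjs).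
apply: (wsmooth_eq (f := fun p => fN (logtime p - 1, p.2) * (logtime p)%:C
  * (dlog_theta j p.2)%:C)).
  by move=> p _; rewrite -!mulrA -rmorphM [logtime p * _]mulrC.
exact: wsmoothM fN' (dlog_theta_wsmooth m j).
Qed.

Lemma log_theta_le p : Zhyp N p -> 0 < enorm p.2 -> theta p.2 <= 1 + p.1.
Proof. by move=> Zp x0; apply/Zhyp_theta. Qed.

Definition zone_reg : set point := Zhyp N `&` [set p | enorm p.2 != N].
Local Notation D' := zone_reg.

Definition logcoord p : R := ln (1 + p.1) - ln (theta p.2).

Lemma zone_regU p : D' p -> U p.2.
Proof. by move=> [Zp pN]; split => //; exact: (enorm_gt0 p.2 N_gt0 Zp). Qed.

Lemma logcoordP p : D' p -> Y (logcoord p, p.2).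
Proof.
move=> Dp; have [x0 xN] := zone_regU Dp; split => //=.
have := log_theta_le Dp.1 x0; rewrite /logcoord subr_ge0 => H.
by rewrite ler_ln ?posrE// ?theta_gt0// (lt_le_trans _ H)// theta_gt0.
Qed.

Lemma logcoordK p : 0 < 1 + p.1 -> logtime (logcoord p, p.2) - 1 = p.1.
Proof.
move=> p0; rewrite /logtime /logcoord /= expRD expRN !lnK ?posrE ?theta_gt0//.
have : theta p.2 != 0 by rewrite gt_eqF// theta_gt0.
by move: (theta p.2) (p.1) => a b a0; field.
Qed.

Lemma has_pd_logcoord j p : D' p ->
  has_pd D' (Some j) (fun q => (logcoord q)%:C) p (- dlog_theta j p.2)%:C.
Proof.
move=> Dp; have Up := zone_regU Dp.
have dth := has_pd_theta D' j Up.
have dln := @dquot_real_comp _ _ (increments_filter D' (Some j) p)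
  (@increments_dnbhs _ _ D' (Some j) p) _ _ _ _ _ dth (is_derive1_ln (theta_gt0 N p.2)).
have -> : (- dlog_theta j p.2)%:C =
    0 - ((theta p.2)^-1 * (dlog_theta j p.2 * theta p.2))%:C.
  rewrite sub0r -rmorphN; congr (- _)%:C.
  by field; rewrite gt_eqF// theta_gt0.
rewrite /has_pd /logcoord rmorphB.
apply: (dquot_near _ (dquotB (dquot_cst (ln (1 + p.1))%:C) dln)).
by apply: filterE => h; rewrite rmorphB !dir_freq.
Qed.

(** At fixed t the derivative d_j becomes d_j - [dlog_theta] d_y. Hence all directions are assumed
    on the half-space, although only frequency directions remain in the zone. *)
Lemma from_log_wsmooth m g f : wsmooth Y predT wt m g f ->
  wsmooth D' isSome zwt m (fun p => g (logcoord p, p.2)) (fun p => f (logcoord p, p.2)).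
Proof.
have lc p : D' p -> (fun q : point => (logcoord q, q.2)) @ within D' (nbhs p) -->
    (logcoord p, p.2).
  move=> Dp; have Up := zone_regU Dp; have p0 : 0 < 1 + p.1 by case: Dp => [[p0 _] _]; rewrite ltr_pwDl.
  have h1 : (fun q : point => 1 + q.1) @ nbhs p --> 1 + p.1.
    by apply: cvgD; [exact: cvg_cst|exact: fst_continuous].
  have h2 : (fun q : point => theta q.2) @ nbhs p --> theta p.2.
    exact: (continuous_comp (@snd_continuous _ _ p) (theta_continuous Up)).
  have h3 : (fun q : point => logcoord q) @ nbhs p --> logcoord p.
    apply: cvgB.
      exact: (continuous_cvg _ (continuous_ln p0) h1).
    exact: (continuous_cvg _ (continuous_ln (theta_gt0 N p.2)) h2).
  exact: cvg_change_time h3.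
elim: m g f => [|m ih] g f [fc [C fC] fd].
  split => //; first exact: (cont_on_comp logcoordP lc fc).
  by exists C => p Dp; exact: fC (logcoordP Dp).
split.
- exact: (cont_on_comp logcoordP lc fc).
- by exists C => p Dp; exact: fC (logcoordP Dp).
move=> [j|//] _.
have [fN fNd fNs] := fd None isT; have [fj fjd fjs] := fd (Some j) isT.
exists (fun p => fN (logcoord p, p.2) * (- dlog_theta j p.2)%:C + fj (logcoord p, p.2)).
  move=> p Dp; have Yp := logcoordP Dp.
  have pn : \forall h \near increments D' (Some j) p,
      Y (logcoord p, (p + h *: dir (Some j)).2).
    have [d d0 dP] := freq_near j (@Ureg_open _ _ N p.2 (zone_regU Dp)).
    apply/incrementsP; exists d => // h _ hd _.
    by rewrite dir_freq; split; [case: Yp|exact: dP].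
  apply: (@has_pd_time_comp _ _ Y D' (Some j) f fN logcoord) => //.
  - by move=> s s' xi [/= s0 Us] ss; split => //=; exact: le_trans ss.
  - exact: logcoordP.
  - exact: wsmooth_cont fNs _ Yp.
  - exact: has_pd_logcoord.
  apply: (@dquot_near _ _ _ (fun h => f ((logcoord p, p.2) + h *: dir (Some j)))).
    by apply: filterE => h; rewrite !dir_freq.
  apply: dquot_filter (fjd _ Yp) => P /incrementsP[r r0 rP].
  have /incrementsP[d d0 dP] := pn.
  apply/incrementsP; exists (Num.min r d); first by rewrite lt_min r0.
  move=> h h0; rewrite lt_min => /andP[hr hd] Dh; apply: rP => //.
  by have := dP h h0 hd Dh; rewrite !dir_freq.
apply: wsmoothD; last exact: (ih _ _ fjs).
have dl : wsmooth D' isSome zwt m (fun p => (enorm p.2)^-1) (fun p => (- dlog_theta j p.2)%:C).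
  apply: (@wsmooth_eq _ _ _ _ _ _ _ (fun p => - (dlog_theta j p.2)%:C)).
    by move=> p _; rewrite rmorphN.
  apply: wsmoothN; apply: (@wsmooth_dlog_theta _ _ N D') => //.
  by move=> p; exact: zone_regU.
by apply: wsmooth_eqw (wsmoothM (ih _ _ fNs) dl) => p _ /=; rewrite mulr1.
Qed.

End LogCoordinates.

Section RestrictedChainRule.
Context {R : realType} (F : set_system R) {FF : Filter F} (F0 : (0 : R)^' `<=` F).

(** The completed slope of [dquot_real_comp], for a derivative of [G] restricted to [S]; the values
    of [psi] must then stay in [S]. *)
Lemma dquot_cwder_comp (S : set R) (psi : R -> R) v l (G : R -> R[i]) G' :
  dquot F (fun h => (psi h)%:C) v%:C l%:C -> cwder S G v G' ->
  (\forall h \near F, S (psi h)) ->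
  dquot F (fun h => G (psi h)) (G v) (G' * l%:C).
Proof.
move=> pl /cwderP Gd Sp; pose s u := if u == v then G' else (u - v)^-1%:C * (G u - G v).
have sl : ccvg F (fun h => s (psi h)) G'.
  apply/ccvgP => e e0; have [d d0 dP] := Gd e e0.
  have [/cvgrPdist_lt/(_ d d0) pd _] := dquot_ccvg F0 pl.
  apply: filterS2 Sp pd => h Sh; rewrite /= distrC /s => hd.
  have [_|hv] := eqVneq (psi h) v; first by rewrite subrr Normc.normc0 ltW.
  have := dP (psi h - v) _ hd; rewrite subrKC; apply => //.
  by rewrite subr_eq0.
rewrite mulrC; apply: ccvg_ext (ccvgM pl sl) => h; rewrite /s.
have [->|hv] := eqVneq (psi h) v; first by rewrite !subrr !mulr0 mul0r.
rewrite -!mulrA; congr (_ * _); rewrite mulrA -rmorphB -rmorphM/= divff ?subr_eq0//.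
by rewrite mul1r.
Qed.

End RestrictedChainRule.

(** * From weighted smoothness to iterated derivatives [Dxi] *)

Section Words.
Context {R : realType} {n : nat}.
Local Notation point := (R * 'rV[R]_n)%type.
Implicit Types (D : set point) (p : point) (f : point -> R[i]).

Lemma increments_proper D o p :
  (forall d : R, 0 < d -> exists h : R, [/\ h != 0, `|h| < d & D (p + h *: dir o)]) ->
  ProperFilter (increments D o p).
Proof.
move=> H; apply: Build_ProperFilter => /incrementsP[d d0 dP].
by have [h [h0 hd Dh]] := H d d0; exact: dP Dh.
Qed.

(** [wsmooth] only provides some derivative at each stage; properness identifies it with the one
    computed by [Dpartial]. *)
Lemma wsmooth_Dword D (dirs : pred (option 'I_n)) wt m g f :
  (forall o p, dirs o -> D p -> ProperFilter (increments D o p)) ->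
  wsmooth D dirs wt m g f ->
  forall w, (size w <= m)%N -> all dirs w ->
  wsmooth D dirs wt (m - size w) (fun p => g p * \prod_(o <- w) wt o p) (Dword D w f).
Proof.
move=> prop fs; elim=> [|o w ih] wm.
  by move=> _; rewrite subn0; apply: wsmooth_eqw fs => p _; rewrite big_nil mulr1.
move=> /= /andP[od wd]; have := ih (ltnW wm) wd; rewrite -(subnSK wm).
move=> [_ _ /(_ o od)[fo fod fos]].
apply: (wsmooth_eq (f := fun p => - 'i * fo p)).
  by move=> p Dp; have PF := prop o p od Dp; exact: esym (Dpartial_has_pd PF (fod p Dp)).
apply: wsmoothZ; apply: wsmooth_eqw fos => p _.
by rewrite big_cons; ring.
Qed.

Lemma size_mi_word (alpha : {ffun 'I_n -> nat}) : size (mi_word alpha) = mi_size alpha.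
Proof.
rewrite /mi_word size_flatten /shape -map_comp sumnE big_map big_enum /=.
by apply: eq_bigr => j _; rewrite size_nseq.
Qed.

Section FrequencyRegularity.
Variables (D : set point) (wt : option 'I_n -> point -> R) (m : nat) (r : R).
Hypothesis prop : forall j p, D p -> ProperFilter (increments D (Some j) p).
Hypothesis rm : forall k : nat, k%:R <= r -> (k <= m)%N.

Let prop' o p : (isSome o : bool) -> D p -> ProperFilter (increments D o p).
Proof. by case: o => // j _; exact: prop. Qed.

Let allS (w : seq 'I_n) : all (isSome : pred (option 'I_n)) (map Some w).
Proof. by elim: w. Qed.

Lemma wsmooth_xi_differentiable g f :
  wsmooth D isSome wt m g f -> xi_differentiable_on D r f.
Proof.
move=> fs; split=> [w j p /rm jm Dp|w t /rm wm].
  have sw : (size (map Some w) < m)%N by rewrite size_map.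
  have := wsmooth_Dword prop' fs (ltnW sw) (allS w); rewrite -(subnSK sw).
  move=> [_ _ /(_ (Some j) isT)[fo fod _]].
  exact: has_pd_exists (fod p Dp).
have sw : (size (map Some w) <= m)%N by rewrite size_map.
have fc := wsmooth_cont (wsmooth_Dword prop' fs sw (allS w)).
have slice xi (P : set point) : D (t, xi) -> within D (nbhs (t, xi)) P ->
    within [set xi | D (t, xi)] (nbhs xi) [set xi | P (t, xi)].
  move=> Dx /pair_near[d d0 dP]; apply/nbhs_ballP; exists d => // x.
  by rewrite -ball_normE /= distrC => xd Dtx; apply: dP; rewrite //= subrr normr0.
split; apply/subspace_continuousP => xi Dx P nP.
  by have [cr _] := fc _ Dx; exact: (slice xi _ Dx (cr P nP)).
by have [_ ci] := fc _ Dx; exact: (slice xi _ Dx (ci P nP)).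
Qed.

(** One constant for all multi-indices: those of size at most m have entries at most m, so they are
    coded in a finite type and their constants are summed. *)
Lemma wsmooth_Dxi_bound g f : wsmooth D isSome wt m g f ->
  exists2 C : R, 0 <= C & forall (alpha : {ffun 'I_n -> nat}) p, (mi_size alpha)%:R <= r -> D p ->
    normc (Dxi D alpha f p) <= C * `|g p * \prod_(j <- mi_word alpha) wt (Some j) p|.
Proof.
move=> fs.
pose nat_of (beta : {ffun 'I_n -> 'I_m.+1}) : {ffun 'I_n -> nat} := [ffun j => beta j : nat].
have /choice[c cP] : forall beta : {ffun 'I_n -> 'I_m.+1}, exists C : R,
    (mi_size (nat_of beta))%:R <= r -> forall p, D p ->
    normc (Dxi D (nat_of beta) f p)
      <= C * (g p * \prod_(j <- mi_word (nat_of beta)) wt (Some j) p).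
  move=> beta; have [/rm am|nr] := boolP ((mi_size (nat_of beta))%:R <= r); last by exists 0.
  have sw : (size (map Some (mi_word (nat_of beta))) <= m)%N by rewrite size_map size_mi_word.
  have [C CP] := wsmooth_bound (wsmooth_Dword prop' fs sw (allS _)).
  by exists C => _ p Dp; have := CP p Dp; rewrite big_map.
exists (\sum_beta `|c beta|); first by rewrite sumr_ge0.
move=> alpha p ar Dp; have am := rm ar.
have aj j : (alpha j < m.+1)%N.
  by rewrite ltnS (leq_trans _ am)// /mi_size (bigD1 j)//= leq_addr.
pose beta : {ffun 'I_n -> 'I_m.+1} := [ffun j => Ordinal (aj j)].
have ab : nat_of beta = alpha by apply/ffunP => j; rewrite !ffunE.
have := cP beta; rewrite ab => /(_ ar p Dp) H; apply: le_trans H _.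
apply: le_trans (ler_norm _) _; rewrite normrM ler_wpM2r//.
by rewrite (bigD1 beta)//= lerDl sumr_ge0.
Qed.

End FrequencyRegularity.
End Words.

Section ZoneRegular.
Context {R : realType} {n : nat} (N : R).
Hypothesis N_gt0 : 0 < N.

(** On the boundary of the zone some increments are not admissible, but moving xi_j away from 0
    increases |xi| and stays inside; [s] is the corresponding sign. *)
Lemma zone_reg_proper j (p : R * 'rV[R]_n) :
  zone_reg N p -> ProperFilter (increments (zone_reg N) (Some j) p).
Proof.
move=> Dp; apply: increments_proper => d d0.
have [x0 xN] := zone_regU N_gt0 Dp.
have [r r0 rP] := freq_near j (@Ureg_open _ _ N p.2 (conj x0 xN)).
pose s : R := if 0 <= p.2 ord0 j then 1 else -1.
pose h := s * (Num.min d r / 2).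
have m0 : 0 < Num.min d r by rewrite lt_min d0.
have hm : `|h| < Num.min d r.
  rewrite /h normrM (_ : `|s| = 1) ?mul1r; last first.
    by rewrite /s; case: ifP; rewrite ?normrN normr1.
  by rewrite ger0_norm ?divr_ge0 ?ltW// ltr_pdivrMr// ltr_pMr//; lra.
exists h; split.
- rewrite mulf_neq0//; last by rewrite gt_eqF// divr_gt0.
  by rewrite /s; case: ifP; rewrite ?oppr_eq0 oner_neq0.
- by move: hm; rewrite lt_min => /andP[].
- have hr : `|h| < r by move: hm; rewrite lt_min => /andP[].
  have [x'0 x'N] := rP h hr.
  case: Dp => -[p0 pN] _; rewrite dir_freq; split => //; split => //=.
  apply: le_trans pN _; rewrite ler_wpM2l ?addr_ge0//.
  rewrite -(@ler_sqr R) ?nnegrE ?enorm_ge0// enorm_sqr_shift lerDl.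
  have sx : 0 <= s * p.2 ord0 j.
    by rewrite /s; case: (leP 0 (p.2 ord0 j)) => [|/ltW]; rewrite ?mul1r// mulN1r oppr_ge0.
  have hx : 0 <= h * p.2 ord0 j.
    by rewrite /h mulrAC mulr_ge0// divr_ge0// ltW.
  by have := sqr_ge0 h; rewrite expr2; lra.
Qed.

End ZoneRegular.

(** * The diagonalised system *)

Section NonnegTime.
Context {R : realType} {n : nat}.
Local Notation point := (R * 'rV[R]_n)%type.

Lemma nonneg_time_proper (p : point) : nonneg_time p ->
  ProperFilter (increments nonneg_time None p).
Proof.
move=> p0; apply: increments_proper => d d0; exists (d / 2); split.
- by rewrite gt_eqF// divr_gt0.
- by rewrite ger0_norm ?divr_ge0 ?ltW// ltr_pdivrMr// ltr_pMr//; lra.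
- by rewrite dir_time /nonneg_time /= addr_ge0// divr_ge0// ltW.
Qed.

Lemma nonneg_time_near (N : R) (p : point) (P : set point) : Zopen N p ->
  (forall q, Zhyp N q -> P q) -> \forall h \near increments nonneg_time None p, P (p + h *: dir None).
Proof.
move=> Op HP; have [r r0 rP] := dir_near None None (Zopen_near Op).
apply/incrementsP; exists r => // h _ hr ph; apply: HP; apply: Zopen_Zhyp.
have := rP h 0; rewrite normr0 scale0r addr0; apply => //; exact: ltW.
Qed.

Lemma has_pd_nonneg_time (N : R) (p : point) (f : point -> R[i]) l : Zopen N p ->
  has_pd (Zhyp N) None f p l -> has_pd nonneg_time None f p l.
Proof.
move=> Op; apply: dquot_filter => P /incrementsP[d d0 dP].
have /incrementsP[r r0 rP] := nonneg_time_near Op (fun q H => H).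
apply/incrementsP; exists (Num.min d r); first by rewrite lt_min d0.
by move=> h h0; rewrite lt_min => /andP[hd hr] ph; apply: dP => //; exact: rP.
Qed.

End NonnegTime.

(** Here [Mp] stands for D_t M^-1, and D + M^-1 (A - Ah) M = M^-1 A M: the identity is (D_t - D -
    R_0)(M^-1 E v) = 0 once the derivatives have been computed. *)
Lemma diagonalised_cancel {R : realType} d (iM A Ah M D Mp E : 'M[R[i]]_d) (v : 'cV[R[i]]_d) :
  M *m iM = 1%:M -> iM *m Ah *m M = D ->
  - 'i *: (('i *: Mp *m E + iM *m ('i *: (A *m E))) *m v)
  - (D + (iM *m (A - Ah) *m M + Mp *m M)) *m (iM *m E *m v) = 0.
Proof.
move=> MM MD.
have -> : 'i *: Mp *m E + iM *m ('i *: (A *m E)) = 'i *: ((Mp + iM *m A) *m E).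
  by rewrite -scalemxAl -scalemxAr -scalerDr mulmxDl mulmxA.
rewrite -scalemxAl scalerA mulNr -expr2 sqr_i opprK scale1r.
have MK (X : 'M[R[i]]_d) : X *m M *m iM = X by rewrite -mulmxA MM mulmx1.
have -> : (D + (iM *m (A - Ah) *m M + Mp *m M)) *m (iM *m E *m v) = (Mp + iM *m A) *m E *m v.
  rewrite !mulmxA; do 2 congr (_ *m _).
  by rewrite -MD !mulmxDl !MK mulmxBr addrA [X in X + _]addrC subrK addrC.
by rewrite subrr.
Qed.

Section TransformedSystem.
Context {R : realType} {n d : nat}.
Local Notation matrix_symbol := (R -> 'rV[R]_n -> 'M[R[i]]_d).

Lemma mdquot_Dt_mx a b (B : R -> 'rV[R]_n -> 'M[R[i]]_(a, b)) t xi L : 0 <= t ->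
  mdquot (increments nonneg_time None (t, xi)) (fun h => B (t + h) xi) (B t xi) L ->
  Dt_exists B t xi /\ Dt_mx B t xi = - 'i *: L.
Proof.
move=> t0 BL; have BL' i j : has_pd nonneg_time None (entry B i j) (t, xi) (L i j).
  apply: (dquot_near _ (BL i j)); apply: filterE => h.
  by rewrite /entry dir_time.
split; first by move=> i j; exact: has_pd_exists (BL' i j).
apply/matrixP => i j; rewrite !mxE.
apply: Dpartial_has_pd => //; exact: nonneg_time_proper.
Qed.

Lemma Dt_exists_mdquot a b (B : R -> 'rV[R]_n -> 'M[R[i]]_(a, b)) t xi :
  Dt_exists B t xi ->
  mdquot (increments nonneg_time None (t, xi)) (fun h => B (t + h) xi) (B t xi)
    ('i *: Dt_mx B t xi).
Proof.
move=> H i j; rewrite !mxE.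
apply: (dquot_near _ (partial_exists_has_pd (H i j))).
by apply: filterE => h; rewrite /entry dir_time.
Qed.

Variables (A Ahom M Nd F Rem : matrix_symbol) (lambda : 'I_d -> R -> 'rV[R]_n -> R).
Variables (E : R -> R -> 'rV[R]_n -> 'M[R[i]]_d) (N : R).
Local Notation iM := (fun t xi => invmx (M t xi)).
Local Notation iNd := (fun t xi => invmx (Nd t xi)).
Hypothesis Efs : fundamental_solution A E.
Hypothesis Mu : forall t xi, Zhyp N (t, xi) -> M t xi \in unitmx.
Hypothesis Mdiag : forall t xi, Zhyp N (t, xi) ->
  invmx (M t xi) *m Ahom t xi *m M t xi = Dsym lambda t xi.
Hypothesis Ndu : forall t xi, Zhyp N (t, xi) -> Nd t xi \in unitmx.
Hypothesis iMd : forall p i j, Zhyp N p -> partial_exists (Zhyp N) None (entry iM i j) p.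
Hypothesis iNdd : forall p i j, Zhyp N p -> partial_exists (Zhyp N) None (entry iNd i j) p.
Hypothesis scheme : forall t xi, Zhyp N (t, xi) ->
  forall V : R -> 'rV[R]_n -> 'cV[R[i]]_d, Dt_exists V t xi ->
    Dt_minus (fun t xi => Dsym lambda t xi + R0sym A Ahom M t xi)
             (fun t xi => Nd t xi *m V t xi) t xi
    = Nd t xi *m Dt_minus (fun t xi => Dsym lambda t xi + F t xi + Rem t xi) V t xi.

Lemma zone_Dt_exists (B : matrix_symbol) t xi : Zopen N (t, xi) ->
  (forall p i j, Zhyp N p -> partial_exists (Zhyp N) None (entry B i j) p) -> Dt_exists B t xi.
Proof.
move=> Op Bd i j; apply: has_pd_exists.
exact: has_pd_nonneg_time Op (partial_exists_has_pd (Bd _ i j (Zopen_Zhyp Op))).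
Qed.

(** The product rule shows that N_k^-1 M^-1 E has some derivative [L]. The operator identity,
    applied to this matrix times a constant column, has left side 0 by [diagonalised_cancel];
    cancelling N_k identifies [L]. *)
Lemma transformed_ode (s t : R) xi : 0 <= s -> Zopen N (t, xi) ->
  mdquot (increments nonneg_time None (t, xi))
    (fun h => invmx (Nd (t + h) xi) *m (invmx (M (t + h) xi) *m E (t + h) s xi))
    (invmx (Nd t xi) *m (invmx (M t xi) *m E t s xi))
    ('i *: ((Dsym lambda t xi + F t xi + Rem t xi)
            *m (invmx (Nd t xi) *m (invmx (M t xi) *m E t s xi)))).
Proof.
move=> s0 Op; have Zp := Zopen_Zhyp Op; have t0 : 0 <= t by case: Op.
have F0 := @increments_dnbhs R n nonneg_time None (t, xi).
have FF : Filter (increments (@nonneg_time R n) None (t, xi)) by exact: increments_filter.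
have [_ /(_ t t0)[Ed Eeq]] := Efs xi s0.
have dE := Dt_exists_mdquot Ed; rewrite Eeq in dE.
have dM := Dt_exists_mdquot (zone_Dt_exists Op iMd).
have dN := Dt_exists_mdquot (zone_Dt_exists Op iNdd).
have dME := @mdquotM _ _ FF F0 _ _ _ _ _ _ _ _ _ dM dE.
have dV := @mdquotM _ _ FF F0 _ _ _ _ _ _ _ _ _ dN dME.
rewrite /= in dE dM dN dME dV.
set Mp := Dt_mx iM t xi in dM dME dV.
set V0 := invmx (Nd t xi) *m _ in dV *.
set L := _ + _ in dV.
suff -> : 'i *: ((Dsym lambda t xi + F t xi + Rem t xi) *m V0) = L by [].
pose V v : R -> 'rV[R]_n -> 'cV[R[i]]_d :=
  fun t xi => invmx (Nd t xi) *m (invmx (M t xi) *m E t s xi) *m v.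
have Vd v : Dt_exists (V v) t xi /\ Dt_mx (V v) t xi = - 'i *: (L *m v).
  apply: mdquot_Dt_mx => //; have := @mdquotM _ _ FF F0 _ _ _ _ _ _ _ _ _ dV (@mdquot_cst _ _ FF _ _ v).
  by rewrite mulmx0 addr0.
have NV v t' : Zhyp N (t', xi) ->
    Nd t' xi *m V v t' xi = invmx (M t' xi) *m E t' s xi *m v.
  by move=> Zt; rewrite /V -mulmxA mulKVmx ?Ndu.
have NVd v : Dt_mx (fun t xi => Nd t xi *m V v t xi) t xi =
    - 'i *: (('i *: Mp *m E t s xi + invmx (M t xi) *m ('i *: (A t xi *m E t s xi))) *m v).
  apply: (mdquot_Dt_mx _ _).2 => //.
  have H : mdquot (increments nonneg_time None (t, xi))
      (fun h => invmx (M (t + h) xi) *m E (t + h) s xi *m v)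
      (invmx (M t xi) *m E t s xi *m v)
      (('i *: Mp *m E t s xi + invmx (M t xi) *m ('i *: (A t xi *m E t s xi))) *m v).
    by have := @mdquotM _ _ FF F0 _ _ _ _ _ _ _ _ _ dME (@mdquot_cst _ _ FF _ _ v); rewrite mulmx0 addr0.
  move=> i j; rewrite NV//; apply: (dquot_near _ (H i j)).
  have Zn := nonneg_time_near Op (fun q Zq => Zq).
  apply: filterS Zn => h Zh; rewrite NV//.
  by move: Zh; rewrite dir_time.
apply/matrixP => i j.
(* The scheme acts on columns; the unit columns recover the matrix identity. *)
suff H (v : 'cV[R[i]]_d) : 'i *: ((Dsym lambda t xi + F t xi + Rem t xi) *m V0) *m v = L *m v.
  have := H (delta_mx j 0); rewrite -!colE => /matrixP/(_ i 0).
  by rewrite !mxE.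
have := scheme Zp (Vd v).1; rewrite /Dt_minus (Vd v).2 NVd.
rewrite (NV v t Zp).
have Z0 := @diagonalised_cancel R d (invmx (M t xi)) (A t xi) (Ahom t xi) (M t xi)
  (Dsym lambda t xi) Mp (E t s xi) v (mulmxV (Mu Zp)) (Mdiag Zp).
move=> /(etrans (esym Z0))/esym/(congr1 (mulmx (invmx (Nd t xi)))); rewrite mulmx0 mulKmx ?Ndu//.
move/eqP; rewrite subr_eq0 => /eqP H.
rewrite -scalemxAl -mulmxA -H scalerA mulrN -expr2 sqr_i opprK scale1r//.
Qed.

End TransformedSystem.

(** * Solutions close to the identity *)

Section NearIdentity.
Context {R : realType} {d : nat}.

Lemma segment_bounded (a b : R) (g : R -> R) : a <= b -> {within `[a, b], continuous g} ->
  exists K : R, forall x, a <= x <= b -> `|g x| <= K.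
Proof.
move=> ab gc; have [x1 _ H1] := EVT_max ab gc; have [x2 _ H2] := EVT_min ab gc.
exists (`|g x1| + `|g x2|) => x xab.
have xi : x \in `[a, b] by rewrite in_itv.
have := H1 x xi; have := H2 x xi; have := ler_norm (g x1).
have := ler_norm (- g x2); rewrite normrN => h1 h2 h3 h4.
by have := normr_ge0 (g x1); have := normr_ge0 (g x2); rewrite ler_norml => *; lra.
Qed.

Lemma cmxnorm1 : cmxnorm (1%:M : 'M[R[i]]_d) <= 1.
Proof.
apply: cmxnorm_le => // i j; rewrite mxE; case: (i == j).
  by rewrite mulr1n Normc.normc1.
by rewrite mulr0n Normc.normc0.
Qed.

Variables (q B : R -> 'M[R[i]]_d) (beta : R).
Hypothesis q0 : q 0 = 1%:M.
Hypothesis qd : forall y, 0 <= y -> mdquot (within [set h | `[0, +oo[%classic (y + h)] (0 : R)^')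
  (fun h => q (y + h)) (q y) (B y *m q y).
Hypothesis Bb : forall y, 0 <= y -> cmxnorm (B y) <= beta * expR (- y).

(** Absorption: let S be the supremum of |q| on [0, T]. As e^-y has integral at most 1, |q - 1| <= 2
    d beta S <= S / 4, so that S <= 1 + S / 4 and S <= 2. Inserting S <= 2 gives d |q - 1| <= 4 d^2
    beta <= 1 / 2. *)
Lemma ode_near_identity : beta * (8 * (d%:R + 1) ^+ 2) <= 1 ->
  forall y, 0 <= y -> d%:R * cmxnorm (q y - 1%:M) <= 2^-1.
Proof.
move=> bsmall T T0.
have b0 : 0 <= beta by have := Bb (lexx 0); rewrite oppr0 expR0 mulr1; exact/le_trans/cmxnorm_ge0.
have step S : 0 <= S -> (forall y, 0 <= y <= T -> cmxnorm (q y) <= S) ->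
    forall y, 0 <= y <= T -> cmxnorm (q y - 1%:M) <= 2 * (d%:R * (beta * S)).
  move=> S0 qS y /andP[y0 yT]; apply: cmxnorm_le => [|i j]; first by rewrite !mulr_ge0.
  pose K := d%:R * (beta * S); have K0 : 0 <= K by rewrite !mulr_ge0.
  rewrite -q0 !mxE; apply: (@le_trans _ _ (2 * (- (K * expR (- y)) - (- (K * expR (- 0)))))).
    apply: (@mean_value_ineq _ 0 y (fun z => q z i j) (fun z => (B z *m q z) i j)
      (fun z => - (K * expR (- z))) (fun z => K * expR (- z))) => //.
    - move=> x /andP[x0 _]; apply: (cwderW (@segment_ray _ y)); exact: qd.
    - move=> x _; have := @is_deriveZ _ _ _ _ K x 1 _ (is_derive_NexpRN x).
      rewrite /GRing.scale/= => H; rewrite (_ : (fun z => _) = K \*: (fun z => - expR (- z)))//.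
      by apply/funext => z /=; rewrite /GRing.scale/= mulrN.
    - move=> x /andP[/ltW x0 /ltW xy].
      apply: le_trans (cmxnorm_entry _ _ _) _; apply: le_trans (cmxnormM _ _) _.
      rewrite /K -mulrA ler_wpM2l// mulrAC ler_pM ?cmxnorm_ge0 ?Bb//.
      by apply: qS; rewrite x0 (le_trans xy).
  rewrite oppr0 expR0 mulr1 opprK ler_wpM2l// addrC lerBlDr lerDl.
  by rewrite mulr_ge0// expR_ge0.
(* Finiteness of the supremum, by continuity on the compact segment; without it nothing could be
   absorbed. *)
have [S0 S0P] : exists S0 : R, forall y, 0 <= y <= T -> cmxnorm (q y) <= S0.
  have /choice[c cP] : forall ij : 'I_d * 'I_d, exists c : R, forall y, 0 <= y <= T ->
      normc (q y ij.1 ij.2) <= c.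
    move=> [i j] /=; have [cr ci] := @cwder_within_continuous _ 0 T (fun z => q z i j)
      (fun z => (B z *m q z) i j) (fun x xT => cwderW (@segment_ray _ T) (qd (proj1 (andP xT)) i j)).
    have [K1 K1P] := segment_bounded T0 cr; have [K2 K2P] := segment_bounded T0 ci.
    exists (K1 + K2) => y yT; apply: le_trans (normc_le _) _.
    by apply: lerD; [exact: K1P|exact: K2P].
  exists (\sum_ij `|c ij|) => y yT; apply: cmxnorm_le => [|i j]; first exact: sumr_ge0.
  apply: le_trans (cP (i, j) y yT) _; apply: le_trans (ler_norm _) _.
  by rewrite (bigD1 (i, j))//= lerDl sumr_ge0.
pose X := [set cmxnorm (q y) | y in `[0, T]%classic].
have supX : has_sup X.
  split; first by exists (cmxnorm (q 0)); exists 0 => //=; rewrite in_itv/= lexx.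
  by exists S0 => z [y]; rewrite /= in_itv/= => /S0P yS <-.
pose S := sup X.
have XS y : 0 <= y <= T -> cmxnorm (q y) <= S.
  by move=> yT; apply: (ub_le_sup supX.2); exists y => //=; rewrite in_itv.
have S_ge0 : 0 <= S by apply: le_trans (XS 0 _); rewrite ?cmxnorm_ge0// lexx.
have dR : 0 <= d%:R :> R by [].
have db : d%:R * beta <= 8^-1.
  have : d%:R * beta <= beta * (d%:R + 1) ^+ 2.
    by rewrite mulrC ler_wpM2l// expr2; nra.
  by lra.
have ddb : d%:R * (d%:R * beta) <= 8^-1.
  have : d%:R * (d%:R * beta) <= beta * (d%:R + 1) ^+ 2.
    by rewrite mulrA mulrC ler_wpM2l// expr2; nra.
  by lra.
have S2 : S <= 2.
  have : S <= 1 + 4^-1 * S.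
    apply: ge_sup; first exact: supX.1.
    move=> z [y]; rewrite /= in_itv/= => yT <-.
    rewrite -[X in cmxnorm X](subrK 1%:M) addrC (le_trans (cmxnormD _ _))// lerD ?cmxnorm1//.
    rewrite (le_trans (step _ S_ge0 XS y yT))// mulrA mulrA ler_wpM2r//.
    by lra.
  by lra.
have yT : 0 <= T <= T by rewrite T0 lexx.
apply: le_trans (ler_wpM2l _ (step _ S_ge0 XS T yT)) _ => //.
have -> : d%:R * (2 * (d%:R * (beta * S))) = 2 * (d%:R * (d%:R * beta)) * S by ring.
apply: (@le_trans _ _ (2 * 8^-1 * 2)); last by lra.
by rewrite ler_pM// ?mulr_ge0// ler_wpM2l.
Qed.

End NearIdentity.

(** The exponential factor commutes with the diagonal symbol [Phi], so its derivative cancels the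
    contribution of [Phi] and only the remainder survives. *)
Lemma conjugated_derivative {R : realType} d (e V K Phi Rm : 'M[R[i]]_d) :
  Phi *m e = e *m Phi ->
  (- 'i *: (Phi *m e) *m V + e *m ('i *: ((Phi + Rm) *m V))) *m K
  = 'i *: (e *m Rm *m V *m K).
Proof.
move=> ->.
have -> : - 'i *: (e *m Phi) *m V = - ('i *: (e *m Phi *m V)).
  by rewrite scaleNr mulNmx -scalemxAl.
have -> : e *m ('i *: ((Phi + Rm) *m V)) = 'i *: (e *m Phi *m V) + 'i *: (e *m Rm *m V).
  by rewrite -scalemxAr mulmxDl mulmxDr scalerDr !mulmxA.
by rewrite addrA addNr add0r -scalemxAl.
Qed.

(** * The amplitude Q *)

Section PhaseSystem.
Context {R : realType} {n d : nat}.
Local Notation point := (R * 'rV[R]_n)%type.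
Local Notation matrix_symbol := (R -> 'rV[R]_n -> 'M[R[i]]_d).
Variables (M Nd F Rem : matrix_symbol) (lambda : 'I_d -> R -> 'rV[R]_n -> R).
Variables (E : R -> R -> 'rV[R]_n -> 'M[R[i]]_d) (N1 : R).

Definition phi (j : 'I_d) (t : R) (xi : 'rV[R]_n) : R[i] :=
  (Dsym lambda t xi + F t xi) j j.

Definition phase (j : 'I_d) (t s : R) (xi : 'rV[R]_n) : R[i] :=
  cintegral s t (fun tau => phi j tau xi).

(** c = i gives [Etilde] and c = -i its inverse, by [dexpM] and [dexp0]. *)
Definition dexp (c : R[i]) (t s : R) (xi : 'rV[R]_n) : 'M[R[i]]_d :=
  diag_mx (\row_j cexp (c * phase j t s xi)).

Definition Qmx (t s : R) (xi : 'rV[R]_n) : 'M[R[i]]_d :=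
  dexp (- 'i) t s xi *m (invmx (Nd t xi) *m (invmx (M t xi) *m E t s xi))
  *m (M s xi *m Nd s xi).

(* [Qmx] solves [D_t Q = Pmx Q]. *)
Definition Pmx (t s : R) (xi : 'rV[R]_n) : 'M[R[i]]_d :=
  dexp (- 'i) t s xi *m Rem t xi *m dexp 'i t s xi.

Hypothesis phic : forall j, cont_on (Zhyp N1) (fun p => phi j p.1 p.2).
Hypothesis Fdiag : forall t xi, Zhyp N1 (t, xi) -> is_diag_mx (F t xi).
Hypothesis VD : forall (s t : R) xi, 0 <= s -> Zopen N1 (t, xi) ->
  mdquot (increments nonneg_time None (t, xi))
    (fun h => invmx (Nd (t + h) xi) *m (invmx (M (t + h) xi) *m E (t + h) s xi))
    (invmx (Nd t xi) *m (invmx (M t xi) *m E t s xi))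
    ('i *: ((Dsym lambda t xi + F t xi + Rem t xi)
            *m (invmx (Nd t xi) *m (invmx (M t xi) *m E t s xi)))).

Lemma zone_cont_time (f : point -> R[i]) (s t : R) xi : cont_on (Zhyp N1) f -> Zhyp N1 (s, xi) -> s <= t ->
  ccvg (within `[s, +oo[ (nbhs t)) (fun tau => f (tau, xi)) (f (t, xi)).
Proof.
move=> fc Zs st; have Zt := Zhyp_up Zs st.
apply/ccvgP => e e0; have /ccvgP/(_ e e0)/pair_near[r r0 rP] := fc (t, xi) Zt.
apply/nbhs_ballP; exists r => // z /=; rewrite /ball/= in_itv/= andbT => zr sz.
apply: rP => //=; rewrite ?subrr ?normr0//; first by rewrite distrC.
exact: Zhyp_up Zs sz.
Qed.

Lemma phase_time j (s t : R) xi : Zhyp N1 (s, xi) -> s <= t ->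
  cwder `[s, +oo[ (fun t => phase j t s xi) t (phi j t xi).
Proof.
move=> Zs st; apply: (@cintegral_cwder _ s (fun tau => phi j tau xi)) => // z sz.
exact: (zone_cont_time (f := fun p => phi j p.1 p.2)).
Qed.

Lemma phase_id j s xi : phase j s s xi = 0.
Proof. exact: cintegral_id. Qed.

Lemma cexpD (z w : R[i]) : cexp (z + w) = cexp z * cexp w.
Proof.
rewrite /cexp cReD cImD expRD cosD sinD.
by apply: eq_complexP; rewrite ?cReM ?cImM /=; ring.
Qed.

Lemma cexp0 : cexp (0 : R[i]) = 1.
Proof. by rewrite /cexp /= expR0 cos0 sin0 mul1r mulr0. Qed.

Lemma dexpM c c' t s xi : dexp c t s xi *m dexp c' t s xi = dexp (c + c') t s xi.
Proof.
rewrite /dexp mulmx_diag; congr diag_mx; apply/rowP => j.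
by rewrite !mxE mulrDl cexpD.
Qed.

Lemma dexp0 t s xi : dexp 0 t s xi = 1%:M.
Proof.
rewrite /dexp -diag_const_mx; congr diag_mx; apply/rowP => j.
by rewrite !mxE mul0r cexp0.
Qed.

Lemma Qmx_id s xi : Zhyp N1 (s, xi) -> M s xi \in unitmx -> Nd s xi \in unitmx ->
  E s s xi = 1%:M -> Qmx s s xi = 1%:M.
Proof.
move=> Zs Mu Nu Es; rewrite /Qmx Es mulmx1.
have -> : dexp (- 'i) s s xi = 1%:M.
  rewrite /dexp -diag_const_mx; congr diag_mx; apply/rowP => j.
  by rewrite !mxE phase_id mulr0 cexp0.
by rewrite mul1mx -mulmxA mulKmx// mulVmx.
Qed.

Lemma Phi_diag t xi : Zhyp N1 (t, xi) ->
  Dsym lambda t xi + F t xi = diag_mx (\row_j phi j t xi).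
Proof.
move=> /Fdiag/is_diag_mxP Fd; apply/matrixP => a b; rewrite !mxE /phi !mxE.
have [->|ab] := eqVneq a b; first by rewrite eqxx.
by rewrite Fd// !mulr0n addr0.
Qed.

Lemma dexp_time c (s t : R) xi : Zhyp N1 (s, xi) -> s <= t ->
  mdquot (within [set h | `[s, +oo[%classic (t + h)] (0 : R)^')
    (fun h => dexp c (t + h) s xi) (dexp c t s xi)
    (c *: ((Dsym lambda t xi + F t xi) *m dexp c t s xi)).
Proof.
move=> Zs st a b; rewrite Phi_diag; last exact: Zhyp_up Zs st.
rewrite /dexp mulmx_diag !mxE.
have [->|ab] := eqVneq a b; last first.
  rewrite !mulr0n mulr0; apply: dquot_near (dquot_cst 0).
  by apply: filterE => h; rewrite !mxE (negbTE ab) mulr0n.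
rewrite !mulr1n mulrA.
have ph := phase_time b Zs st.
apply: (dquot_near _ (dquot_cexp (within_dnbhs_le _) (dquotZ (within_dnbhs_le _) c ph))).
by apply: filterE => h; rewrite !mxE eqxx mulr1n.
Qed.

Lemma Qmx_time (s t : R) xi : Zhyp N1 (s, xi) -> s <= t -> Zopen N1 (t, xi) ->
  mdquot (within [set h | `[s, +oo[%classic (t + h)] (0 : R)^')
    (fun h => Qmx (t + h) s xi) (Qmx t s xi) ('i *: (Pmx t s xi *m Qmx t s xi)).
Proof.
move=> Zs st Zt; have s0 : 0 <= s by case: Zs.
set G := within _ _; have FG : Filter G by exact: within_filter.
have G0 : (0 : R)^' `<=` G by exact: within_dnbhs_le.
have Vt : mdquot G
    (fun h => invmx (Nd (t + h) xi) *m (invmx (M (t + h) xi) *m E (t + h) s xi))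
    (invmx (Nd t xi) *m (invmx (M t xi) *m E t s xi))
    ('i *: ((Dsym lambda t xi + F t xi + Rem t xi)
            *m (invmx (Nd t xi) *m (invmx (M t xi) *m E t s xi)))).
  move=> a b; apply: dquot_filter (VD s0 Zt a b) => P /incrementsP[r r0 rP].
  apply/within_dnbhsP; exists r => // h h0 hr; rewrite /= in_itv/= andbT => sh.
  by apply: rP => //; rewrite dir_time /nonneg_time /=; exact: le_trans sh.
set Phi := Dsym lambda t xi + F t xi in Vt.
set V := invmx (Nd t xi) *m _ in Vt.
pose K := M s xi *m Nd s xi; pose e := dexp (- 'i) t s xi.
have H := @mdquotM _ _ FG G0 _ _ _ _ _ _ _ _ _ (@mdquotM _ _ FG G0 _ _ _ _ _ _ _ _ _
  (dexp_time (- 'i) Zs st) Vt) (@mdquot_cst _ _ FG _ _ K).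
have PhiC : Phi *m e = e *m Phi.
  by rewrite /Phi Phi_diag; [exact: diag_mxC|exact: Zopen_Zhyp].
have eK (X : 'M[R[i]]_d) : dexp 'i t s xi *m (e *m X) = X.
  by rewrite mulmxA dexpM subrr dexp0 mul1mx.
have -> : 'i *: (Pmx t s xi *m Qmx t s xi) =
    (- 'i *: (Phi *m e) *m V + e *m ('i *: ((Phi + Rem t xi) *m V))) *m K + e *m V *m 0.
  rewrite mulmx0 addr0 conjugated_derivative//; congr (_ *: _).
  rewrite /Pmx /Qmx -/e -/V -/K -(mulmxA (e *m Rem t xi) (dexp 'i t s xi)).
  by rewrite -(mulmxA e V K) eK !mulmxA.
exact: H.
Qed.

(** The substitution 1 + t = (1 + s) e^y, whose dt/dy is the scalar factor, for any initial time:
    general s serves the uniform bounds, s = t_xi the frequency derivatives. *)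
Lemma Qmx_log (s y : R) xi : Zhyp N1 (s, xi) -> 0 <= y ->
  Zopen N1 (s, xi) ->
  mdquot (within [set h | `[0, +oo[%classic (y + h)] (0 : R)^')
    (fun h => Qmx ((1 + s) * expR (y + h) - 1) s xi) (Qmx ((1 + s) * expR y - 1) s xi)
    ((('i * ((1 + s) * expR y)%:C) *: Pmx ((1 + s) * expR y - 1) s xi)
      *m Qmx ((1 + s) * expR y - 1) s xi).
Proof.
move=> Zs y0 Os; set t := (1 + s) * expR y - 1.
have s1 : 0 < 1 + s by case: Zs => /= s0 _; rewrite ltr_pwDl.
have ge z : 0 <= z -> s <= (1 + s) * expR z - 1.
  move=> z0; have : 1 <= expR z by rewrite -[leLHS]expR0 ler_expR.
  by rewrite -(ler_pM2l s1); lra.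
have Ot : Zopen N1 (t, xi).
  case: Os => /= s0 sN; split => /=; first by apply: le_trans s0 (ge y y0).
  by apply: lt_le_trans sN _; rewrite ler_wpM2r ?enorm_ge0// lerD2l ge.
have Qt := Qmx_time Zs (ge y y0) Ot.
move=> a b.
have -> : ((('i * ((1 + s) * expR y)%:C) *: Pmx t s xi) *m Qmx t s xi) a b =
    ('i *: (Pmx t s xi *m Qmx t s xi)) a b * ((1 + s) * expR y)%:C.
  by rewrite -scalemxAl mxE [in RHS]mxE mulrAC.
have td : dquot (within [set h | `[0, +oo[%classic (y + h)] (0 : R)^')
    (fun h => ((1 + s) * expR (y + h) - 1)%:C) t%:C ((1 + s) * expR y)%:C.
  have H := is_derive_cwder `[0, +oo[ (is_derive_expR y).
  have -> : t%:C = (1 + s)%:C * (expR y)%:C - 1 by rewrite /t rmorphB rmorphM.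
  rewrite [((1 + s) * expR y)%:C]rmorphM -[X in dquot _ _ _ X]subr0.
  apply: (dquot_near _ (dquotB (dquotZ (within_dnbhs_le _) (1 + s)%:C H) (dquot_cst 1))).
  by apply: filterE => h; rewrite rmorphB rmorphM.
have Qab : cwder `[s, +oo[ (fun t => Qmx t s xi a b) t (('i *: (Pmx t s xi *m Qmx t s xi)) a b).
  exact: Qt.
apply: (dquot_cwder_comp (S := `[s, +oo[) (within_dnbhs_le _) td Qab).
by apply/within_dnbhsP; exists 1 => // h _ _; rewrite /= !in_itv/= !andbT; exact: ge.
Qed.

End PhaseSystem.

Lemma is_derive_Ninv1D (R : realType) (c z : R) : 0 < 1 + z ->
  is_derive z 1 (fun z => - (c * (1 + z)^-1)) (c * (1 + z)^-1 ^+ 2).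
Proof.
move=> z0.
have d1 : is_derive z 1 (fun z : R => 1 + z) 1.
  have H : is_derive z (1 : R) ((cst (1 : R) : R -> R) + (id : R -> R)) (0 + 1) by exact: is_deriveD.
  by rewrite add0r in H.
have d2 := @is_deriveV R (fun z => 1 + z) z 1 1 (lt0r_neq0 z0) d1.
have := is_deriveN (@is_deriveZ _ _ _ _ c z 1 _ d2).
by move=> /is_derive_eq; apply; rewrite /GRing.scale/= mulr1 exprVn mulrN opprK.
Qed.

(** * Growth of the phases and size of the coefficient *)

Section PhaseBounds.
Context {R : realType} {n d : nat}.
Local Notation point := (R * 'rV[R]_n)%type.
Local Notation matrix_symbol := (R -> 'rV[R]_n -> 'M[R[i]]_d).

Lemma cintegral_eq (a b : R) (f g : R -> R[i]) :
  (forall x, a <= x <= b -> f x = g x) -> cintegral a b f = cintegral a b g.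
Proof.
move=> fg; rewrite /cintegral; congr (_ +i* _); apply: eq_Rintegral => x;
  by rewrite inE/= in_itv/= => /fg ->.
Qed.

(** Isolates powers of (1 + t)|xi|, the quantity bounded below in the zone. *)
Lemma zweightE (k l : nat) (p : point) : 0 < enorm p.2 -> 0 < 1 + p.1 ->
  zweight (- k%:R) (k%:R + l%:R) p = ((1 + p.1) * enorm p.2)^-1 ^+ k * (1 + p.1)^-1 ^+ l.
Proof.
move=> x0 t0; rewrite /zweight opprD -opprD -natrD !powRN !powR_mulrn ?ltW//.
by rewrite exprD !exprVn exprMn; field; rewrite !expf_neq0 ?gt_eqF.
Qed.

Lemma ln_ratio (s y : R) : 0 < 1 + s ->
  ln ((1 + ((1 + s) * expR y - 1)) / (1 + s)) = y.
Proof. by move=> s0; rewrite subrKC mulrAC divff ?gt_eqF// mul1r expRK. Qed.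

Lemma time_log (s t : R) : 0 < 1 + s -> 0 < 1 + t ->
  (1 + s) * expR (ln ((1 + t) / (1 + s))) - 1 = t.
Proof.
move=> s0 t0; rewrite lnK ?posrE ?divr_gt0//.
by field; rewrite gt_eqF.
Qed.

Variables (F F0 : matrix_symbol) (lambda : 'I_d -> R -> 'rV[R]_n -> R) (N1 : R).
Hypothesis N1_ge1 : 1 <= N1.
Local Notation phi := (phi F lambda).
Local Notation phase := (phase F lambda).
Hypothesis phic : forall j, cont_on (Zhyp N1) (fun p => phi j p.1 p.2).
Hypothesis F0c : forall j, cont_on (Zhyp N1) (fun p => F0 p.1 p.2 j j).

Lemma zone_pos (N : R) (p : point) : 0 < N -> Zhyp N p -> 0 < enorm p.2 /\ 0 < 1 + p.1.
Proof.
move=> N0 Zp; split; first exact: (enorm_gt0 p.2 N0 Zp).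
by case: Zp => p0 _; rewrite ltr_pwDl.
Qed.

(** D is real, so only F - F_0 = O(|xi|^-1 (1 + z)^-2) contributes. Its integral from s is at most
    C0 / ((1 + s)|xi|) <= C0 because N1 >= 1; the factor 2 is that of [mean_value_ineq]. *)
Lemma phase_im (C0 : R) (s t : R) xi j : 0 <= C0 ->
  (forall p, Zhyp N1 p -> normc (F p.1 p.2 j j - F0 p.1 p.2 j j)
     <= C0 * (((1 + p.1) * enorm p.2)^-1 * (1 + p.1)^-1)) ->
  Zhyp N1 (s, xi) -> s <= t ->
  `|cIm (phase j t s xi) - cIm (cintegral s t (fun tau => F0 tau xi j j))| <= 2 * C0.
Proof.
move=> C00 FF0 Zs st; have N10 : 0 < N1 by exact: lt_le_trans N1_ge1.
have [x0 s0] := zone_pos N10 Zs; rewrite /= in x0 s0.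
pose f z := (cIm (phase j z s xi) - cIm (cintegral s z (fun tau => F0 tau xi j j)))%:C : R[i].
pose H z := - (C0 / enorm xi * (1 + z)^-1).
pose H' z := C0 * (((1 + z) * enorm xi)^-1 * (1 + z)^-1).
have fs : f s = 0 by rewrite /f phase_id cintegral_id subrr.
rewrite -normc_real -[X in normc X]subr0 -fs.
have pos z : s <= z -> 0 < 1 + z by lra.
apply: (@le_trans _ _ (2 * (H t - H s))).
  apply: (@mean_value_ineq _ s t f
    (fun z => (cIm (phi j z xi) - cIm (F0 z xi j j))%:C) H H') => //.
  - move=> z /andP[sz zt].
    have Szt : (`[s, t] `<=` `[s, +oo[)%classic.
      by move=> x /=; rewrite !in_itv/= andbT => /andP[].
    have P1 := cwderW Szt (phase_time (lambda := lambda) (F := F) phic j Zs sz).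
    have P2 : cwder `[s, t] (fun z => cintegral s z (fun tau => F0 tau xi j j)) z (F0 z xi j j).
      apply: (cwderW Szt); apply: (@cintegral_cwder _ s (fun tau => F0 tau xi j j)) => // y sy.
      exact: (zone_cont_time (f := fun p => F0 p.1 p.2 j j)).
    have -> : (cIm (phi j z xi) - cIm (F0 z xi j j))%:C
        = (cIm (phi j z xi))%:C - (cIm (F0 z xi j j))%:C :> R[i] by rewrite rmorphB.
    rewrite /cwder; have -> : f z = (cIm (phase j z s xi))%:C
        - (cIm (cintegral s z (fun tau => F0 tau xi j j)))%:C by rewrite /f rmorphB.
    have F0' := within_dnbhs_le [set h | `[s, t]%classic (z + h)].
    apply: (dquot_near _ (dquotB (dquotIm F0' P1) (dquotIm F0' P2))).
    by apply: filterE => h; rewrite /f rmorphB.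
  - move=> z /andP[sz _]; have z0 := pos z sz.
    rewrite /H'; have -> : C0 * (((1 + z) * enorm xi)^-1 * (1 + z)^-1) = C0 / enorm xi * (1 + z)^-1 ^+ 2.
      by field; rewrite !gt_eqF.
    exact: is_derive_Ninv1D.
  - move=> z /andP[/ltW sz _].
    have := FF0 (z, xi) (Zhyp_up Zs sz); apply: le_trans.
    have -> : cIm (phi j z xi) - cIm (F0 z xi j j) = cIm (F z xi j j - F0 z xi j j).
      by rewrite /phi /Dsym !mxE eqxx mulr1n !cImD cImN add0r.
    by rewrite normc_real absIm_le.
have H0 : H t - H s <= C0.
  have h1 : H t <= 0 by rewrite oppr_le0 mulr_ge0 ?divr_ge0 ?invr_ge0 ?enorm_ge0// ltW// pos.
  suff : - H s <= C0 by lra.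
  rewrite opprK -mulrA ler_piMr// -invfM invf_le1 ?mulr_gt0//.
  by case: Zs => _ /= /(le_trans N1_ge1); rewrite mulrC.
by rewrite ler_wpM2l.
Qed.

End PhaseBounds.

Section SymbolBounds.
Context {R : realType} {n d : nat}.
Local Notation point := (R * 'rV[R]_n)%type.
Local Notation matrix_symbol := (R -> 'rV[R]_n -> 'M[R[i]]_d).

(** Every symbol comes with its own zone constant; as conditions near +oo, finitely many of them
    intersect and yield a common one. *)
Lemma symbol_near m1 m2 (a : point -> R[i]) : symbol m1 m2 a ->
  \forall N \near +oo, forall m, wsmooth (Zhyp N) predT zwt m (zweight m1 m2) a.
Proof.
move=> /symbol_wsmooth[N0 _ H]; near=> N; apply: H.
by near: N; apply: nbhs_pinfty_gt; exact: num_real.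
Unshelve. all: by end_near. Qed.

Lemma symbol_mx_near m1 m2 p q (B : R -> 'rV[R]_n -> 'M[R[i]]_(p, q)) : symbol_mx m1 m2 B ->
  \forall N \near +oo, forall i j m, wsmooth (Zhyp N) predT zwt m (zweight m1 m2) (entry B i j).
Proof. by move=> sB; do 2 apply: filter_forall => ?; exact: symbol_near. Qed.

Lemma in_some_Zhyp_near (P : R -> 'rV[R]_n -> Prop) : in_some_Zhyp P ->
  \forall N \near +oo, forall t xi, Zhyp N (t, xi) -> P t xi.
Proof.
move=> [N0 _ H]; near=> N => t xi [t0 tN]; apply: H; split => //.
by apply: le_trans tN; near: N; apply: nbhs_pinfty_ge; exact: num_real.
Unshelve. all: by end_near. Qed.

Lemma wsmooth_mx_bound p q (B : R -> 'rV[R]_n -> 'M[R[i]]_(p, q)) (D : set point) dirs wt m g :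
  (forall i j, wsmooth D dirs wt m g (entry B i j)) ->
  exists2 C : R, 0 <= C & forall i j r, D r -> normc (B r.1 r.2 i j) <= C * `|g r|.
Proof.
move=> ws; have /choice[c cP] : forall ij : 'I_p * 'I_q, exists C : R, forall r, D r ->
    normc (B r.1 r.2 ij.1 ij.2) <= C * g r.
  by move=> [i j]; exact: wsmooth_bound (ws i j).
exists (\sum_ij `|c ij|); first exact: sumr_ge0.
move=> i j r Dr; apply: le_trans (cP (i, j) r Dr) _.
apply: le_trans (ler_norm _) _; rewrite normrM ler_wpM2r//.
by rewrite (bigD1 (i, j))//= lerDl sumr_ge0.
Qed.

Lemma zweight_ge0 m1 m2 (p : point) : 0 <= zweight m1 m2 p.
Proof. by rewrite mulr_ge0// powR_ge0. Qed.

(** Telescoping sum: F_j - F_{j-1} is O(((1 + t)|xi|)^-j (1 + t)^-1), and since (1 + t)|xi| >= 1 the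
    case j = 1 is the largest. *)
Lemma diagonal_corrections (F : nat -> matrix_symbol) k :
  (forall k, (1 < k)%N -> symbol_mx (1 - k%:R) k%:R (fun t xi => F k.-1 t xi - F k.-2 t xi)) ->
  \forall N \near +oo, exists2 C : R, 0 <= C & forall i j p, Zhyp N p ->
    normc (F k p.1 p.2 i j - F 0%N p.1 p.2 i j) <= C * (((1 + p.1) * enorm p.2)^-1 * (1 + p.1)^-1).
Proof.
move=> FF; elim: k => [|k ih].
  apply: filterE => N; exists 0 => // i j p _.
  by rewrite subrr Normc.normc0 mul0r.
have N1 : \forall N \near +oo, (1 : R) <= N by apply: nbhs_pinfty_ge; exact: num_real.
apply: filter_app ih; apply: filter_app N1; have := symbol_mx_near (FF k.+2 isT).
apply: filterS => N sF; have := wsmooth_mx_bound (fun i j => sF i j 0%N).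
move=> [C2 C20 C2P] N1 [C1 C10 C1P]; exists (C2 + C1); first exact: addr_ge0.
move=> i j p Zp; rewrite mulrDl.
have -> : F k.+1 p.1 p.2 i j - F 0%N p.1 p.2 i j
  = (F k.+1 p.1 p.2 - F k p.1 p.2) i j + (F k p.1 p.2 i j - F 0%N p.1 p.2 i j).
  by rewrite !mxE addrA subrK.
apply: le_trans (le_normcD _ _) _; apply: lerD; last exact: C1P.
apply: le_trans (C2P i j p Zp) _; apply: ler_wpM2l => //.
have [x0 p0] := zone_pos (lt_le_trans ltr01 N1) Zp.
rewrite ger0_norm ?zweight_ge0//.
have -> : 1 - k.+2%:R = - k.+1%:R :> R by rewrite -(natr1 k.+1); ring.
rewrite -(natr1 k.+1) (_ : 1 = 1%:R)// zweightE// expr1 ler_wpM2r ?invr_ge0 ?(ltW p0)//.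
have r1 : 1 <= (1 + p.1) * enorm p.2 by case: Zp => _; exact: le_trans.
by rewrite exprS ler_piMr ?invr_ge0 ?mulr_ge0 ?exprn_ile1 ?invf_le1 ?mulr_gt0 ?invr_ge0 ?mulr_ge0 ?(ltW x0) ?(ltW p0).
Qed.

End SymbolBounds.

Lemma cRe_iM {R : realType} (z : R[i]) : cRe ('i * z) = - cIm z.
Proof. by case: z => a b; rewrite cReM /=; ring. Qed.

Lemma cRe_NiM {R : realType} (z : R[i]) : cRe (- 'i * z) = cIm z.
Proof. by rewrite mulNr cReN cRe_iM opprK. Qed.

Section Growth.
Context {R : realType} {n d : nat}.
Local Notation matrix_symbol := (R -> 'rV[R]_n -> 'M[R[i]]_d).
Variables (F F0 Rem : matrix_symbol) (lambda : 'I_d -> R -> 'rV[R]_n -> R) (N1 : R).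
Variables (kp km : R).
Hypothesis N1_ge1 : 1 <= N1.
Local Notation phi := (phi F lambda).
Local Notation phase := (phase F lambda).
Local Notation dexp := (dexp F lambda).
Local Notation Pmx := (Pmx F Rem lambda).

Let N1_gt0 : 0 < N1. Proof. exact: lt_le_trans N1_ge1. Qed.

Lemma enorm_neq0 (xi : 'rV[R]_n) : 0 < enorm xi -> xi != 0.
Proof.
apply: contraTneq => ->; rewrite /enorm big1 ?sqrtr0 ?ltxx// => j _.
by rewrite mxE expr0n.
Qed.

Lemma txi_le (N s : R) (xi : 'rV[R]_n) : 0 < enorm xi -> Zhyp N (s, xi) -> txi N xi <= s.
Proof.
by move=> x0 [/= s0 sN]; rewrite /txi ge_max s0 andbT lerBlDl ler_pdivrMr.
Qed.

Lemma phase_growth (C0 Ns Cp Cm : R) :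
  (forall j, cont_on (Zhyp N1) (fun p => phi j p.1 p.2)) ->
  (forall j, cont_on (Zhyp N1) (fun p => F0 p.1 p.2 j j)) ->
  0 <= C0 ->
  (forall j p, Zhyp N1 p -> normc (F p.1 p.2 j j - F0 p.1 p.2 j j)
     <= C0 * (((1 + p.1) * enorm p.2)^-1 * (1 + p.1)^-1)) ->
  Ns <= N1 ->
  (forall xi (s t : R) j, xi != 0 -> txi Ns xi <= s -> Zhyp N1 (s, xi) -> s <= t ->
     let I := cIm (cintegral s t (fun tau => F0 tau xi j j)) in
     kp * ln ((1 + t) / (1 + s)) + Cp <= I /\ I <= km * ln ((1 + t) / (1 + s)) + Cm) ->
  exists2 c : R, 0 <= c & forall (s t : R) xi j, Zhyp N1 (s, xi) -> s <= t ->
    kp * ln ((1 + t) / (1 + s)) - c <= cIm (phase j t s xi) <= km * ln ((1 + t) / (1 + s)) + c.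
Proof.
move=> phic F0c C00 FF0 NsN sub; exists (2 * C0 + (`|Cp| + `|Cm|)).
  by rewrite addr_ge0 ?mulr_ge0 ?addr_ge0.
move=> s t xi j Zs st; have [x0 _] := zone_pos N1_gt0 Zs; rewrite /= in x0.
have ts : txi Ns xi <= s.
  by apply: txi_le => //; case: Zs => s0 sN; split => //; exact: le_trans sN.
have [h3 h4] := sub xi s t j (enorm_neq0 x0) ts Zs st.
have := phase_im N1_ge1 phic F0c C00 (FF0 j) Zs st.
move: (cIm (phase j t s xi)) (cIm (cintegral s t _)) (ln _) h3 h4 => a b L h3 h4.
rewrite ler_norml => /andP[h1 h2].
have h5 := ler_norm (- Cp); have h6 := ler_norm Cm; rewrite normrN in h5.
have h7 := normr_ge0 Cp; have h8 := normr_ge0 Cm.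
apply/andP; split; lra.
Qed.

Variables (c CR : R) (k : nat).
Hypothesis phase_bd : forall (s t : R) xi j, Zhyp N1 (s, xi) -> s <= t ->
  kp * ln ((1 + t) / (1 + s)) - c <= cIm (phase j t s xi) <= km * ln ((1 + t) / (1 + s)) + c.

Lemma dexp_bound (s t : R) xi : Zhyp N1 (s, xi) -> s <= t ->
  cmxnorm (dexp 'i t s xi) <= expR c * ((1 + t) / (1 + s)) `^ (- kp).
Proof.
move=> Zs st; have s0 : 0 < 1 + s by case: Zs => /= s0 _; rewrite ltr_pwDl.
apply: cmxnorm_le => [|i j]; first by rewrite mulr_ge0 ?expR_ge0 ?powR_ge0.
rewrite !mxE; case: (i == j); rewrite ?mulr0n ?Normc.normc0 ?mulr_ge0 ?expR_ge0 ?powR_ge0//.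
rewrite mulr1n normc_cexp cRe_iM.
have t0 : 0 < 1 + t by lra.
rewrite /powR gt_eqF ?divr_gt0//.
rewrite -expRD ler_expR; have /andP[h _] := phase_bd i Zs st.
by lra.
Qed.

Hypothesis CR_ge0 : 0 <= CR.
Hypothesis kappa_ge0 : 0 <= km - kp.
Hypothesis k_gt : km - kp + 1 < k%:R.
Hypothesis Remb : forall i j p, Zhyp N1 p ->
  normc (Rem p.1 p.2 i j) <= CR * zweight (- k%:R) (k%:R + 1) p.

(** With kappa = km - kp, conjugation costs e^(2c + kappa y), the remainder is O(((1 + t)|xi|)^-k (1
    + t)^-1), and dt/dy = 1 + t cancels the last factor. As (1 + t)|xi| >= N e^y, the exponent kappa
    - k < -1 leaves e^-y. *)
Lemma Pmx_bound (N s y : R) xi : N1 <= N -> Zhyp N (s, xi) -> 0 <= y ->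
  cmxnorm (('i * ((1 + s) * expR y)%:C) *: Pmx ((1 + s) * expR y - 1) s xi)
  <= CR * expR (2 * c) / N * expR (- y).
Proof.
move=> N1N ZNs y0; set t := (1 + s) * expR y - 1.
have N0 : 0 < N by exact: lt_le_trans N1N.
have Zs : Zhyp N1 (s, xi) by case: ZNs => ? ?; split => //; exact: le_trans N1N _.
have [x0 s0] := zone_pos N0 ZNs; rewrite /= in x0 s0.
have e1 : 1 <= expR y by rewrite -[leLHS]expR0 ler_expR.
have st : s <= t by rewrite /t lerBrDr addrC ler_peMr// ltW.
have T0 : 0 < (1 + s) * expR y by rewrite mulr_gt0 ?expR_gt0.
apply: cmxnorm_le => [|a b].
  by rewrite !mulr_ge0 ?invr_ge0 ?expR_ge0// ltW.
rewrite mxE /Pmx /dexp mul_mx_diag mul_diag_mx !mxE !Normc.normcM !normc_cexp.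
rewrite normc_real normc_i mul1r (ger0_norm (ltW T0)) cRe_NiM cRe_iM.
have /andP[_ Ha] := phase_bd a Zs st; have /andP[Hb _] := phase_bd b Zs st.
move: Ha Hb; rewrite ln_ratio// => Ha Hb.
have Hr := Remb a b (Zhyp_up Zs st).
have t1 : 1 + t = (1 + s) * expR y by rewrite /t subrKC.
rewrite /= (_ : 1 = 1%:R)// zweightE//= ?t1// expr1 in Hr.
move: (cIm (phase a t s xi)) (cIm (phase b t s xi)) Ha Hb => pa pb Ha Hb.
have k1 : (0 < k)%N.
  by rewrite -(ltr0n R); apply: le_lt_trans k_gt; rewrite addr_ge0.
have rhoN : N * expR y <= (1 + s) * expR y * enorm xi.
  by rewrite mulrAC ler_wpM2r ?expR_ge0//; case: ZNs.
have NeY : 0 < N * expR y by rewrite mulr_gt0 ?expR_gt0.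
have rho0 : 0 < (1 + s) * expR y * enorm xi by rewrite mulr_gt0.
(* One of the k factors 1/N is kept; it makes the coefficient small for large [N]. The others are at
   most 1. *)
have rk : ((1 + s) * expR y * enorm xi)^-1 ^+ k <= N^-1 * expR (- (k%:R * y)).
  rewrite exprVn expRN expRM_natl -invfM lef_pV2 ?posrE ?mulr_gt0 ?exprn_gt0 ?expR_gt0//.
  apply: le_trans (_ : (N * expR y) ^+ k <= _); last first.
    by rewrite lerXn2r ?nnegrE ?(ltW NeY)// (le_trans (ltW NeY)).
  rewrite exprMn ler_wpM2r ?exprn_ge0 ?expR_ge0//.
  by rewrite -[leLHS]expr1 ler_weXn2l// (le_trans N1_ge1).
have -> : CR * expR (2 * c) / N * expR (- y)
   = (1 + s) * expR y * (CR * (expR (2 * c) * (N^-1 * expR (- y)) * ((1 + s) * expR y)^-1)).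
  by field; rewrite !gt_eqF ?expR_gt0.
rewrite ler_wpM2l ?(ltW T0)//.
apply: le_trans (_ : expR (km * y + c) * (CR * (N^-1 * expR (- (k%:R * y)) * ((1 + s) * expR y)^-1))
   * expR (c - kp * y) <= _).
  have Rb' : normc (Rem t xi a b) <= CR * (N^-1 * expR (- (k%:R * y)) * ((1 + s) * expR y)^-1).
    by apply: le_trans Hr _; rewrite ler_wpM2l// ler_wpM2r// invr_ge0 ltW.
  have ea : expR pa <= expR (km * y + c) by rewrite ler_expR.
  have eb : expR (- pb) <= expR (c - kp * y) by rewrite ler_expR -[leRHS]opprB lerN2.
  apply: ler_pM eb; rewrite ?expR_ge0 ?mulr_ge0 ?expR_ge0 ?normc_ge0//.
  by apply: ler_pM; rewrite ?expR_ge0 ?normc_ge0.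
have -> : expR (km * y + c) * (CR * (N^-1 * expR (- (k%:R * y)) * ((1 + s) * expR y)^-1)) * expR (c - kp * y)
  = CR * (N^-1 * (expR (km * y + c) * expR (- (k%:R * y)) * expR (c - kp * y)) * ((1 + s) * expR y)^-1).
  by ring.
have -> : expR (2 * c) * (N^-1 * expR (- y)) = N^-1 * (expR (2 * c) * expR (- y)) by ring.
rewrite ler_wpM2l// ler_wpM2r ?invr_ge0 ?(ltW T0)// ler_wpM2l ?invr_ge0 ?(ltW N0)//.
rewrite -!expRD ler_expR.
have : 0 <= (k%:R - (km - kp + 1)) * y by rewrite mulr_ge0// subr_ge0 ltW.
by rewrite !mulrBl mulrDl mulrBl mul1r; move: (km * y) (kp * y) (k%:R * y) => *; lra.
Qed.

End Growth.

(** * Derivatives of the coefficient in logarithmic time *)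

Section Regularity.
Context {R : realType} {n d : nat}.
Local Notation point := (R * 'rV[R]_n)%type.
Local Notation matrix_symbol := (R -> 'rV[R]_n -> 'M[R[i]]_d).
Variables (F Rem : matrix_symbol) (lambda : 'I_d -> R -> 'rV[R]_n -> R) (N1 N : R).
Variables (kp km c : R) (k : nat).
Local Notation phi := (phi F lambda).
Local Notation phase := (phase F lambda).
Local Notation Pmx := (Pmx F Rem lambda).
Hypothesis N1_ge1 : 1 <= N1.
Hypothesis N1N : N1 < N.
Let N1_gt0 : 0 < N1. Proof. exact: lt_le_trans N1_ge1. Qed.
Let N_gt0 : 0 < N. Proof. exact: lt_trans N1N. Qed.
Local Notation U := (Ureg N).
Local Notation Y := (halfspace U).
Local Notation wt := (hwt fwt).
Local Notation T := (logtime N).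
Hypothesis phis : forall j m, wsmooth (Zhyp N1) predT zwt m (zweight 1 0) (fun p => phi j p.1 p.2).
Hypothesis rems : forall a b m,
  wsmooth (Zhyp N1) predT zwt m (zweight (- k%:R) (k%:R + 1)) (entry Rem a b).
Hypothesis phase_bd : forall (s t : R) xi j, Zhyp N1 (s, xi) -> s <= t ->
  kp * ln ((1 + t) / (1 + s)) - c <= cIm (phase j t s xi) <= km * ln ((1 + t) / (1 + s)) + c.

Let wt_ge0 o (p : point) : Y p -> 0 <= wt o p. Proof. by apply: hwt_ge0 => j xi; exact: fwt_ge0. Qed.

(** This is (1 + t)|xi| in the new variables, the size of the phase and the factor lost by each
    derivative of its exponential. *)
Definition rho (p : point) : R := theta N p.2 * enorm p.2 * expR p.1.

Lemma rho_ge p : Y p -> expR p.1 <= rho p.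
Proof.
move=> [_ [x0 _]]; rewrite /rho ler_peMl ?expR_ge0// theta_enorm// le_max.
by rewrite (le_trans N1_ge1 (ltW N1N)).
Qed.

Lemma rho_ge1 p : Y p -> 1 <= rho p.
Proof.
move=> Yp; apply: le_trans (rho_ge Yp).
by rewrite -[leLHS]expR0 ler_expR; case: Yp.
Qed.

Lemma Zhyp_txi (xi : 'rV[R]_n) : U xi -> Zhyp N (txi N xi, xi).
Proof.
move=> [x0 _]; split => /=; first by rewrite /txi le_max lexx orbT.
by rewrite -/(theta N xi) theta_enorm// le_max lexx.
Qed.

Definition log_phi j (p : point) : R[i] := (T p)%:C * phi j (T p - 1) p.2.

(** The phase counted from t_xi, after dt = T dy: the lower limit is now 0 for every xi, so that
    frequency derivatives are those of the integrand. *)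
Definition log_phase j : point -> R[i] := primitive (log_phi j).

Lemma log_phi_wsmooth j m : wsmooth Y predT wt m (fun p => theta N p.2 * enorm p.2 * expR p.1) (log_phi j).
Proof.
have := wsmoothM (logtime_wsmooth N_gt0 m) (to_log_wsmooth N_gt0 N1_gt0 N1N (phis j m)).
apply: wsmooth_eqw => p [_ [x0 _]].
by rewrite /zweight /= oppr0 powRr0 mulr1 powRr1 ?enorm_ge0// /logtime mulrAC.
Qed.

Lemma log_phase_wsmooth j m : wsmooth Y predT wt m rho (log_phase j).
Proof.
apply: (@wsmooth_primitive _ _ U _ fwt _ m (fun xi => theta N xi * enorm xi) (@expR R) (@expR R) (@expR R) 1).
- exact: Ureg_open.
- by move=> j' xi; exact: fwt_ge0.
- by move=> xi _; rewrite mulr_ge0 ?enorm_ge0// ltW// theta_gt0.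
- by move=> y y0; rewrite mul1r expR_ge0 lerBlDr lerDl expR_ge0.
- exact: log_phi_wsmooth.
Qed.

(** Both sides vanish at y = 0 and have the same y-derivative; the mean value bound with constant 0
    replaces a change of variables in the integral. *)
Lemma log_phaseE j p : Y p -> log_phase j p = phase j (T p - 1) (txi N p.2) p.2.
Proof.
case: p => y xi [/= y0 Uxi].
have Zs : Zhyp N1 (txi N xi, xi).
  by have [s0 sN] := Zhyp_txi Uxi; split => //; apply: le_trans sN; exact: ltW.
have ge z : 0 <= z -> txi N xi <= T (z, xi) - 1 by exact: txi_le_logtime.
pose f z := log_phase j (z, xi) - phase j (T (z, xi) - 1) (txi N xi) xi.
have f0 : f 0 = 0 by rewrite /f logtime0 /log_phase primitive0 phase_id subrr.
suff : f y = 0 by move=> /eqP; rewrite subr_eq0 => /eqP.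
apply/eqP; rewrite -normc_eq0 eq_le normc_ge0 andbT -[f y]subr0 -f0.
have := @mean_value_bound _ 0 y f (fun=> 0) 0 y0.
rewrite mul0r mulr0; apply => [z /andP[z0 zy]|z _]; last by rewrite Normc.normc0.
apply: (cwderW (@segment_ray _ y)).
have lc := wsmooth_cont (log_phi_wsmooth j 0).
have H1 := primitive_time lc Uxi z0.
have td : dquot (within [set h | `[0, +oo[%classic (z + h)] (0 : R)^')
    (fun h => (T (z + h, xi) - 1)%:C) (T (z, xi) - 1)%:C (T (z, xi))%:C.
  have H := proj1 (halfspace_time _ _ _ Uxi) (has_pd_logtime_time (conj z0 Uxi : Y (z, xi))).
  have -> : (T (z, xi) - 1)%:C = (T (z, xi))%:C - 1 :> R[i] by rewrite rmorphB.
  rewrite -[X in dquot _ _ _ X]subr0.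
  by apply: (dquot_near _ (dquotB H (dquot_cst 1))); apply: filterE => h; rewrite rmorphB.
have Pc j' : cont_on (Zhyp N1) (fun p => phi j' p.1 p.2) by exact: wsmooth_cont (phis j' 0).
have H2 : cwder `[0, +oo[ (fun z => phase j (T (z, xi) - 1) (txi N xi) xi) z (log_phi j (z, xi)).
  rewrite /log_phi mulrC /cwder.
  apply: (dquot_cwder_comp (S := `[txi N xi, +oo[) (within_dnbhs_le _) td (phase_time Pc j Zs (ge z z0))).
  by apply/within_dnbhsP; exists 1 => // h _ _; rewrite /= !in_itv/= !andbT; exact: ge.
rewrite -(subrr (log_phi j (z, xi))); exact: (dquotB H1 H2).
Qed.

Lemma phase_txi j p : Y p ->
  kp * p.1 - c <= cIm (log_phase j p) <= km * p.1 + c.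
Proof.
move=> Yp; rewrite log_phaseE//; case: p Yp => y xi [/= y0 Uxi].
have Zs : Zhyp N1 (txi N xi, xi).
  by have [s0 sN] := Zhyp_txi Uxi; split => //; apply: le_trans sN; exact: ltW.
have := phase_bd j Zs (txi_le_logtime N xi y0); rewrite ln_ratio//; exact: theta_gt0.
Qed.

Let wt_rho o (p : point) : R := wt o p * rho p.

Let wt_rho_ge0 o (p : point) : Y p -> 0 <= wt_rho o p.
Proof. by move=> Yp; rewrite mulr_ge0 ?wt_ge0// (le_trans ler01)// rho_ge1. Qed.

Let wt_rho_mono o : exists K : R, forall p, Y p -> 0 <= wt o p /\ wt o p <= K * wt_rho o p.
Proof.
exists 1 => p Yp; rewrite wt_ge0// mul1r; split => //.
by rewrite ler_peMr ?wt_ge0// rho_ge1.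
Qed.

(** The modulus is at most e^(2c + (km - kp) y) by the two-sided bound on the phases, and every
    derivative brings down a derivative of a phase, of size [rho] times the weight. *)
Lemma exp_phase_wsmooth a b m :
  wsmooth Y predT wt_rho m (fun p => expR ((km - kp) * p.1))
    (fun p => cexp ('i * (log_phase b p - log_phase a p))).
Proof.
suff : wsmooth Y predT wt_rho m.+1 (fun p => expR ((km - kp) * p.1))
    (fun p => cexp ('i * (log_phase b p - log_phase a p))) by exact: wsmooth_leq.
pose f p := 'i * (log_phase b p - log_phase a p).
have fs : wsmooth Y predT wt m.+1 rho f.
  by apply: wsmoothZ; apply: wsmoothB => //; exact: log_phase_wsmooth.
have [fc _ fo] := fs.
have /choice[g gP] : forall o, exists g, (forall p, Y p -> has_pd Y o f p (g p)) /\
    wsmooth Y predT wt m (fun p => rho p * wt o p) g.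
  by move=> o; have [g g1 g2] := fo o isT; exists g.
apply: (@wsmooth_cexp _ _ Y predT wt_rho m _ f g) => //.
- by move=> o p _ Yp; exact: (gP o).1.
- move=> o _; apply: (@wsmooth_mono _ _ Y predT wt wt_rho m (fun p => rho p * wt o p) _ _ 1) (gP o).2.
    move=> p Yp; rewrite mul1r mulrC; split => //; exact: wt_rho_ge0.
  by move=> o' _; exact: wt_rho_mono.
- exists (expR (2 * c)) => p Yp; rewrite normc_cexp cRe_iM cImD cImN -expRD ler_expR.
  have /andP[b1 b2] := phase_txi b Yp; have /andP[a1 a2] := phase_txi a Yp.
  rewrite mulrBl; lra.
Qed.

(* The coefficient [B] of the equation of [Q] in logarithmic time. *)
Definition log_coef a b (p : point) : R[i] :=
  'i * (T p)%:C * Rem (T p - 1) p.2 a b * cexp ('i * (log_phase b p - log_phase a p)).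

Lemma log_coefE a b p : Y p ->
  log_coef a b p = (('i * (T p)%:C) *: Pmx (T p - 1) (txi N p.2) p.2) a b.
Proof.
move=> Yp; rewrite mxE /Pmx /dexp mul_mx_diag mul_diag_mx !mxE -!log_phaseE// /log_coef.
by rewrite mulrBr addrC cexpD mulNr; ring.
Qed.

(** The count that fixes the number of derivatives: rho^-k from the remainder, e^((km - kp) y) from
    the exponentials and at most rho^m lost by m derivatives. Since rho >= e^y, the product is at
    most e^(-(k - m - km + kp) y) <= e^-y. *)
Lemma log_coef_wsmooth a b m : (m <= k)%N -> m%:R + (km - kp) + 1 <= k%:R ->
  wsmooth Y predT wt m (fun p => expR (- p.1)) (log_coef a b).
Proof.
move=> mk mk1.
have H1 : wsmooth Y predT wt m (fun p => (rho p)^-1 ^+ k)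
    (fun p => 'i * (T p)%:C * Rem (T p - 1) p.2 a b).
  have := wsmoothM (wsmoothZ 'i (logtime_wsmooth N_gt0 m))
    (to_log_wsmooth N_gt0 N1_gt0 N1N (rems a b m)).
  apply: wsmooth_eqw => p Yp; have [_ [x0 _]] := Yp.
  have t1 : 1 + (T p - 1) = T p by rewrite subrKC.
  rewrite (_ : k%:R + 1 = k%:R + 1%:R :> R)// zweightE//= ?t1 ?logtime_gt0//.
  rewrite expr1 mulrCA divff ?gt_eqF ?logtime_gt0// mulr1 /rho /logtime.
  by congr (_^-1 ^+ _); ring.
have H2 : wsmooth Y predT wt_rho m (fun p => (rho p)^-1 ^+ k)
    (fun p => 'i * (T p)%:C * Rem (T p - 1) p.2 a b).
  apply: (@wsmooth_mono _ _ Y predT wt wt_rho m _ _ _ 1) H1.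
    by move=> p Yp; rewrite mul1r lexx exprn_ge0 ?invr_ge0 ?(le_trans ler01) ?rho_ge1.
  by move=> o _; exact: wt_rho_mono.
have := wsmoothM H2 (exp_phase_wsmooth a b m).
apply: (@wsmooth_absorb _ _ Y predT wt wt_ge0 m _ _ _ rho 1); first exact: rho_ge1.
move=> p Yp; have r0 : 0 < rho p by rewrite (lt_le_trans ltr01)// rho_ge1.
split; first by rewrite mulr_ge0 ?expR_ge0 ?exprn_ge0// invr_ge0 ltW.
have -> : (rho p)^-1 ^+ k * expR ((km - kp) * p.1) * rho p ^+ m
   = ((rho p) ^+ (k - m))^-1 * expR ((km - kp) * p.1).
  have E : (rho p)^-1 ^+ m * rho p ^+ m = 1 by rewrite -exprMn mulVf ?gt_eqF// expr1n.
  rewrite -[in LHS](subnK mk) exprD -exprVn -[RHS]mulr1 -E.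
  by move: (expR _) => e; ring.
apply: (@le_trans _ _ (expR (- ((k - m)%:R * p.1)) * expR ((km - kp) * p.1))).
  rewrite ler_wpM2r ?expR_ge0// expRN expRM_natl lef_pV2 ?posrE ?exprn_gt0 ?expR_gt0//.
  by rewrite lerXn2r ?nnegrE ?expR_ge0 ?(ltW r0)// rho_ge.
rewrite mul1r -expRD ler_expR natrB//.
have : 0 <= (k%:R - (m%:R + (km - kp) + 1)) * p.1.
  by rewrite mulr_ge0// ?subr_ge0//; case: Yp.
by rewrite !(mulrBl, mulrDl) mul1r; move: (km * _) (kp * _) (k%:R * _) (m%:R * _) => *; lra.
Qed.

End Regularity.

Section Amplitude.
Context {R : realType} {n d : nat}.
Local Notation point := (R * 'rV[R]_n)%type.
Local Notation matrix_symbol := (R -> 'rV[R]_n -> 'M[R[i]]_d).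
Variables (M Nd F Rem : matrix_symbol) (lambda : 'I_d -> R -> 'rV[R]_n -> R).
Variables (E : R -> R -> 'rV[R]_n -> 'M[R[i]]_d) (N1 N : R).
Variables (kp km c CR : R) (k : nat).
Local Notation phi := (phi F lambda).
Local Notation phase := (phase F lambda).
Local Notation Pmx := (Pmx F Rem lambda).
Local Notation Qmx := (Qmx M Nd F lambda E).
Hypothesis N1_ge1 : 1 <= N1.
Hypothesis N1N : N1 < N.
Let N1_gt0 : 0 < N1. Proof. exact: lt_le_trans N1_ge1. Qed.
Let N_gt0 : 0 < N. Proof. exact: lt_trans N1N. Qed.
Local Notation U := (Ureg N).
Local Notation Y := (halfspace U).
Local Notation T := (logtime N).
Hypothesis phis : forall j m, wsmooth (Zhyp N1) predT zwt m (zweight 1 0) (fun p => phi j p.1 p.2).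
Hypothesis rems : forall a b m,
  wsmooth (Zhyp N1) predT zwt m (zweight (- k%:R) (k%:R + 1)) (entry Rem a b).
Hypothesis phase_bd : forall (s t : R) xi j, Zhyp N1 (s, xi) -> s <= t ->
  kp * ln ((1 + t) / (1 + s)) - c <= cIm (phase j t s xi) <= km * ln ((1 + t) / (1 + s)) + c.
Hypothesis CR_ge0 : 0 <= CR.
Hypothesis kappa_ge0 : 0 <= km - kp.
Hypothesis k_gt : km - kp + 1 < k%:R.
Hypothesis Remb : forall i j p, Zhyp N1 p ->
  normc (Rem p.1 p.2 i j) <= CR * zweight (- k%:R) (k%:R + 1) p.
Hypothesis N_large : CR * expR (2 * c) / N * (8 * (d%:R + 1) ^+ 2) <= 1.
Hypothesis Fdiag : forall t xi, Zhyp N1 (t, xi) -> is_diag_mx (F t xi).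
Hypothesis Mu : forall t xi, Zhyp N1 (t, xi) -> M t xi \in unitmx.
Hypothesis Ndu : forall t xi, Zhyp N1 (t, xi) -> Nd t xi \in unitmx.
Hypothesis E1 : forall (s : R) xi, 0 <= s -> E s s xi = 1%:M.
Hypothesis VD : forall (s t : R) xi, 0 <= s -> Zopen N1 (t, xi) ->
  mdquot (increments nonneg_time None (t, xi))
    (fun h => invmx (Nd (t + h) xi) *m (invmx (M (t + h) xi) *m E (t + h) s xi))
    (invmx (Nd t xi) *m (invmx (M t xi) *m E t s xi))
    ('i *: ((Dsym lambda t xi + F t xi + Rem t xi)
            *m (invmx (Nd t xi) *m (invmx (M t xi) *m E t s xi)))).

Let phic j : cont_on (Zhyp N1) (fun p => phi j p.1 p.2).
Proof. exact: wsmooth_cont (phis j 0). Qed.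

Lemma Qmx_near_identity (s t : R) xi : Zhyp N (s, xi) -> s <= t ->
  d%:R * cmxnorm (Qmx t s xi - 1%:M) <= 2^-1.
Proof.
move=> Zs st; have [x0 s0] := zone_pos N_gt0 Zs; rewrite /= in x0 s0.
have Os := Zhyp_Zopen N1N Zs; have Z1s := Zopen_Zhyp Os.
have t0 : 0 < 1 + t by lra.
have y0 : 0 <= ln ((1 + t) / (1 + s)).
  by rewrite ln_ge0// ler_pdivlMr// mul1r lerD2l.
pose q y := Qmx ((1 + s) * expR y - 1) s xi.
have q0 : q 0 = 1%:M.
  rewrite /q expR0 mulr1 addrAC subrr add0r.
  by apply: (Qmx_id F lambda Z1s) => //; [exact: Mu|exact: Ndu|apply: E1; case: Zs].
have := ode_near_identity q0 (fun y y0 => Qmx_log phic Fdiag VD Z1s y0 Os)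
  (fun y y0 => Pmx_bound N1_ge1 phase_bd CR_ge0 kappa_ge0 k_gt Remb (ltW N1N) Zs y0)
  N_large y0.
by rewrite /q time_log.
Qed.

Lemma Qmx_bounds (s t : R) xi : Zhyp N (s, xi) -> s <= t ->
  [/\ Qmx t s xi \in unitmx, cmxnorm (Qmx t s xi) <= 2 & cmxnorm (invmx (Qmx t s xi)) <= 2].
Proof.
move=> Zs st; have Q1 := Qmx_near_identity Zs st.
have [Qu Qi] := near_identity_unit Q1; have I1 := @cmxnorm1 R d; split => //; last by lra.
move: (Qmx t s xi) Q1 => Q Q1; apply: cmxnorm_le => // i j.
have d0 : (0 < d)%N by apply: leq_ltn_trans (ltn_ord i).
have d1 : 1 <= d%:R :> R by rewrite ler1n.
have h1 := cmxnorm_ge0 (Q - 1%:M).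
have h2 : cmxnorm (Q - 1%:M) <= d%:R * cmxnorm (Q - 1%:M) by rewrite ler_peMl.
apply: le_trans (cmxnorm_entry Q i j) _.
rewrite -[Q](subrK 1%:M); apply: le_trans (cmxnormD _ _) _; lra.
Qed.

(** [ode_wsmooth] on the half-space, with the a priori bound 2 of [Qmx_bounds], and then the return
    to (t, xi). *)
Lemma Qmx_wsmooth a b m : (m <= k)%N -> m%:R + (km - kp) + 1 <= k%:R ->
  wsmooth (zone_reg N) isSome zwt m (fun=> 1) (entry (fun t xi => Qmx t (txi N xi) xi) a b).
Proof.
move=> mk mk1.
pose V (p : point) := Qmx (T p - 1) (txi N p.2) p.2.
pose B (p : point) := ('i * (T p)%:C) *: Pmx (T p - 1) (txi N p.2) p.2.
have Bs i j : wsmooth Y predT (hwt fwt) m (fun p => expR (- p.1)) (fun p => B p i j).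
  apply: (wsmooth_eq (f := log_coef F Rem lambda N i j)) => [p Yp|].
    exact: (log_coefE Rem N1_ge1 N1N phis).
  exact: (log_coef_wsmooth N1_ge1 N1N phis rems phase_bd).
have Zs (xi : 'rV[R]_n) : U xi -> Zhyp N (txi N xi, xi) by exact: Zhyp_txi.
have Vs : wsmooth Y predT (hwt fwt) m (fun=> 1) (fun p => V p a b).
  have V0 xi : U xi -> V (0, xi) = 1%:M.
    move=> Uxi; rewrite /V logtime0.
    have Os := Zopen_Zhyp (Zhyp_Zopen N1N (Zs xi Uxi)).
    by apply: (Qmx_id F lambda Os) => //; [exact: Mu|exact: Ndu|apply: E1; case: Os].
  have Vb p : Y p -> [/\ V p \in unitmx, cmxnorm (V p) <= 2 & cmxnorm (invmx (V p)) <= 2].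
    by case: p => y xi [y0 Uxi]; apply: Qmx_bounds; [exact: Zs|exact: txi_le_logtime].
  have Vd p : Y p ->
      mdquot (increments Y None p) (fun h => V (p + h *: dir None)) (V p) (B p *m V p).
    case: p => y xi [/= y0 Uxi] i j.
    apply/(@halfspace_time _ _ U (fun p => V p i j)) => //.
    have Os := Zhyp_Zopen N1N (Zs xi Uxi).
    exact: (Qmx_log phic Fdiag VD (Zopen_Zhyp Os) y0 Os).
  have Bc i j : cont_on Y (fun p => B p i j) by exact: wsmooth_cont (Bs i j).
  have w0 (j : 'I_n) xi : U xi -> 0 <= fwt j xi by exact: fwt_ge0.
  exact: (ode_wsmooth (@Ureg_open _ _ N) (ler0n R 2) V0 Vd Vb Bc w0 Bs).1.
apply: (wsmooth_eq (f := fun p => V (logcoord N p, p.2) a b)); last first.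
  exact: (from_log_wsmooth N_gt0 Vs).
move=> p Dp; rewrite /V /entry /= logcoordK//.
by have [] := zone_pos N_gt0 Dp.1.
Qed.

End Amplitude.

(** * Choice of constants and conclusion *)

Section Assembly.
Context {R : realType} {n d : nat}.
Local Notation point := (R * 'rV[R]_n)%type.
Local Notation matrix_symbol := (R -> 'rV[R]_n -> 'M[R[i]]_d).

(** If kp > km, the lower and upper bounds of the subprincipal condition cross for a large
    logarithm; [L] makes their gap exceed |Cp - Cm|. A nonzero frequency and an index are required
    for the condition to say anything. *)
Lemma kappa_nonneg (A Ahom M : matrix_symbol) (kp km : R) (xi : 'rV[R]_n) (j : 'I_d) :
  subprincipal A Ahom M kp km -> xi != 0 -> 0 <= km - kp.
Proof.
move=> [Ns [Cp [Cm [Ns0 sub]]]] xi0; rewrite leNgt; apply/negP => neg.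
pose L := (`|Cp - Cm| + 1) / (kp - km).
have kk : 0 < kp - km by lra.
have L0 : 0 <= L by apply: divr_ge0; [exact: addr_ge0|exact: ltW].
have s0 : 0 < 1 + txi Ns xi.
  by rewrite ltr_pwDl// /txi le_max lexx orbT.
have st : txi Ns xi <= (1 + txi Ns xi) * expR L - 1.
  by rewrite lerBrDl ler_peMr ?(ltW s0)// -[leLHS]expR0 ler_expR.
have [h1 h2] := sub xi _ _ j xi0 (lexx _) st; have h := le_trans h1 h2.
move: h; rewrite ln_ratio//.
have : (kp - km) * L = `|Cp - Cm| + 1 by rewrite mulrC divfK// gt_eqF.
have := ler_norm (Cm - Cp); rewrite distrC mulrBl; move: (kp * L) (km * L) => *; lra.
Qed.

(** Regularity of the eigenvalues is read off from M^-1 Ahom M, and the term [F] of lower order fits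
    the larger weight because (1 + t)|xi| >= 1. *)
Lemma phi_wsmooth (Ahom M F : matrix_symbol) (lambda : 'I_d -> R -> 'rV[R]_n -> R) (N m : _) j :
  1 <= N ->
  (forall t xi, Zhyp N (t, xi) -> invmx (M t xi) *m Ahom t xi *m M t xi = Dsym lambda t xi) ->
  (forall i j, wsmooth (Zhyp N) predT zwt m (zweight 1 0) (entry Ahom i j)) ->
  (forall i j, wsmooth (Zhyp N) predT zwt m (zweight 0 0) (entry M i j)) ->
  (forall i j, wsmooth (Zhyp N) predT zwt m (zweight 0 0) (entry (fun t xi => invmx (M t xi)) i j)) ->
  (forall i j, wsmooth (Zhyp N) predT zwt m (zweight 0 1) (entry F i j)) ->
  wsmooth (Zhyp N) predT zwt m (zweight 1 0) (fun p => phi F lambda j p.1 p.2).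
Proof.
move=> N1 MD As Ms iMs Fs; have N0 : 0 < N by exact: lt_le_trans N1.
have z00 (p : point) : zweight 0 0 p = 1 by rewrite /zweight oppr0 !powRr0 mulr1.
have wt0 o (p : point) : Zhyp N p -> 0 <= zwt o p by exact: zwt_ge0.
apply: (wsmooth_eq (f := fun p => (invmx (M p.1 p.2) *m Ahom p.1 p.2 *m M p.1 p.2) j j + F p.1 p.2 j j)).
  by move=> [t xi] Zp; rewrite MD// /phi !mxE.
apply: wsmoothD => //.
  have := @wsmooth_mulmx _ _ _ _ _ m _ _ _ _ _ (fun p => invmx (M p.1 p.2) *m Ahom p.1 p.2)
    (fun p => M p.1 p.2) (@wsmooth_mulmx _ _ _ _ _ m _ _ _ _ _ (fun p => invmx (M p.1 p.2))
    (fun p => Ahom p.1 p.2) iMs As) Ms j j.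
  by apply: wsmooth_eqw => p _; rewrite !z00 mul1r mulr1.
apply: (@wsmooth_weight _ _ _ _ _ wt0 _ _ _ _ 1) (Fs j j) => p Zp.
have [x0 p0] := zone_pos N0 Zp.
rewrite zweight_ge0; split => //; rewrite mul1r /zweight oppr0 !powRr0 mul1r mulr1 powRr1 ?enorm_ge0//.
rewrite powRN powRr1 ?(ltW p0)// -[leLHS]mul1r ler_pdivrMr// mulrC.
by case: Zp => _; exact: le_trans.
Qed.

End Assembly.

Lemma xi_differentiable_set0 {R : realType} {n : nat} (D : set (R * 'rV[R]_n)) (r : R) f :
  D = set0 -> xi_differentiable_on D r f.
Proof.
move=> ->; split => // w t _.
by rewrite (_ : [set xi | _] = set0) ?predeqE//; split; exact: continuous_subspace0.
Qed.

Lemma representation {R : realType} d (M N M' N' e e' E : 'M[R[i]]_d) :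
  M \in unitmx -> N \in unitmx -> M' \in unitmx -> N' \in unitmx -> e *m e' = 1%:M ->
  E = M *m N *m e *m (e' *m (invmx N *m (invmx M *m E)) *m (M' *m N')) *m invmx N' *m invmx M'.
Proof.
move=> Mu Nu Mu' Nu' ee'.
have -> : e' *m (invmx N *m (invmx M *m E)) *m (M' *m N')
    = e' *m (invmx N *m (invmx M *m (E *m M' *m N'))) by rewrite -!mulmxA.
rewrite -(mulmxA (M *m N)) (mulmxA e) ee' mul1mx -(mulmxA M) mulKVmx// mulKVmx//.
by rewrite mulmxK// mulmxK.
Qed.

Lemma prod_zwt {R : realType} {n : nat} (alpha : {ffun 'I_n -> nat}) (p : R * 'rV[R]_n) :
  \prod_(j <- mi_word alpha) zwt (Some j) p = enorm p.2 `^ (- (mi_size alpha)%:R).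
Proof.
by rewrite big_const_seq count_predT size_mi_word iter_mulr_1 powRN powR_mulrn ?enorm_ge0// exprVn.
Qed.

Theorem theorem3p6 (R : realType) (n d : nat)
    (A Ahom M : R -> 'rV[R]_n -> 'M[R[i]]_d)
    (lambda : 'I_d -> R -> 'rV[R]_n -> R)
    (E : R -> R -> 'rV[R]_n -> 'M[R[i]]_d)
    (kappap kappam : R)
    (Nd F Rem : nat -> R -> 'rV[R]_n -> 'M[R[i]]_d)
    (k : nat) :
  fundamental_solution A E ->
  uniformly_strictly_hyperbolic A Ahom lambda ->
  diagonaliser Ahom lambda M ->
  subprincipal A Ahom M kappap kappam ->
  diagonalisation_scheme A Ahom lambda M Nd F Rem ->
  kappam - kappap + 1 < k%:R ->
  exists2 N : R, 0 < N &
  exists Q : R -> R -> 'rV[R]_n -> 'M[R[i]]_d,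
  [/\ forall t xi, Zhyp N (t, xi) ->
        E t (txi N xi) xi =
          M t xi *m Nd k t xi *m Etilde lambda (F k.-1) t (txi N xi) xi
          *m Q t (txi N xi) xi
          *m invmx (Nd k (txi N xi) xi) *m invmx (M (txi N xi) xi),
      exists C : R, forall t xi, Zhyp N (t, xi) ->
        cmxnorm (Etilde lambda (F k.-1) t (txi N xi) xi)
        <= C * ((1 + t) / (1 + txi N xi)) `^ (- kappap),
      exists C : R, forall (t s : R) xi, Zhyp N (s, xi) -> s <= t ->
        [/\ cmxnorm (Q t s xi) <= C,
            Q t s xi \in unitmx &
            cmxnorm (invmx (Q t s xi)) <= C] &
      (* xi |-> txi N xi has a kink on |xi| = N; away from that sphere: *)
      let D := Zhyp N `&` [set p | enorm p.2 != N] in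
      let q := fun t xi => Q t (txi N xi) xi in
      let r := k%:R - 1 + kappap - kappam in
      (forall i j, xi_differentiable_on D r (entry q i j)) /\
      exists C : R, forall (alpha : {ffun 'I_n -> nat}) t xi,
        (mi_size alpha)%:R <= r -> D (t, xi) ->
        cmxnorm (Dxi_mx D alpha q t xi) <= C * enorm xi `^ (- (mi_size alpha)%:R)].
Proof.
move=> Efs [sAh _ _ _ _] [biM MD] sub scheme kgt.
(* By [kappa_nonneg] this case leaves no pair of a zone point and an index, so that every entrywise
   claim is vacuous and Q = I will do. *)
have [kap0|kap0] := ltP (kappam - kappap) 0.
  have empty (N : R) (p : R * 'rV[R]_n) (j : 'I_d) : 0 < N -> ~ Zhyp N p.
    move=> N0 /(enorm_gt0 p.2 N0)/enorm_neq0 x0.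
    by have := kappa_nonneg j sub x0; rewrite leNgt kap0.
  exists 1 => //; exists (fun _ _ _ => 1%:M); split.
  - by move=> t xi Z; apply/matrixP => i; case: (empty 1 (t, xi) i).
  - exists 0 => t xi Z; rewrite mul0r; apply: cmxnorm_le => // i.
    by case: (empty 1 (t, xi) i).
  - exists 0 => t s xi Z _; split.
    + by apply: cmxnorm_le => // i; case: (empty 1 (s, xi) i).
    + exact: unitmx1.
    + by apply: cmxnorm_le => // i; case: (empty 1 (s, xi) i).
  - split=> [i j|].
      apply: xi_differentiable_set0; apply/seteqP; split => // p [Z _].
      by case: (empty 1 p i).
    exists 0 => alpha t xi _ [Z _]; rewrite mul0r; apply: cmxnorm_le => // i.
    by case: (empty 1 (t, xi) i).
have k1 : (1 <= k)%N by rewrite -(ltr0n R); apply: le_lt_trans kgt; rewrite addr_ge0.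
case: biM => sM Mu siM; case: scheme => F0E _ Fcorr Skk Sop.
have [[_ Ndu siN] Fd sF sR] := Skk k k1; have [_ _ sF0 _] := Skk 1%N isT.
have [Ns [Cp [Cm [Ns0 subp]]]] := sub.
have ge1 : \forall N \near +oo, 1 <= N /\ Ns <= N.
  by apply: filterI; apply: nbhs_pinfty_ge; exact: num_real.
have dc := diagonal_corrections k.-1 (fun k k1 => (Fcorr k k1).1).
have fI (P Q : set R) : (\forall N \near +oo, P N) -> (\forall N \near +oo, Q N) ->
    \forall N \near +oo, P N /\ Q N by exact: filterI.
(* A single [N1] for which all hypotheses and symbol estimates hold together; the constants [c] and
   [CR] below refer to it. *)
have := fI _ _ ge1 (fI _ _ dc (fI _ _ (symbol_mx_near sM) (fI _ _ (symbol_mx_near siM)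
  (fI _ _ (symbol_mx_near sAh) (fI _ _ (symbol_mx_near siN) (fI _ _ (symbol_mx_near sF)
  (fI _ _ (symbol_mx_near sR) (fI _ _ (symbol_mx_near sF0) (fI _ _ (in_some_Zhyp_near Mu)
  (fI _ _ (in_some_Zhyp_near MD) (fI _ _ (in_some_Zhyp_near Ndu) (fI _ _ (in_some_Zhyp_near Fd)
  (fI _ _ (in_some_Zhyp_near F0E) (in_some_Zhyp_near (Sop k k1))))))))))))))).
move=> /filter_ex[N1 [[N11 NsN1] [[C0 C00 C0P] [sM1 [siM1 [sAh1 [siN1 [sF1 [sR1 [sF01
  [Mu1 [MD1 [Ndu1 [Fd1 [F0E1 Sop1]]]]]]]]]]]]]]].
have N10 : 0 < N1 by exact: lt_le_trans N11.
have phis j m : wsmooth (Zhyp N1) predT zwt m (zweight 1 0) (fun p => phi (F k.-1) lambda j p.1 p.2).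
  exact: (@phi_wsmooth R n d Ahom M (F k.-1) lambda N1 m j N11 MD1).
have phic j : cont_on (Zhyp N1) (fun p => phi (F k.-1) lambda j p.1 p.2).
  exact: wsmooth_cont (phis j 0%N).
have F0c j : cont_on (Zhyp N1) (fun p => F 0%N p.1 p.2 j j).
  exact: wsmooth_cont (sF01 j j 0%N).
have subF0 xi (s t : R) j : xi != 0 -> txi Ns xi <= s -> Zhyp N1 (s, xi) -> s <= t ->
    let I := cIm (cintegral s t (fun tau => F 0%N tau xi j j)) in
    kappap * ln ((1 + t) / (1 + s)) + Cp <= I /\ I <= kappam * ln ((1 + t) / (1 + s)) + Cm.
  move=> x0 ts Zs st; rewrite (@cintegral_eq _ _ _ _ (fun tau => F0sym A Ahom M tau xi j j)).
    exact: subp.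
  by move=> tau /andP[/(Zhyp_up Zs) Zt _]; rewrite F0E1.
have [c c0 phase_bd] := phase_growth N11 phic F0c C00 (fun j p Zp => C0P j j p Zp) NsN1 subF0.
have [CR CR0 CRP] := wsmooth_mx_bound (fun i j => sR1 i j 0%N).
have Remb i j p : Zhyp N1 p -> normc (Rem k p.1 p.2 i j) <= CR * zweight (- k%:R) (k%:R + 1) p.
  by move=> Zp; rewrite -[X in _ * X]ger0_norm ?zweight_ge0//; exact: CRP.
(* The last term meets the smallness condition of [ode_near_identity] for beta = CR e^(2c) / N, and
   N1 + 1 makes the nesting of the zones strict. There is no circularity: [c] and [CR] depend on
   [N1] only. *)
pose N := N1 + 1 + CR * expR (2 * c) * (8 * (d%:R + 1) ^+ 2).
have K0 : 0 <= CR * expR (2 * c) * (8 * (d%:R + 1) ^+ 2).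
  by rewrite !mulr_ge0 ?expR_ge0 ?exprn_ge0 ?addr_ge0.
have N1N : N1 < N by rewrite /N; lra.
have N0 : 0 < N by exact: lt_trans N1N.
have N_large : CR * expR (2 * c) / N * (8 * (d%:R + 1) ^+ 2) <= 1.
  by rewrite mulrAC ler_pdivrMr// mul1r /N; lra.
have exN (B : R -> 'rV[R]_n -> 'M[R[i]]_d) :
    (forall i j m, wsmooth (Zhyp N1) predT zwt m (zweight 0 0) (entry B i j)) ->
    forall p i j, Zhyp N1 p -> partial_exists (Zhyp N1) None (entry B i j) p.
  move=> Bs p i j Zp; have [_ _ /(_ None isT)[fo fop _]] := Bs i j 1%N.
  exact: has_pd_exists (fop p Zp).
have VD := @transformed_ode _ _ _ A Ahom M (Nd k) (F k.-1) (Rem k) lambda E N1 Efs Mu1 MD1 Ndu1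
  (exN _ siM1) (exN _ siN1) Sop1.
have E1 (s : R) xi : 0 <= s -> E s s xi = 1%:M by move=> /(Efs _ xi)[].
have Qb := @Qmx_bounds _ _ _ M (Nd k) (F k.-1) (Rem k) lambda E N1 N kappap kappam c CR k
  N11 N1N phis phase_bd CR0 kap0 kgt Remb N_large Fd1 Mu1 Ndu1 E1 VD.
have Zs (t : R) (xi : 'rV[R]_n) : Zhyp N (t, xi) -> [/\ Zhyp N (txi N xi, xi), Zhyp N1 (txi N xi, xi) & txi N xi <= t].
  move=> Zt; have [x0 _] := zone_pos N0 Zt; rewrite /= in x0.
  have Z : Zhyp N (txi N xi, xi).
    split => /=; first by rewrite /txi le_max lexx orbT.
    by rewrite -/(theta N xi) theta_enorm// le_max lexx.
  by split => //; [exact: Zopen_Zhyp (Zhyp_Zopen N1N Z)|exact: txi_le].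
have EtE (t s : R) xi : Etilde lambda (F k.-1) t s xi = dexp (F k.-1) lambda 'i t s xi by [].
exists N => //; exists (Qmx M (Nd k) (F k.-1) lambda E); split.
- move=> t xi Zt; have [_ Z1 st] := Zs t xi Zt; have Z1t := Zhyp_up Z1 st.
  move: (txi N xi) Z1 st => s Z1 st; rewrite EtE /Qmx.
  apply: representation; [exact: Mu1|exact: Ndu1|exact: Mu1|exact: Ndu1|].
  by rewrite dexpM subrr dexp0.
- exists (expR c) => t xi Zt; have [_ Z1 st] := Zs t xi Zt; rewrite EtE.
  exact: (dexp_bound phase_bd).
- by exists 2 => t s xi Z st; have [? ? ?] := Qb _ _ _ Z st.
pose r := k%:R - 1 + kappap - kappam.
(* The order r is real; an integer order is at most r exactly when it is at most its integer part m,
   and m <= r is the condition m + kappa + 1 <= k of [log_coef_wsmooth]. *)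
pose m := Num.truncn r.
have r0 : 0 <= r by rewrite /r; lra.
have mr : m%:R <= r < m.+1%:R by rewrite truncn_itv.
have rm (l : nat) : l%:R <= r -> (l <= m)%N.
  by move=> lr; rewrite -ltnS -(ltr_nat R); case/andP: mr => _; exact: le_lt_trans.
have mk1 : m%:R + (kappam - kappap) + 1 <= k%:R.
  by case/andP: mr => + _; rewrite /r; lra.
have mk : (m <= k)%N by rewrite -(ler_nat R); lra.
have Qs a b := @Qmx_wsmooth _ _ _ M (Nd k) (F k.-1) (Rem k) lambda E N1 N kappap kappam c CR k
  N11 N1N phis sR1 phase_bd CR0 kap0 kgt Remb N_large Fd1 Mu1 Ndu1 E1 VD a b m mk mk1.
split.
  move=> i j; exact: (wsmooth_xi_differentiable (@zone_reg_proper _ _ _ N0) rm (Qs i j)).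
have /choice[C CP] : forall ij : 'I_d * 'I_d, exists C : R, 0 <= C /\
    forall (alpha : {ffun 'I_n -> nat}) p, (mi_size alpha)%:R <= r -> zone_reg N p ->
    normc (Dxi (zone_reg N) alpha (entry (fun t xi => Qmx M (Nd k) (F k.-1) lambda E t (txi N xi) xi) ij.1 ij.2) p)
    <= C * `|1 * \prod_(j <- mi_word alpha) zwt (Some j) p|.
  move=> [i j] /=.
  have [C C00' CP] := wsmooth_Dxi_bound (@zone_reg_proper _ _ _ N0) rm (Qs i j).
  by exists C.
exists (\sum_ij C ij) => alpha t xi ar Dp.
have S0 : 0 <= \sum_ij C ij by apply: sumr_ge0 => ij _; have [] := CP ij.
apply: cmxnorm_le => [|i j]; first by rewrite mulr_ge0// powR_ge0.
rewrite mxE; have [C1 /(_ alpha (t, xi) ar Dp)] := CP (i, j); move/le_trans; apply.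
rewrite mul1r prod_zwt ger0_norm ?powR_ge0// ler_wpM2r ?powR_ge0//.
by rewrite (bigD1 (i, j))//= lerDl sumr_ge0// => ij _; have [] := CP ij.
Qed.
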